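(* Let $n\ge 1$ be an integer and let $P_1,P_2,Q_1,Q_2,I_1,I_2,J_1,J_2\subseteq[n]$ be nonempty with $|P_k|=|Q_k|$ and $|I_k|=|J_k|$ for $k=1,2$, and $|P_1|+|P_2|=|I_1|+|I_2|=n$. Define $$R_1:=P_1\cup(2n+1-Q_2),\quad R_2:=P_2\cup(2n+1-Q_1),\quad K_1:=I_1\cup(2n+1-J_2),\quad K_2:=I_2\cup(2n+1-J_1),$$ and $M:=(R_1\setminus R_2)\cup(R_2\setminus R_1)$. Then statement (6) below is equivalent to each of (1), (2), (3): (1) For all $n\times n$ totally nonnegative matrices $A$, $\det A(P_1|Q_1)\det A(P_2|Q_2)\le\det A(I_1|J_1)\det A(I_2|J_2)$. (2) For all $2n\times 2n$ totally nonnegative matrices $B$, $\det B(R_1|R_1)\det B(R_2|R_2)\le\det B(K_1|K_1)\det B(K_2|K_2)$. (3) The multisets $R_1\cup R_2$ and $K_1\cup K_2$ are equal, and for all even contiguous $S\subseteq M$, $\max\{|S\cap R_1|,|S\cap R_2|\}\ge\max\{|S\cap K_1|,|S\cap K_2|\}$. (6) There exist $P,Q,I,J\subseteq[n]$ with $|P|=|Q|=|P_1|$ and $|I|=|J|=|I_1|$ such that, for all $n\times n$ totally nonnegative matrices $A$, $$\det A(P|Q)\,\det A(P^{\mathsf c}|Q^{\mathsf c})\ \le\ \det A(I|J)\,\det A(I^{\mathsf c}|J^{\mathsf c});$$ moreover, there exist integers $k_r,k_c\ge 1$ and integer pairs $(u_i,v_i)$, $i\in[k_r]$, and $(u_j',v_j')$,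 $j\in[k_c]$, in $[n]$, with each $u_i\in\{v_i-1,v_i,v_i+1\}$ and each $u_j'\in\{v_j'-1,v_j',v_j'+1\}$, such that the composite operation $$\mathrm R_{(u_{k_r},v_{k_r})}\circ\cdots\circ\mathrm R_{(u_1,v_1)}\circ\mathrm C_{(u'_{k_c},v'_{k_c})}\circ\cdots\circ\mathrm C_{(u'_1,v'_1)}$$ applied to the displayed inequality results in the inequality $\det A(P_1|Q_1)\det A(P_2|Q_2)\le\det A(I_1|J_1)\det A(I_2|J_2)$.
   Context: $[m]=\{1,\dots,m\}$; for $X\subseteq[n]$, $X^{\mathsf c}=[n]\setminus X$. For an integer $l$ and a set $X$ of integers, $l-X:=\{l-x:x\in X\}$. Equality of the multisets $R_1\cup R_2$ and $K_1\cup K_2$ means that every integer lies in the same number of the sets $R_1,R_2$ as of the sets $K_1,K_2$. For $M=\{m_1<\cdots<m_t\}$, a subset $S\subseteq M$ is contiguous in $M$ if $S=\{m_s:s\in L\}$ for some interval of integers $L\subseteq[t]$; it is even if $|S|$ is even. $A(X|Y)$ is the submatrix with row indices in $X$ and column indices in $Y$ (increasing order); the empty determinant is $1$. A real matrix is totally nonnegative (TN) if the determinant of each of its square submatrices is $\ge 0$. For a set $X$ of indices and $|u-v|=1$, $X(u,v):=(X\setminus\{u\})\cup\{v\}$ if $u\in X$ and $v\notin X$, and $X(u,v):=X$ otherwise. For $|u-v|=1$ the index-row operation $\mathrm R_{(u,v)}$ acts on a formal determinantal expression (built from products of minors $\det A(X|Y)$, signs and relation symbols) as follows: in every minor the row index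 set $X$ is replaced by $X(u,v)$; for each product of minors occurring in the expression (on either side) count the number of its minors for which $u\in X$ and $v\notin X$; the products for which this count equals its maximum over all products in the expression are kept (with the new row sets), and the products with a smaller count are replaced by $0$; all other symbols are unchanged. Products already replaced by $0$ are not taken into account in later operations. The index-column operation $\mathrm C_{(u,v)}$ is defined in the same way, acting on the column index sets. $\mathrm R_{(u,u)}$ and $\mathrm C_{(u,u)}$ are the identity operations. ''Results in'' means that the resulting formal expression is the stated one. *)

(* Defs.v *)
From HB Require Import structures.
From mathcomp Require Import all_boot all_order all_algebra.
From mathcomp Require Import reals.

Set Implicit Arguments.
Unset Strict Implicit.
Unset Printing Implicit Defensive.

Import Order.TTheory GRing.Theory Num.Theory.
Local Open Scope ring_scope.

(* The index set [n] = {1, ..., n} is represented by 'I_n, so the mathematical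
   index i is the ordinal of value i - 1. *)

(* [enum_val] lists a set of ordinals in increasing order.  The value 0 is
   used only when [#|X| != #|Y|]. *)
Definition minor (R : realType) (m n : nat) (A : 'M[R]_(m, n))
    (X : {set 'I_m}) (Y : {set 'I_n}) : R :=
  match #|X| =P #|Y| with
  | ReflectT eqXY => \det (mxsub enum_val (enum_val \o cast_ord eqXY) A)
  | ReflectF _ => 0
  end.

Definition totally_nonnegative (R : realType) (m n : nat) (A : 'M[R]_(m, n)) :
    Prop :=
  forall (X : {set 'I_m}) (Y : {set 'I_n}), #|X| = #|Y| -> 0 <= minor A X Y.

Definition minor_ineq (R : realType) (n : nat)
    (X1 Y1 X2 Y2 Z1 W1 Z2 W2 : {set 'I_n}) : Prop :=
  forall A : 'M[R]_n, totally_nonnegative A ->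
    minor A X1 Y1 * minor A X2 Y2 <= minor A Z1 W1 * minor A Z2 W2.

(* X ∪ (2n + 1 - Y): on 1-based indices of [2n], [rev_ord] is
   x |-> 2n + 1 - x. *)
Definition double_set (n : nat) (X Y : {set 'I_n}) : {set 'I_(n + n)} :=
  [set lshift n x | x in X] :|: [set rev_ord (lshift n y) | y in Y].

Definition same_multiset (T : finType) (R1 R2 K1 K2 : {set T}) : Prop :=
  forall x, ((x \in R1) + (x \in R2) = (x \in K1) + (x \in K2))%N.

Definition symdiff (T : finType) (X Y : {set T}) : {set T} :=
  (X :\: Y) :|: (Y :\: X).

(* [enum_val s] is the element of rank s (from 0) of M in increasing order. *)
Definition contiguous (m : nat) (M S : {set 'I_m}) : Prop :=
  exists a b : nat, S = [set enum_val s | s : 'I_#|M| & (a <= s < b)%N].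

(* The formal minor det A(X|Y) is the pair (X, Y); a determinantal expression
   is a word of symbols, each product of minors being a single symbol. *)
Definition formal_minor (n : nat) := ({set 'I_n} * {set 'I_n})%type.

Inductive det_symbol (n : nat) : Type :=
| SymProd of seq (formal_minor n)
| SymZero
| SymPlus | SymMinus
| SymLe | SymLt | SymEq | SymGt | SymGe.

Arguments SymZero {n}.
Arguments SymPlus {n}.
Arguments SymMinus {n}.
Arguments SymLe {n}.
Arguments SymLt {n}.
Arguments SymEq {n}.
Arguments SymGt {n}.
Arguments SymGe {n}.

Definition det_expr (n : nat) := seq (det_symbol n).

Definition formal_ineq (n : nat) (X1 Y1 X2 Y2 Z1 W1 Z2 W2 : {set 'I_n}) :
    det_expr n :=
  [:: SymProd [:: (X1, Y1); (X2, Y2)]; SymLe; SymProd [:: (Z1, W1); (Z2, W2)]].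

Definition movable (n : nat) (u v : 'I_n) (X : {set 'I_n}) : bool :=
  (u \in X) && (v \notin X).

Definition move_set (n : nat) (u v : 'I_n) (X : {set 'I_n}) : {set 'I_n} :=
  if movable u v X then v |: (X :\ u) else X.

(* Symbols other than products contribute 0 to the maximum, which is harmless
   since counts are natural numbers. *)
Definition index_op (n : nat) (hit : pred (formal_minor n))
    (upd : formal_minor n -> formal_minor n) (e : det_expr n) : det_expr n :=
  let top := (\max_(s <- e) (if s is SymProd p then count hit p else 0))%N in
  [seq (if s is SymProd p then
          if count hit p == top then SymProd (map upd p) else SymZero
        else s) | s <- e].

(* For u = v no set is movable, so both operations below are the identity. *)
Definition row_op (n : nat) (u v : 'I_n) : det_expr n -> det_expr n :=
  index_op (fun d => movable u v d.1) (fun d => (move_set u v d.1, d.2)).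

Definition col_op (n : nat) (u v : 'I_n) : det_expr n -> det_expr n :=
  index_op (fun d => movable u v d.2) (fun d => (d.1, move_set u v d.2)).

(* The head of the list of index pairs is applied first. *)
Definition row_ops (n : nat) (s : seq ('I_n * 'I_n)) (e : det_expr n) :
    det_expr n :=
  foldl (fun e' uv => row_op uv.1 uv.2 e') e s.

Definition col_ops (n : nat) (s : seq ('I_n * 'I_n)) (e : det_expr n) :
    det_expr n :=
  foldl (fun e' uv => col_op uv.1 uv.2 e') e s.

Definition near_pair (n : nat) (uv : 'I_n * 'I_n) : bool :=
  [|| uv.1.+1 == uv.2 :> nat, uv.1 == uv.2 | uv.1 == uv.2.+1 :> nat].

Definition tn_ineq (R : realType) (n : nat)
    (P1 P2 Q1 Q2 I1 I2 J1 J2 : {set 'I_n}) : Prop :=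
  minor_ineq R P1 Q1 P2 Q2 I1 J1 I2 J2.

Definition principal_tn_ineq (R : realType) (m : nat) (R1 R2 K1 K2 : {set 'I_m}) :
    Prop :=
  minor_ineq R R1 R1 R2 R2 K1 K1 K2 K2.

Definition contiguous_set_condition (m : nat) (R1 R2 K1 K2 : {set 'I_m}) : Prop :=
  same_multiset R1 R2 K1 K2 /\
  forall S : {set 'I_m},
    S \subset symdiff R1 R2 -> contiguous (symdiff R1 R2) S -> ~~ odd #|S| ->
    (maxn #|S :&: K1| #|S :&: K2| <= maxn #|S :&: R1| #|S :&: R2|)%N.

Definition obtained_by_index_ops (R : realType) (n : nat)
    (P1 P2 Q1 Q2 I1 I2 J1 J2 : {set 'I_n}) : Prop :=
  exists P Q I J : {set 'I_n},
    [/\ (#|P| = #|P1| /\ #|Q| = #|P1|) /\ (#|I| = #|I1| /\ #|J| = #|I1|),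
        minor_ineq R P Q (~: P) (~: Q) I J (~: I) (~: J)
      & exists rows cols : seq ('I_n * 'I_n),
        [/\ (1 <= size rows)%N, (1 <= size cols)%N,
            all (@near_pair n) rows, all (@near_pair n) cols
          & row_ops rows
              (col_ops cols (formal_ineq P Q (~: P) (~: Q) I J (~: I) (~: J)))
            = formal_ineq P1 Q1 P2 Q2 I1 J1 I2 J2]].

(* Main.v *)
(* For a pair of sets (X1, X2) let its height at s be
   #{x in X1, x < s} - #{x in X2, x < s}.  Condition (3) says that the two pairs
   have the same multiset and that the height of (K1, K2) is a function of the
   height of (R1, R2).

   For (3) => (1), a totally nonnegative matrix is a product of nonnegative row
   scalings and of chips "add t times a neighbouring row" (Neville elimination),
   and multiplying by these factors one at a time writes the product
   det A(P1|Q1) det A(P2|Q2), as a function of (R1, R2) with a fixed multiset, as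
   a nonnegative combination of indicators "the noncrossing matching m joins
   elements of opposite colours" (Temperley-Lieb immanants).  If (R1, R2) is
   compatible with m, heights agree on both sides of each arc, hence so do the
   heights of (K1, K2), which is then compatible with m as well.

   For (1) => (3), comparing leading coefficients in t shows that a chip move
   u -> v preserves valid inequalities, and that the left side never has more
   moves than the right side because some totally nonnegative matrix makes the
   left side positive.  Moving everything down as far as possible leaves
   configurations for which the condition is visible, after testing the
   inequality on the identity matrix.

   For (3) => (6), the moves are run backwards until all multiplicities are 1:
   an empty position is swapped towards a doubled one, which is then split.  The
   split of the left pair is arbitrary, that of the right pair is dictated by the
   dependence of heights. *)
Require Import Defs.
From HB Require Import structures.
From mathcomp Require Import all_boot all_order all_algebra.
From mathcomp Require Import reals.
From mathcomp Require Import perm.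
From mathcomp Require Import zify ring lra.
From mathcomp Require boolp.

Set Implicit Arguments.
Unset Strict Implicit.
Unset Printing Implicit Defensive.

Import Order.TTheory GRing.Theory Num.Theory.
Local Open Scope ring_scope.

(** * Minors and chips *)

(** Placing the columns after the rows, reversed and with the two sets exchanged, turns a product of
    two minors into a function of one pair of subsets of a line; heights and noncrossing matchings
    live on that line, and chips act on its first half only. The factorization has to cover singular
    matrices: a zero pivot above a nonzero entry turns out to sit in a zero row, so elimination
    never needs a permutation. The obstacle in the necessity part is a coincidence of a row height
    with a column height. A move may change the height at the very cut under observation; the cut is
    then slid to a neighbour of equal height, unless both positions beside it have multiplicity 1.
    Configurations without admissible moves are rigid: equal heights force equal row and column
    sets, so the identity matrix is a meaningful test. In the backward construction the choice
    between the two sets never fails because heights of the left pair differing by 1 correspond to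
    heights of the right pair differing by 1. *)

Definition increasing (k m : nat) (f : 'I_k -> 'I_m) : Prop :=
  forall i j : 'I_k, (i < j)%N -> (f i < f j)%N.

Definition adjacent (m : nat) (u v : 'I_m) : bool :=
  (u.+1 == v :> nat) || (v.+1 == u :> nat).

(** For adjacent [u] and [v], left multiplication by an elementary bidiagonal matrix. *)
Definition chip (R : realType) (m n : nat) (t : R) (u v : 'I_m)
    (A : 'M[R]_(m, n)) : 'M[R]_(m, n) :=
  \matrix_(i, j) (A i j + (if i == u then t * A v j else 0)).

Definition scale_row (R : realType) (m n : nat) (d : R) (u : 'I_m)
    (A : 'M[R]_(m, n)) : 'M[R]_(m, n) :=
  \matrix_(i, j) ((if i == u then d else 1) * A i j).

Lemma increasing_inj (k m : nat) (f : 'I_k -> 'I_m) :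
  increasing f -> injective f.
Proof.
move=> fi i j eq_f; apply/val_inj/eqP; case: ltngtP => // /fi;
by rewrite eq_f ltnn.
Qed.

Lemma increasing_comp (k l m : nat) (f : 'I_k -> 'I_l) (g : 'I_l -> 'I_m) :
  increasing f -> increasing g -> increasing (g \o f).
Proof. by move=> fi gi i j /fi /gi. Qed.

Lemma increasing_lift (k : nat) (i : 'I_k.+1) : increasing (lift i).
Proof. by move=> a b; rewrite /= /bump; lia. Qed.

Lemma sorted_enum_set (m : nat) (X : {set 'I_m}) :
  sorted ltn (map val (enum X)).
Proof.
rewrite /enum_mem -enumT /=.
apply: (@subseq_sorted _ ltn ltn_trans _ (map val (enum 'I_m))).
  exact/map_subseq/filter_subseq.
by rewrite val_enum_ord iota_ltn_sorted.
Qed.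

Lemma enum_set_increasing (k m : nat) (f : 'I_k -> 'I_m) :
  increasing f -> enum [set f i | i in 'I_k] = map f (enum 'I_k).
Proof.
move=> fi; apply: (inj_map val_inj).
apply: (irr_sorted_eq ltn_trans ltnn); first exact: sorted_enum_set.
  rewrite -map_comp (@sorted_map _ _ (val \o f) ltn).
  have := iota_ltn_sorted 0 k; rewrite -val_enum_ord sorted_map.
  by apply: sub_sorted => i j /= /fi.
move=> x; apply/mapP/mapP => -[y].
  by rewrite mem_enum => /imsetP[i _ ->] ->; exists (f i); rewrite ?map_f ?mem_enum.
by case/mapP=> i _ -> ->; exists (f i); rewrite ?mem_enum ?imset_f.
Qed.

Lemma enum_val_imset (k m : nat) (f : 'I_k -> 'I_m)
    (e : k = #|[set f i | i in 'I_k]|) (i : 'I_k) :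
  increasing f -> enum_val (cast_ord e i) = f i.
Proof.
move=> fi; rewrite (enum_val_nth (f i)) enum_set_increasing //=.
by rewrite (nth_map i) ?size_enum_ord // nth_ord_enum.
Qed.

Lemma enum_val_increasing (m : nat) (X : {set 'I_m}) :
  increasing (@enum_val _ (mem X)).
Proof.
move=> i j lt_ij; pose x0 : 'I_m := enum_val i.
rewrite !(enum_val_nth x0) -!(nth_map x0 (val x0) val) -?cardE //.
have /sortedP-/(_ (val x0)) := sorted_enum_set X.
have := sorted_ltn_nth ltn_trans (val x0) (sorted_enum_set X).
by move=> /(_ i j) H _; apply: H; rewrite // inE size_map -cardE.
Qed.

Lemma det_mxsub_cast (R : realType) (m n k k' : nat) (A : 'M[R]_(m, n))
    (f : 'I_k' -> 'I_m) (g : 'I_k' -> 'I_n) (e : k = k') :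
  \det (mxsub (f \o cast_ord e) (g \o cast_ord e) A) = \det (mxsub f g A).
Proof.
case: k' / e f g => f g; congr (\det _); apply/matrixP=> i j.
by rewrite !mxE /= !cast_ord_id.
Qed.

Lemma minorE (R : realType) (m n k : nat) (A : 'M[R]_(m, n))
    (f : 'I_k -> 'I_m) (g : 'I_k -> 'I_n) :
  increasing f -> increasing g ->
  minor A [set f i | i in 'I_k] [set g i | i in 'I_k] = \det (mxsub f g A).
Proof.
move=> fi gi; rewrite /minor.
have cf : k = #|[set f i | i in 'I_k]|.
  by rewrite card_imset ?card_ord //; exact: increasing_inj.
have cg : k = #|[set g i | i in 'I_k]|.
  by rewrite card_imset ?card_ord //; exact: increasing_inj.
case: eqP => [e | ]; last by rewrite -cf -cg.
rewrite -(det_mxsub_cast _ _ _ cf); congr (\det _).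
apply/matrixP=> i j; rewrite !mxE /= enum_val_imset //.
congr (A _ _); rewrite -(enum_val_imset cg j gi); congr (enum_val _).
exact: val_inj.
Qed.

Lemma imset_enum_val (m : nat) (X : {set 'I_m}) :
  [set @enum_val _ (mem X) i | i in 'I_#|X| ] = X.
Proof.
apply/setP=> x; apply/imsetP/idP => [[i _ ->]|Xx]; first exact: enum_valP.
by exists (enum_rank_in Xx x); rewrite ?enum_rankK_in.
Qed.

Lemma set_as_image (m k : nat) (X : {set 'I_m}) : #|X| = k ->
  exists2 f : 'I_k -> 'I_m, increasing f & X = [set f i | i in 'I_k].
Proof.
move=> <-; exists (@enum_val _ (mem X)); first exact: enum_val_increasing.
by rewrite imset_enum_val.
Qed.

Lemma minor_card (R : realType) (m n : nat) (A : 'M[R]_(m, n))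
  (X : {set 'I_m}) (Y : {set 'I_n}) : #|X| != #|Y| -> minor A X Y = 0.
Proof. by rewrite /minor; case: eqP. Qed.

Lemma minor_ind (m n : nat) (P : {set 'I_m} -> {set 'I_n} -> Prop) :
  (forall k (f : 'I_k -> 'I_m) (g : 'I_k -> 'I_n), increasing f ->
     increasing g -> P [set f i | i in 'I_k] [set g i | i in 'I_k]) ->
  forall (X : {set 'I_m}) (Y : {set 'I_n}), #|X| = #|Y| -> P X Y.
Proof.
move=> H X Y; move eY: #|Y| => k /set_as_image[f fi ->].
by have [g gi ->] := set_as_image eY; apply: H.
Qed.

Lemma tnP (R : realType) (m n : nat) (A : 'M[R]_(m, n)) :
  totally_nonnegative A <->
  (forall k (f : 'I_k -> 'I_m) (g : 'I_k -> 'I_n), increasing f ->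
     increasing g -> 0 <= \det (mxsub f g A)).
Proof.
split=> [H k f g fi gi|H]; last first.
  by apply: minor_ind => k f g fi gi; rewrite minorE //; apply: H.
rewrite -minorE //; apply: H.
by rewrite !card_imset //; exact: increasing_inj.
Qed.

Lemma minor_tr (R : realType) (m n : nat) (A : 'M[R]_(m, n))
    (X : {set 'I_m}) (Y : {set 'I_n}) :
  minor A^T Y X = minor A X Y.
Proof.
case: (eqVneq #|X| #|Y|) => [|ne]; last by rewrite !minor_card // eq_sym.
move: X Y; apply: minor_ind => k f g fi gi.
by rewrite !minorE // -det_tr; congr (\det _); apply/matrixP=> i j; rewrite !mxE.
Qed.

Lemma tn_tr (R : realType) (m n : nat) (A : 'M[R]_(m, n)) :
  totally_nonnegative A -> totally_nonnegative A^T.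
Proof. by move=> H X Y e; rewrite minor_tr; apply: H. Qed.

Lemma card_move_set (m : nat) (u v : 'I_m) (X : {set 'I_m}) :
  #|move_set u v X| = #|X|.
Proof.
rewrite /move_set; case: ifP => // /andP[uX vX].
rewrite cardsU1 !inE (negPf vX) andbF /= add1n (cardsD1 u X) uX.
by [].
Qed.

Lemma adjacentC (m : nat) (u v : 'I_m) : adjacent u v = adjacent v u.
Proof. by rewrite /adjacent orbC. Qed.

Lemma increasing_replace (k m : nat) (f : 'I_k -> 'I_m) (u v : 'I_m) :
  increasing f -> adjacent u v -> (forall i, f i != v) ->
  increasing (fun i => if f i == u then v else f i).
Proof.
move=> fi uv nv i j /fi lt_ij; have := nv i; have := nv j; move: uv lt_ij.
by rewrite /adjacent -!(inj_eq val_inj) /=; do 2![case: ifP => /eqP ? //]; lia.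
Qed.

Lemma move_set_imset (k m : nat) (f : 'I_k -> 'I_m) (u v : 'I_m) :
  movable u v [set f i | i in 'I_k] ->
  move_set u v [set f i | i in 'I_k] =
  [set (if f i == u then v else f i) | i in 'I_k].
Proof.
move=> mv; rewrite /move_set mv; case/andP: mv => /imsetP[i0 _ u_i0] _.
apply/setP=> x; rewrite !inE.
apply/idP/imsetP => [/orP[/eqP->|/andP[xu /imsetP[i _ e]]]|[i _ ->]].
- by exists i0; rewrite // -u_i0 eqxx.
- by exists i; rewrite // -e (negPf xu).
- case: (f i =P u) => [_|/eqP->]; first by rewrite eqxx.
  by rewrite imset_f ?orbT.
Qed.

(** Multilinearity in row [u]. The second determinant has a repeated row if [v] already occurs;
    otherwise no index lies strictly between [u] and [v], so the new rows are still in increasing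
    order and no sign appears. *)
Lemma minor_chip (R : realType) (m n : nat) (t : R) (u v : 'I_m)
    (A : 'M[R]_(m, n)) (X : {set 'I_m}) (Y : {set 'I_n}) :
  adjacent u v ->
  minor (chip t u v A) X Y =
  minor A X Y + (if movable u v X then t * minor A (move_set u v X) Y else 0).
Proof.
move=> uv.
have neq_uv : u != v by apply: contraTneq uv => ->; rewrite /adjacent; lia.
case: (eqVneq #|X| #|Y|) => [|ne]; last first.
  by rewrite !minor_card ?card_move_set // mulr0 if_same addr0.
move: X Y; apply: minor_ind => k f g fi gi; rewrite !minorE //.
case: (boolP (u \in [set f i | i in 'I_k])) => [/imsetP[i0 _ u_i0]|uN]; last first.
  rewrite /movable (negPf uN) addr0; congr (\det _); apply/matrixP=> i j.
  rewrite !mxE; case: eqP => [e|]; last by rewrite addr0.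
  by case/negP: uN; rewrite -e imset_f.
pose f' i := if f i == u then v else f i.
have nfu i : i != i0 -> f i != u.
  by apply: contra_neq => e; apply: (increasing_inj fi); rewrite -u_i0.
have nflu i : (f (lift i0 i) == u) = false.
  by apply/negbTE/nfu; rewrite eq_sym neq_lift.
have -> : \det (mxsub f g (chip t u v A)) =
    \det (mxsub f g A) + t * \det (mxsub f' g A).
  rewrite -[X in X + _]mul1r; apply: (determinant_multilinear (i0 := i0)).
  - by apply/rowP=> j; rewrite !mxE /f' -u_i0 eqxx mul1r.
  - by apply/matrixP=> i j; rewrite !mxE nflu addr0.
  - by apply/matrixP=> i j; rewrite !mxE /f' nflu addr0.
congr (_ + _).
have uX : u \in [set f i | i in 'I_k] by rewrite u_i0 imset_f.
rewrite /move_set /movable uX /=; case: (boolP (v \in _)) => [/imsetP[i1 _ v_i1]|vN] /=.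
  have i01 : i0 != i1.
    by apply: contra neq_uv => /eqP e; rewrite u_i0 v_i1 e.
  rewrite (determinant_alternate i01) ?mulr0 // => j.
  by rewrite !mxE /f' -u_i0 eqxx -v_i1 eq_sym (negPf neq_uv).
have nv i : f i != v by apply: contra vN => /eqP <-; rewrite imset_f.
rewrite -minorE //; last exact: increasing_replace.
rewrite -move_set_imset //; first by rewrite /move_set /movable uX vN.
by rewrite /movable uX vN.
Qed.

Lemma tn_chip (R : realType) (m n : nat) (t : R) (u v : 'I_m)
    (A : 'M[R]_(m, n)) :
  adjacent u v -> 0 <= t ->
  totally_nonnegative A -> totally_nonnegative (chip t u v A).
Proof.
move=> uv t0 tnA X Y e; rewrite minor_chip // addr_ge0 ?tnA //.
by case: ifP => // _; rewrite mulr_ge0 ?tnA // card_move_set.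
Qed.

Lemma minor_scale_row (R : realType) (m n : nat) (d : R) (u : 'I_m)
    (A : 'M[R]_(m, n)) (X : {set 'I_m}) (Y : {set 'I_n}) :
  minor (scale_row d u A) X Y = d ^+ (u \in X) * minor A X Y.
Proof.
case: (eqVneq #|X| #|Y|) => [|ne]; last by rewrite !minor_card // mulr0.
move: X Y; apply: minor_ind => k f g fi gi; rewrite !minorE //.
case: (boolP (u \in _)) => [/imsetP[i0 _ u_i0]|uN] /=; last first.
  rewrite expr0 mul1r; congr (\det _); apply/matrixP=> i j.
  rewrite !mxE; case: eqP => [e|]; last by rewrite mul1r.
  by case/negP: uN; rewrite -e imset_f.
rewrite expr1.
rewrite (@determinant_multilinear _ _ _ (mxsub f g A) (mxsub f g A) i0 d 0).
- by rewrite mul0r addr0.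
- by apply/rowP=> j; rewrite !mxE -u_i0 eqxx mul0r addr0.
- apply/matrixP=> i j; rewrite !mxE; case: eqP => [e|]; last by rewrite mul1r.
  have := neq_lift i0 i; rewrite -(inj_eq (increasing_inj fi)) -u_i0.
  by rewrite e eqxx.
- apply/matrixP=> i j; rewrite !mxE; case: eqP => [e|]; last by rewrite mul1r.
  have := neq_lift i0 i; rewrite -(inj_eq (increasing_inj fi)) -u_i0.
  by rewrite e eqxx.
Qed.

Lemma tn_scale_row (R : realType) (m n : nat) (d : R) (u : 'I_m)
    (A : 'M[R]_(m, n)) :
  0 <= d -> totally_nonnegative A -> totally_nonnegative (scale_row d u A).
Proof.
by move=> d0 tnA X Y e; rewrite minor_scale_row mulr_ge0 ?exprn_ge0 ?tnA.
Qed.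

Lemma minor1 (R : realType) (n : nat) (X Y : {set 'I_n}) :
  minor (1%:M : 'M[R]_n) X Y = (X == Y)%:R.
Proof.
case: (eqVneq #|X| #|Y|) => [eXY|ne]; last first.
  by rewrite minor_card //; case: (X =P Y) ne => [->|] //; rewrite eqxx.
case: (eqVneq X Y) => [<-|neXY].
  have [k eX] : exists k, #|X| = k by exists #|X|.
  have [f fi ->] := set_as_image eX.
  rewrite minorE // (_ : mxsub _ _ _ = 1%:M) ?det1 //.
  by apply/matrixP=> i j; rewrite !mxE (inj_eq (increasing_inj fi)).
have [x Xx Yx] : exists2 x, x \in X & x \notin Y.
  by apply/subsetPn; apply: contra neXY => sXY; rewrite eqEcard sXY eXY leqnn.
have [k eY] : exists k, #|Y| = k by exists #|Y|.
move: eXY Xx Yx; rewrite eY => eXY.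
have [f fi ->] := set_as_image eXY; have [g gi ->] := set_as_image eY.
rewrite minorE // => /imsetP[i0 _ ->] nY.
rewrite (expand_det_row _ i0) big1 // => j _; rewrite !mxE.
by case: eqP nY => [->|]; rewrite ?mul0r // imset_f.
Qed.

Lemma tn1 (R : realType) (n : nat) : totally_nonnegative (1%:M : 'M[R]_n).
Proof. by move=> X Y _; rewrite minor1 ler0n. Qed.

(** * Whitney's reduction *)

Definition insert_row (R : nzRingType) (k c : nat) (i : 'I_k.+1) (x : 'rV[R]_c)
    (U : 'M[R]_(k, c)) : 'M[R]_(k.+1, c) :=
  \matrix_(a, j) (if unlift i a is Some b then U b j else x ord0 j).

Lemma det_insert_row (R : comNzRingType) (k : nat) (i : 'I_k.+1)
    (x : 'rV[R]_k.+1) (U : 'M[R]_(k, k.+1)) :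
  \det (insert_row i x U) =
  \sum_j x ord0 j * ((-1) ^+ (i + j) * \det (col' j U)).
Proof.
rewrite (expand_det_row _ i); apply: eq_bigr => j _.
rewrite !mxE unlift_none /cofactor; congr (_ * (_ * \det _)).
by apply/matrixP=> a b; rewrite !mxE liftK.
Qed.

Lemma det_insert_row0 (R : comNzRingType) (k : nat) (i : 'I_k.+1)
    (x : 'rV[R]_k.+1) (U : 'M[R]_(k, k.+1)) :
  \det (insert_row i x U) = (-1) ^+ i * \det (insert_row ord0 x U).
Proof.
rewrite !det_insert_row big_distrr; apply: eq_bigr => j _ /=.
by rewrite add0n exprD; ring.
Qed.

(** Laplace expansion along the first column of the square matrix formed by [B *m beta] followed by
    [B], which is singular because that column depends on the others. *)
Lemma sum_minors_combination (R : comNzRingType) (k : nat)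
    (B : 'M[R]_(k.+1, k)) (beta : 'cV[R]_k) :
  \sum_(l < k.+1) (-1) ^+ l * (B *m beta) l ord0 * \det (row' l B) = 0.
Proof.
pose C : 'M[R]_(k.+1) := \matrix_(l, j)
  (if unlift ord0 j is Some j' then B l j' else (B *m beta) l ord0).
have -> : \sum_(l < k.+1) (-1) ^+ l * (B *m beta) l ord0 * \det (row' l B) =
    \det C.
  rewrite (expand_det_col _ ord0); apply: eq_bigr => l _.
  rewrite !mxE unlift_none /cofactor addn0 mulrCA !mulrA.
  congr (_ * \det _); apply/matrixP=> a b; rewrite !mxE.
  by rewrite liftK.
(* Unitriangular column operation that clears the first column of [C]. *)
pose V : 'M[R]_(k.+1) := \matrix_(j, l) (if unlift ord0 j is Some j' then
  (if l == ord0 then - beta j' ord0 else (j == l)%:R) else (j == l)%:R).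
have detV : \det V = 1.
  rewrite det_trig; last first.
    apply/is_trig_mxP => i j lt_ij; rewrite !mxE.
    have /negPf-> : i != j by rewrite -val_eqE /=; case: ltngtP lt_ij.
    by case: unliftP => // i' _; case: eqP lt_ij => // ->.
  apply: big1 => i _; rewrite !mxE; case: unliftP => [i' ->|->]; rewrite eqxx //.
have CV0 : \det (C *m V) = 0.
  rewrite (expand_det_col _ ord0) big1 // => l _.
  rewrite [X in X * _](_ : _ = 0) ?mul0r //.
  rewrite mxE big_ord_recl !mxE unlift_none /= mulr1 -big_split big1 //= => j _.
  by rewrite !mxE liftK /=; ring.
by rewrite -CV0 det_mulmx detV mulr1.
Qed.

(** A three-term Plücker relation between minors of two consecutive orders. The minor [w l],
    obtained by adjoining row [l] to the fixed rows [U], is linear in that row, so [w] is a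
    combination of the columns of [B] and the vanishing alternating sum applies to it. Repeated rows
    kill all terms except those of the rows 0, [p] and [q]. *)
Lemma plucker_flag (R : comNzRingType) (k : nat) (B : 'M[R]_(k.+3, k.+2))
    (y : 'I_k.+2) (i : 'I_k.+1) :
  let j1 := lift ord0 i in
  let j0 : 'I_k.+2 := widen_ord (leqnSn _) i in
  let p := lift ord0 j0 in
  let q := lift ord0 j1 in
  let B' := col' y B in
  \det (row' j1 (row' q B')) * \det (row' ord0 B) +
    \det (row' j0 (row' ord0 B')) * \det (row' q B) =
  \det (row' j1 (row' ord0 B')) * \det (row' p B).
Proof.
move=> j1 j0 p q B'.
pose U : 'M[R]_(k, k.+1) := row' i (row' j1 (row' ord0 B')).
pose w l := \det (insert_row ord0 (row l B') U).
pose beta : 'cV[R]_k.+2 := \col_j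
  (if unlift y j is Some j' then (-1) ^+ j' * \det (col' j' U) else 0).
have wE l : w l = (B *m beta) l ord0.
  rewrite /w det_insert_row [RHS]mxE (bigD1_ord y) //= [beta _ _]mxE unlift_none mulr0 add0r.
  by apply: eq_bigr => j _; rewrite !mxE liftK add0n.
have := sum_minors_combination B beta.
under eq_bigr => l _ do rewrite -wE.
have w0 : w ord0 = \det (row' j1 (row' q B')).
  rewrite /w; congr (\det _); apply/matrixP=> a b; rewrite !mxE.
  case: unliftP => [a' ->|->]; rewrite ?mxE; congr (B _ _); apply/val_inj.
    by rewrite /= /bump; have := ltn_ord a'; lia.
  by rewrite /= /bump; lia.
have wp : w p = (-1) ^+ i * \det (row' j1 (row' ord0 B')).
  rewrite (_ : row' j1 (row' ord0 B') = insert_row i (row p B') U); last first.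
    apply/matrixP=> a b; rewrite !mxE; case: unliftP => [a' ->|->]; rewrite ?mxE;
    congr (B _ _); apply/val_inj => //=.
    by rewrite /= /bump; lia.
  by rewrite (det_insert_row0 i) mulrA -exprD addnn -signr_odd odd_double mul1r.
have wq : w q = (-1) ^+ i * \det (row' j0 (row' ord0 B')).
  rewrite (_ : row' j0 (row' ord0 B') = insert_row i (row q B') U); last first.
    apply/matrixP=> a b; rewrite !mxE; case: unliftP => [a' ->|->]; rewrite ?mxE;
    congr (B _ _); apply/val_inj => //=.
      by rewrite /= /bump; lia.
    by rewrite /= /bump; lia.
  by rewrite (det_insert_row0 i) mulrA -exprD addnn -signr_odd odd_double mul1r.
have wrest l : l != ord0 -> l != p -> l != q -> w l = 0.
  rewrite -!val_eqE /= /bump /= => l0 lp lq.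
  have ltl := ltn_ord l; have lti := ltn_ord i.
  (* [U] lacks the rows 0, [p] and [q = p + 1] of [B'], so row [l] sits at position [l - 1] before
     the gap and at [l - 3] after it. *)
  pose a0 := if (l < p)%N then l.-1 else (l - 3)%N.
  have lta : (a0 < k)%N by rewrite /a0; case: ifP; rewrite /= /bump /=; lia.
  rewrite /w (determinant_alternate (neq_lift ord0 (Ordinal lta))) // => j.
  rewrite !mxE unlift_none liftK !mxE; congr (B _ _); apply/val_inj => /=.
  by rewrite /a0 /= /bump /=; case: ifP; lia.
have qp : q != p by rewrite -val_eqE /= /bump /=; lia.
rewrite (bigD1 ord0) //= (bigD1 p) //= (bigD1 q) ?qp //= big1 => [|l]; last first.
  by case/andP=> /andP[l0 lp] lq; rewrite wrest // mulr0 mul0r.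
rewrite w0 wp wq expr0 mul1r addr0 /= /bump /= !add1n !exprS.
set x := \det _; set e := (-1) ^+ i.
have ee : e * e = 1 by rewrite -exprD addnn -signr_odd odd_double.
set a1 := \det _; set a2 := \det _; set a3 := \det _; set a4 := \det _; set a5 := \det _.
move=> H; have -> : a2 * a3 = a2 * a3 * (e * e) by rewrite ee mulr1.
have -> : a4 * a5 = a4 * a5 * (e * e) by rewrite ee mulr1.
apply/eqP; rewrite -subr_eq0 -[X in _ == X]H; apply/eqP; ring.
Qed.

Definition cons_ord (T : Type) (k : nat) (i : 'I_k.+1) (x : T) (f : 'I_k -> T)
  (a : 'I_k.+1) : T := if unlift i a is Some b then f b else x.

Lemma cons_ord_lift (T : Type) (k : nat) (i : 'I_k.+1) (x : T) (f : 'I_k -> T) b :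
  cons_ord i x f (lift i b) = f b.
Proof. by rewrite /cons_ord liftK. Qed.

Lemma cons_ord_id (T : Type) (k : nat) (i : 'I_k.+1) (x : T) (f : 'I_k -> T) :
  cons_ord i x f i = x.
Proof. by rewrite /cons_ord unlift_none. Qed.

Lemma cons_ord_increasing (k m : nat) (i : 'I_k.+1) (x : 'I_m)
    (f : 'I_k -> 'I_m) :
  increasing f -> (forall a : 'I_k, (a < i)%N -> (f a < x)%N) ->
  (forall a : 'I_k, (i <= a)%N -> (x < f a)%N) -> increasing (cons_ord i x f).
Proof.
move=> fi lo hi a b.
case: (unliftP i a) => [a' ->|->]; case: (unliftP i b) => [b' ->|->];
rewrite ?cons_ord_lift ?cons_ord_id.
- by move=> lt_ab; apply: fi; move: lt_ab; rewrite /= /bump; lia.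
- by move=> lt_ab; apply: lo; move: lt_ab; rewrite /= /bump; lia.
- by move=> lt_ab; apply: hi; move: lt_ab; rewrite /= /bump; lia.
- by rewrite ltnn.
Qed.

Lemma increasing_leq (k m : nat) (f : 'I_k -> 'I_m) (i j : 'I_k) :
  increasing f -> (i <= j)%N -> (f i <= f j)%N.
Proof.
by move=> fi; rewrite leq_eqVlt => /orP[/eqP/val_inj->|/fi/ltnW].
Qed.

(** If the first column lies left of [c], both minors have a zero column; if it is [c], both expand
    along it with the same cofactor. If it lies right of [c], adjoining row [p] and column [c] gives
    a nonnegative minor whose new column has only two nonzero entries at most, and its expansion is
    the inequality. *)
Lemma whitney_base (R : realType) (m n k : nat) (A : 'M[R]_(m, n))
    (p q : 'I_m) (c : 'I_n) (f h : 'I_k.+1 -> 'I_m) (g : 'I_k.+1 -> 'I_n) :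
  totally_nonnegative A -> (p < q)%N ->
  (forall (x : 'I_m) (j : 'I_n), (p <= x)%N -> (j < c)%N -> A x j = 0) ->
  (forall x : 'I_m, (q < x)%N -> A x c = 0) ->
  increasing f -> increasing g -> f ord0 = q -> h ord0 = p ->
  (forall a, a != ord0 -> h a = f a) ->
  A q c * \det (mxsub h g A) <= A p c * \det (mxsub f g A).
Proof.
move=> /tnP tnA pq zcol zlow fi gi f0 h0 hf.
have fq a : (q <= f a)%N by rewrite -f0 increasing_leq.
have ph a : (p <= h a)%N.
  by have [->|/hf->] := eqVneq a ord0; rewrite ?h0 // (leq_trans (ltnW pq)).
have fz a : a != ord0 -> A (f a) c = 0.
  by move=> na; apply: zlow; rewrite -f0; apply: fi; rewrite lt0n; exact: na.
have [|gc] := ltnP (g ord0) c.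
  move=> gc; rewrite !(expand_det_col _ ord0) !big1 ?mulr0 // => a _;
  by rewrite mxE zcol ?mul0r // (leq_trans _ (fq a)) // ltnW.
move: gc; rewrite leq_eqVlt => /orP[/eqP/val_inj gc|gc].
  rewrite !(expand_det_col _ ord0) !big_ord_recl.
  rewrite !big1 => [|a _|a _]; last 2 first.
  - by rewrite mxE -gc fz ?mul0r.
  - by rewrite mxE -gc hf // fz ?mul0r.
  rewrite !addr0 !mxE -gc f0 h0 mulrCA.
  rewrite (_ : cofactor (mxsub h g A) _ _ = cofactor (mxsub f g A) ord0 ord0) //.
  congr (_ * \det _); apply/matrixP=> a b; rewrite !mxE hf //.
pose f' := cons_ord ord0 p f; pose g' := cons_ord ord0 c g.
have f'i : increasing f'.
  by apply: cons_ord_increasing => // a _; exact: leq_trans pq (fq a).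
have g'i : increasing g'.
  apply: cons_ord_increasing => // a _.
  by apply: leq_trans gc _; exact: increasing_leq.
have := tnA _ f' g' f'i g'i.
rewrite (expand_det_col _ ord0) !big_ord_recl big1 => [|a _]; last first.
  by rewrite mxE /f' /g' cons_ord_id cons_ord_lift fz ?mul0r.
rewrite !mxE /f' /g' !cons_ord_id !cons_ord_lift f0 addr0 /cofactor /=.
rewrite expr0 mul1r /bump /= addn0 expr1.
have -> : row' ord0 (col' ord0 (mxsub f' g' A)) = mxsub f g A.
  by apply/matrixP=> a b; rewrite !mxE /f' /g' !cons_ord_lift.
have -> : row' (lift ord0 ord0) (col' ord0 (mxsub f' g' A)) = mxsub h g A.
  apply/matrixP=> a b; rewrite !mxE /g' !cons_ord_lift; congr (A _ _).
  have [->|na] := eqVneq a ord0.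
    rewrite h0 (_ : lift _ _ = ord0) ?/f' ?cons_ord_id //; exact: val_inj.
  rewrite hf // (_ : lift _ _ = lift ord0 a) ?/f' ?cons_ord_lift //.
  by apply: val_inj; rewrite /= /bump; move: na; rewrite -val_eqE /=; lia.
by lra.
Qed.

(* Induction on the number of rows of [f] above row [p]: the first one is
   removed by a three-term Plücker relation. *)
Lemma whitney_step (R : realType) (m n : nat) (A : 'M[R]_(m, n))
    (p q : 'I_m) (c : 'I_n) :
  totally_nonnegative A -> q = p.+1 :> nat -> 0 < A p c -> 0 <= A q c ->
  (forall (x : 'I_m) (j : 'I_n), (p <= x)%N -> (j < c)%N -> A x j = 0) ->
  (forall x : 'I_m, (q < x)%N -> A x c = 0) ->
  forall k (f : 'I_k.+1 -> 'I_m) (g : 'I_k.+1 -> 'I_n) (i : 'I_k.+1),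
  increasing f -> increasing g -> f i = q -> (forall a, f a != p) ->
  A q c * \det (mxsub (fun a => if f a == q then p else f a) g A) <=
  A p c * \det (mxsub f g A).
Proof.
move=> tnA; have /tnP tnA' := tnA; move=> qp Apc Aqc zcol zlow k f g i fi gi.
have nqp : q != p by rewrite -val_eqE /= qp; lia.
have adj : adjacent q p by rewrite /adjacent qp eqxx orbT.
pose sub (l : nat) (h : 'I_l -> 'I_m) a := if h a == q then p else h a.
have subi l (h : 'I_l -> 'I_m) : increasing h -> (forall a, h a != p) ->
  increasing (sub l h) by move=> hi nh; exact: increasing_replace.
elim: k f g i fi gi => [|k IHk] f g i fi gi fiq nfp.
all: have fpi := subi _ _ fi nfp; rewrite -/(sub _ f).
all: have sub_f a : a != i -> sub _ f a = f a
  by rewrite /sub -fiq (inj_eq (increasing_inj fi)) => /negPf->.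
all: have sub_i : sub _ f i = p by rewrite /sub fiq eqxx.
  apply: (whitney_base (c := c)) => //; rewrite ?qp //.
  - by rewrite -fiq (ord1 i).
  - by rewrite -sub_i (ord1 i).
  - by move=> a; rewrite (ord1 a) eqxx.
have [i0|i0] := eqVneq i ord0.
  apply: (whitney_base (c := c)) => //; rewrite ?qp // -?i0 //.
have n0i : ord0 != i by rewrite eq_sym.
have [i' ei _] := unlift_some n0i.
have ltp (a : 'I_k.+2) : (a < i)%N -> (f a < p)%N.
  move=> /fi; rewrite fiq qp ltnS leq_eqVlt => /orP[/eqP/val_inj fap|//].
  by have := nfp a; rewrite fap eqxx.
pose P : 'I_k.+3 := lift ord0 (widen_ord (leqnSn _) i').
(* [b] is [f] with [p] inserted just before [q]: deleting position [P] gives back [f], deleting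
   position [Q] gives [f] with [q] replaced by [p]. *)
pose b := cons_ord P p f.
have bi : increasing b.
  apply: cons_ord_increasing => // a.
    by move=> lta; apply: ltp; move: lta; rewrite ei /= /bump.
  move=> lea; apply: (@leq_trans q); first by rewrite qp.
  by rewrite -fiq; apply: increasing_leq => //; move: lea; rewrite ei /= /bump.
pose Q : 'I_k.+3 := lift ord0 (lift ord0 i').
have bP a : b (lift P a) = f a by rewrite /b cons_ord_lift.
have bQ a : b (lift Q a) = sub _ f a.
  have [ai|ai] := eqVneq a i.
    rewrite ai sub_i (_ : lift Q i = P) ?/b ?cons_ord_id //.
    by apply: val_inj; rewrite ei /= /bump; lia.
  rewrite sub_f // (_ : lift Q a = lift P a) //.
  by apply: val_inj; move: ai; rewrite -val_eqE ei /= /bump /=; lia.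
have dF : \det (mxsub f g A) = \det (row' P (mxsub b g A)).
  by congr (\det _); apply/matrixP=> a j; rewrite !mxE bP.
have dF' : \det (mxsub (sub _ f) g A) = \det (row' Q (mxsub b g A)).
  by congr (\det _); apply/matrixP=> a j; rewrite !mxE bQ.
have [z|nz] := eqVneq (\det (mxsub (sub _ f) g A)) 0.
  by rewrite z mulr0 mulr_ge0 ?(ltW Apc) // tnA'.
(* A nonzero determinant has a nonzero cofactor in its first row. The corresponding minor is
   positive by total nonnegativity, and the final inequality is divided by it. *)
have [y dy] : exists y, \det (mxsub (sub _ f \o lift ord0) (g \o lift y) A) != 0.
  apply/existsP; apply: contraNT nz => /existsPn H.
  rewrite (expand_det_row _ ord0) big1 // => y _.
  rewrite /cofactor (_ : row' _ _ = mxsub (sub _ f \o lift ord0) (g \o lift y) A).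
    by have := H y; rewrite negbK => /eqP->; rewrite !mulr0.
  by apply/matrixP=> a j; rewrite !mxE.
have fli : increasing (f \o lift ord0).
  by apply: increasing_comp => //; exact: increasing_lift.
have gli : increasing (g \o lift y).
  by apply: increasing_comp => //; exact: increasing_lift.
have := IHk _ _ i' fli gli; rewrite /= -ei => /(_ fiq) IH.
have {}IH := IH (fun a => nfp _).
have := plucker_flag (mxsub b g A) y i'.
rewrite /= -/P -/Q -dF -dF'.
rewrite (_ : row' (lift ord0 i') (row' ord0 _) =
  mxsub (sub _ f \o lift ord0) (g \o lift y) A); last first.
  apply/matrixP=> a j; rewrite !mxE /= -bQ; congr (A (b _) _).
  by apply: val_inj; rewrite /= /bump; lia.
rewrite (_ : row' (widen_ord _ i') (row' ord0 _) =
  mxsub (f \o lift ord0) (g \o lift y) A); last first.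
  apply/matrixP=> a j; rewrite !mxE /= -bP; congr (A (b _) _).
  by apply: val_inj; rewrite /= /bump; lia.
have sli : increasing (sub _ f \o lift ord0).
  by apply: increasing_comp => //; exact: increasing_lift.
have u_gt0 : 0 < \det (mxsub (sub _ f \o lift ord0) (g \o lift y) A).
  by rewrite lt_neqAle eq_sym dy tnA'.
set w1 := \det (row' (lift ord0 i') _); set w2 := \det (row' ord0 _).
have w_ge0 : 0 <= w1 * w2.
  apply: mulr_ge0.
    rewrite /w1 (_ : row' _ _ =
      mxsub ((b \o lift Q) \o lift (lift ord0 i')) (g \o lift y) A); last first.
      by apply/matrixP=> a j; rewrite !mxE.
    by apply: tnA' => //; do 2?[apply: increasing_comp => //]; exact: increasing_lift.
  rewrite /w2 (_ : row' _ _ = mxsub (b \o lift ord0) g A); last first.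
    by apply/matrixP=> a j; rewrite !mxE.
  by apply: tnA' => //; apply: increasing_comp => //; exact: increasing_lift.
have F'_ge0 : 0 <= \det (mxsub (sub _ f) g A) by exact: tnA'.
move: w_ge0 u_gt0 F'_ge0 IH.
change (mxsub _ (g \o lift y) A)
  with (mxsub (sub _ f \o lift ord0) (g \o lift y) A) at 2.
set w := w1 * w2; set u := \det _; set F' := \det _; set v := \det _.
set F := \det _ => w0 u0 F'0 IH e.
(* The Plücker relation reads [w + v * F' = u * F] with [w >= 0], and the induction hypothesis is
   [A q c * u <= A p c * v]. *)
rewrite -(ler_pM2l u0).
have H1 : A q c * u * F' <= A p c * v * F' by rewrite ler_wpM2r.
have H2 : 0 <= A p c * w by rewrite mulr_ge0 // ltW.
have H3 : A p c * (w + v * F') = A p c * (u * F) by rewrite e.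
nra.
Qed.

(** Only minors that use row [q] without row [p] change; for these, Whitney's inequality divided by
    [A p c] says that the result is nonnegative. *)
Lemma tn_eliminate (R : realType) (m n : nat) (A : 'M[R]_(m, n))
    (p q : 'I_m) (c : 'I_n) :
  totally_nonnegative A -> q = p.+1 :> nat -> 0 < A p c -> 0 <= A q c ->
  (forall (x : 'I_m) (j : 'I_n), (p <= x)%N -> (j < c)%N -> A x j = 0) ->
  (forall x : 'I_m, (q < x)%N -> A x c = 0) ->
  totally_nonnegative (chip (- (A q c / A p c)) q p A).
Proof.
move=> tnA qp Apc Aqc zcol zlow.
have adj : adjacent q p by rewrite /adjacent qp eqxx orbT.
apply: minor_ind => k f g fi gi; rewrite minor_chip // minorE //.
case: ifP => [mv|_]; last by rewrite addr0; move/tnP: tnA; apply.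
rewrite move_set_imset //; case/andP: (mv) => /imsetP[i _ qi] pN.
have nfp a : f a != p by apply: contra pN => /eqP <-; rewrite imset_f.
rewrite minorE //; last exact: increasing_replace.
case: k f g fi gi i qi {mv pN} nfp => [|k] f g fi gi i qi nfp; first by case: i {qi}.
have := whitney_step tnA qp Apc Aqc zcol zlow fi gi (esym qi) nfp.
set F' := \det _; set F := \det _ => H.
rewrite -(ler_pM2l Apc) mulr0 mulrDr.
have -> : A p c * (- (A q c / A p c) * F') = - (A q c * F').
  by field; rewrite gt_eqF.
by rewrite subr_ge0.
Qed.

(** * Factorization of totally nonnegative matrices *)

(** The factor [d = 0] is allowed in scalings, which is what makes singular matrices reachable. *)
Inductive chip_generated (R : realType) (n : nat) : 'M[R]_n -> Prop :=
| ChipOne : chip_generated 1%:M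
| ChipAdd t u v (A : 'M[R]_n) : adjacent u v -> 0 <= t ->
    chip_generated A -> chip_generated (chip t u v A)
| ChipScale d u (A : 'M[R]_n) : 0 <= d ->
    chip_generated A -> chip_generated (scale_row d u A).

Lemma chip_mul (R : realType) (m n l : nat) (t : R) (u v : 'I_m)
    (A : 'M[R]_(m, n)) (B : 'M[R]_(n, l)) :
  chip t u v A *m B = chip t u v (A *m B).
Proof.
apply/matrixP=> i j; rewrite !mxE; case: (eqVneq i u) => [->|/negPf iu].
  rewrite big_distrr -big_split; apply: eq_bigr => a _ /=.
  by rewrite mxE eqxx mulrDl mulrA.
by rewrite addr0; apply: eq_bigr => a _; rewrite !mxE iu addr0.
Qed.

Lemma scale_row_mul (R : realType) (m n l : nat) (d : R) (u : 'I_m)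
    (A : 'M[R]_(m, n)) (B : 'M[R]_(n, l)) :
  scale_row d u A *m B = scale_row d u (A *m B).
Proof.
apply/matrixP=> i j; rewrite !mxE big_distrr /=; apply: eq_bigr => a _ /=.
by rewrite mxE mulrA.
Qed.

Lemma chip_generated_mul (R : realType) (n : nat) (A B : 'M[R]_n) :
  chip_generated A -> chip_generated B -> chip_generated (A *m B).
Proof.
elim=> [|t u v C uv t0 _ IH|d u C d0 _ IH] gB; first by rewrite mul1mx.
- by rewrite chip_mul; apply: ChipAdd => //; exact: IH.
- by rewrite scale_row_mul; apply: ChipScale => //; exact: IH.
Qed.

Lemma chip_generated_tr (R : realType) (n : nat) (A : 'M[R]_n) :
  chip_generated A -> chip_generated A^T.
Proof.
elim=> [|t u v C uv t0 _ IH|d u C d0 _ IH]; first by rewrite trmx1; exact: ChipOne.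
- rewrite -[C in chip _ _ _ C]mul1mx -chip_mul trmx_mul.
  apply: chip_generated_mul => //.
  have -> : (chip t u v 1%:M)^T = chip t v u 1%:M :> 'M[R]_n.
    apply/matrixP=> i j; rewrite !mxE (eq_sym j i) (eq_sym v i) (eq_sym u j).
    by case: (i == v); case: (j == u); rewrite /= ?mulr0 ?mulr1.
  by apply: ChipAdd; rewrite ?(adjacentC v) //; exact: ChipOne.
- rewrite -[C in scale_row _ _ C]mul1mx -scale_row_mul trmx_mul.
  apply: chip_generated_mul => //.
  have -> : (scale_row d u 1%:M)^T = scale_row d u 1%:M :> 'M[R]_n.
    apply/matrixP=> i j; rewrite !mxE (eq_sym j i).
    by case: (i =P j) => [->//|_]; rewrite !mulr0.
  by apply: ChipScale => //; exact: ChipOne.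
Qed.

Lemma chip_generated_diag (R : realType) (n : nat) (A : 'M[R]_n) :
  (forall i j, 0 <= A i j) -> (forall i j, i != j -> A i j = 0) ->
  chip_generated A.
Proof.
move=> A0 Ad.
pose D s := foldr (fun i B => scale_row (A i i) i B) (1%:M : 'M[R]_n) s.
have DE s : uniq s ->
    D s = \matrix_(i, j) ((if i \in s then A i i else 1) * (i == j)%:R).
  elim: s => [|x s IH] /= => [_|/andP[xs us]].
    by apply/matrixP=> i j; rewrite !mxE mul1r.
  apply/matrixP=> i j; rewrite IH // !mxE inE.
  by case: (i =P x) => [->|]; rewrite /= ?mul1r // (negPf xs) mul1r.
have gD s : chip_generated (D s).
  by elim: s => [|x s IH] /=; [exact: ChipOne | exact: ChipScale].
rewrite (_ : A = D (enum 'I_n)) // DE ?enum_uniq //.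
apply/matrixP=> i j; rewrite !mxE mem_enum inE.
by case: (eqVneq i j) => [->|/Ad->]; rewrite ?mulr1 ?mulr0.
Qed.

Lemma tn_ge0 (R : realType) (m n : nat) (A : 'M[R]_(m, n)) i j :
  totally_nonnegative A -> 0 <= A i j.
Proof.
move=> /tnP/(_ 1%N (fun=> i) (fun=> j)); rewrite det_mx11 mxE; apply;
by move=> a b; rewrite !ord1 ltnn.
Qed.

Lemma tn_minor2 (R : realType) (m n : nat) (A : 'M[R]_(m, n))
    (p q : 'I_m) (c d : 'I_n) : (p < q)%N -> (c < d)%N ->
  totally_nonnegative A -> A p d * A q c <= A p c * A q d.
Proof.
move=> pq cd /tnP.
move=> /(_ 2%N (fun a => if a == ord0 then p else q) (fun a => if a == ord0 then c else d)).
rewrite (expand_det_row _ ord0) !big_ord_recl big_ord0 addr0 /cofactor !det_mx11.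
rewrite !mxE /= /bump /= expr0 expr1 mul1r mulN1r mulrN subr_ge0; apply.
- move=> a b; rewrite -(inj_eq val_inj a) -(inj_eq val_inj b) /=.
  by have := ltn_ord b; do 2!case: eqP => //; lia.
- move=> a b; rewrite -(inj_eq val_inj a) -(inj_eq val_inj b) /=.
  by have := ltn_ord b; do 2!case: eqP => //; lia.
Qed.

(* Eliminating an entry shrinks the support; exchanging a row with the zero row
   above it moves the support up. *)
Definition weight (R : realType) (m n : nat) (A : 'M[R]_(m, n)) : nat :=
  (\sum_i \sum_j (if A i j == 0%R then 0 else (i + j).+1))%N.

Lemma weight_tr (R : realType) (m n : nat) (A : 'M[R]_(m, n)) :
  weight A^T = weight A.
Proof.
rewrite /weight exchange_big; apply: eq_bigr => i _; apply: eq_bigr => j _.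
by rewrite mxE addnC.
Qed.

Lemma ltn_sum_at (I : finType) (F G : I -> nat) (i0 : I) :
  (forall i, (F i <= G i)%N) -> (F i0 < G i0)%N -> (\sum_i F i < \sum_i G i)%N.
Proof.
move=> leFG lt0; rewrite (bigD1 i0) //= [X in (_ < X)%N](bigD1 i0) //=.
by rewrite -addSn leq_add // leq_sum.
Qed.

(** [c] is the first column with a nonzero entry below the diagonal, [q] the lowest nonzero row of
    that column and [p] the row above [q]. A nonzero [A p c] serves as pivot. If [A p c] is zero,
    the whole row [p] is zero and row [q] is moved up into it. *)
Lemma reduction_step (R : realType) (n : nat) (A : 'M[R]_n) (i0 j0 : 'I_n) :
  totally_nonnegative A -> (j0 < i0)%N -> A i0 j0 != 0 ->
  exists A' : 'M[R]_n, [/\ totally_nonnegative A', (weight A' < weight A)%N &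
    chip_generated A' -> chip_generated A].
Proof.
move=> tnA lt0 nz0.
pose bad (c : 'I_n) := [exists i : 'I_n, (c < i)%N && (A i c != 0)].
have bad0 : bad j0 by apply/existsP; exists i0; rewrite lt0.
case: (arg_minnP (@nat_of_ord n) bad0) => c /existsP[i1 /andP[ci1 nz1]] cmin.
case: (arg_maxnP (@nat_of_ord n) (nz1 : (fun i => A i c != 0) i1)) => q nzq qmax.
have cq : (c < q)%N by apply: leq_trans ci1 _; exact: qmax.
have ltp : (q.-1 < n)%N by have := ltn_ord q; lia.
pose p := Ordinal ltp.
have qp : q = p.+1 :> nat by rewrite /=; lia.
have neqp : q != p by rewrite -val_eqE /= ; lia.
have cp : (c <= p)%N by rewrite /=; lia.
have adj : adjacent q p by rewrite /adjacent qp eqxx orbT.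
(* Since [c <= p], these entries lie strictly below the diagonal, and the minimality of [c]
   applies. *)
have zcol (x j : 'I_n) : (p <= x)%N -> (j < c)%N -> A x j = 0.
  move=> px jc; apply/eqP; apply: contraLR jc => nz; rewrite -leqNgt leqNgt.
  apply/negP=> jc; move: (cmin j) => /=; rewrite leqNgt jc => H.
  suff /H : bad j by [].
  by apply/existsP; exists x; rewrite nz andbT (leq_trans jc) // (leq_trans cp).
have zlow (x : 'I_n) : (q < x)%N -> A x c = 0.
  by move=> qx; apply/eqP; apply: contraLR qx => nz; rewrite -leqNgt; exact: qmax.
have A_ge0 i j : 0 <= A i j by exact: tn_ge0.
have Aqc : 0 < A q c by rewrite lt_neqAle eq_sym nzq A_ge0.
have [Apc0|nzp] := eqVneq (A p c) 0.
  (* Left of [c] by the choice of [c]; right of [c] because the minor on rows [p], [q] and columns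
     [c], [j] would be negative. *)
  have rowp j : A p j = 0.
    have [jc|jc|/val_inj->//] := ltngtP j c; first exact: zcol.
    have := tn_minor2 (_ : (p < q)%N) jc tnA; rewrite qp => /(_ (leqnn _)).
    rewrite Apc0 mul0r pmulr_lle0 // => le0.
    by apply/eqP; rewrite eq_le le0 A_ge0.
  (* Exchanging a row with a zero row is a chip followed by a scaling by 0, and both preserve total
     nonnegativity. *)
  pose A' := scale_row 0 q (chip 1 p q A).
  have A'E i j : A' i j = if i == p then A q j else if i == q then 0 else A i j.
    rewrite !mxE; case: (eqVneq i p) => [->|np].
      by rewrite eq_sym (negPf neqp) mul1r mul1r rowp add0r.
    by case: (eqVneq i q) => _; rewrite ?mul0r // mul1r addr0.
  exists A'; split.
  - by apply: tn_scale_row => //; apply: tn_chip => //; rewrite adjacentC.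
  - rewrite /weight (bigD1 p) // (bigD1 q) //= [X in (_ < X)%N](bigD1 p) //.
    rewrite [X in (_ < _ + X)%N](bigD1 q) //= !addnA.
    rewrite [X in (_ + X + _)%N]big1; last first.
      by move=> j _; rewrite A'E (negPf neqp) eqxx eqxx.
    rewrite [X in (_ < X + _ + _)%N]big1; last by move=> j _; rewrite rowp eqxx.
    rewrite addn0 add0n -addSn leq_add //; last first.
      apply: leq_sum => i /andP[np nq]; apply: leq_sum => j _.
      by rewrite A'E (negPf np) (negPf nq).
    apply: (ltn_sum_at (i0 := c)) => [j|]; rewrite A'E eqxx; first by case: eqP; lia.
    by rewrite (negPf nzq) qp.
  - move=> gA'; rewrite (_ : A = scale_row 0 p (chip 1 q p A')).
      by apply: ChipScale => //; exact: ChipAdd.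
    apply/matrixP=> i j; rewrite mxE [chip _ _ _ _ _ _]mxE !A'E eqxx.
    case: (eqVneq i p) => [->|np]; first by rewrite mul0r rowp.
    by case: (eqVneq i q) => [->|]; rewrite ?mul1r ?add0r ?addr0.
have Apc : 0 < A p c by rewrite lt_neqAle eq_sym nzp A_ge0.
pose s := A q c / A p c.
have s_ge0 : 0 <= s by rewrite divr_ge0.
pose A' := chip (- s) q p A.
have tnA' : totally_nonnegative A' by exact: tn_eliminate.
exists A'; split => //.
(* The entries of [A'] are nonnegative and at most those of [A], so zeros of [A] persist. *)
- have entry i j : ((if A' i j == 0%R then 0 else (i + j).+1) <=
      (if A i j == 0%R then 0 else (i + j).+1))%N.
    case: (eqVneq (A i j) 0) => [Aij|]; last by case: ifP.
    suff -> : A' i j = 0 by rewrite eqxx.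
    apply/eqP; rewrite eq_le tn_ge0 // andbT mxE Aij add0r; case: eqP => // _.
    by rewrite mulNr oppr_le0 mulr_ge0.
  apply: (ltn_sum_at (i0 := q)) => [i|]; first by apply: leq_sum => j _.
  apply: (ltn_sum_at (i0 := c)) => [j|]; first exact: entry.
  rewrite (negPf nzq) (_ : A' q c = 0) ?eqxx // mxE eqxx /s.
  by field; rewrite gt_eqF.
- move=> gA'; rewrite (_ : A = chip s q p A'); first exact: ChipAdd.
  apply/matrixP=> i j; rewrite !mxE (eq_sym p) (negPf neqp) addr0.
  by case: eqP => _; rewrite ?addr0 //; ring.
Qed.

(** Transposition preserves the weight, so one induction clears both triangles; a nonnegative
    diagonal matrix remains. *)
Theorem tn_chip_generated (R : realType) (n : nat) (A : 'M[R]_n) :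
  totally_nonnegative A -> chip_generated A.
Proof.
move: {2}(weight A).+1 (ltnSn (weight A)) => N.
elim: N A => // N IH A; rewrite ltnS => ltN tnA.
have [/existsP[i /existsP[j /andP[lt_ji nz]]]|/existsPn up] :=
    boolP [exists i : 'I_n, exists j : 'I_n, (j < i)%N && (A i j != 0)].
  have [A' [tnA' ltA' ]] := reduction_step tnA lt_ji nz; apply.
  by apply: IH => //; exact: leq_trans ltA' ltN.
have [/existsP[i /existsP[j /andP[lt_ji nz]]]|/existsPn lo] :=
    boolP [exists i : 'I_n, exists j : 'I_n, (j < i)%N && (A^T i j != 0)].
  rewrite -[A]trmxK; apply: chip_generated_tr.
  have [A' [tnA' ltA' ]] := reduction_step (tn_tr tnA) lt_ji nz; apply.
  by apply: IH => //; apply: leq_trans ltA' _; rewrite weight_tr.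
apply: chip_generated_diag => [i j|i j]; first exact: tn_ge0.
rewrite -val_eqE /= neq_ltn => /orP[] lt_ij.
- by have /existsPn/(_ i) := lo j; rewrite lt_ij negbK mxE => /eqP.
- by have /existsPn/(_ j) := up i; rewrite lt_ij negbK => /eqP.
Qed.

(** * Heights and noncrossing matchings *)

Definition color (T : finType) (X1 X2 : {set T}) (x : T) : int :=
  (x \in X1)%:Z - (x \in X2)%:Z.

Definition height (m : nat) (X1 X2 : {set 'I_m}) (s : nat) : int :=
  \sum_(x < m | (x < s)%N) color X1 X2 x.

Definition mult (T : finType) (X1 X2 : {set T}) (x : T) : nat :=
  (x \in X1) + (x \in X2).

Definition refines (m : nat) (R1 R2 K1 K2 : {set 'I_m}) : Prop :=
  same_multiset R1 R2 K1 K2 /\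
  forall s t, height R1 R2 s = height R1 R2 t -> height K1 K2 s = height K1 K2 t.

Lemma color_eq0 (T : finType) (X1 X2 : {set T}) x :
  (color X1 X2 x == 0) = (mult X1 X2 x != 1)%N.
Proof. by rewrite /color /mult; case: (x \in X1); case: (x \in X2). Qed.

Lemma height_diff (m : nat) (X1 X2 : {set 'I_m}) (s t : nat) : (s <= t)%N ->
  height X1 X2 t - height X1 X2 s = \sum_(x < m | (s <= x < t)%N) color X1 X2 x.
Proof.
move=> st; rewrite /height (bigID (fun x : 'I_m => (x < s)%N)) /=.
rewrite (eq_bigl (fun x : 'I_m => (x < s)%N)) => [|x]; last by lia.
rewrite addrC addrK; apply: eq_bigl => x; lia.
Qed.

Lemma heightS (m : nat) (X1 X2 : {set 'I_m}) (x : 'I_m) :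
  height X1 X2 x.+1 = height X1 X2 x + color X1 X2 x.
Proof.
apply/eqP; rewrite addrC -subr_eq height_diff // (big_pred1 x) // => y.
by rewrite -[RHS]val_eqE /=; lia.
Qed.

Lemma height_max (m : nat) (X1 X2 : {set 'I_m}) (s : nat) : (m <= s)%N ->
  height X1 X2 s = height X1 X2 m.
Proof.
by move=> ms; apply: eq_bigl => x; rewrite !ltn_ord (leq_trans (ltn_ord x)).
Qed.

(* The last condition says that c and m c lie on the same side of the arc
   {a, m a}. *)
Definition noncrossing (N : nat) (r : 'I_N -> nat) (m : 'I_N -> 'I_N) : Prop :=
  [/\ involutive m, forall x, r x != 1%N -> m x = x &
   forall a c, r a = 1%N -> r c = 1%N -> c != a -> c != m a ->
     (a < c)%N (+) (m a < c)%N = (a < m c)%N (+) (m a < m c)%N].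

(** At a fixed point of [m] this forces colour 0, so a position of multiplicity 1 that [m] leaves
    unmatched makes every pair incompatible. *)
Definition compatible (N : nat) (m : 'I_N -> 'I_N) (R1 R2 : {set 'I_N}) : bool :=
  [forall x, color R1 R2 (m x) == - color R1 R2 x].

Lemma noncrossing_mult (N : nat) (r : 'I_N -> nat) (m : 'I_N -> 'I_N) x :
  noncrossing r m -> (r (m x) == 1%N) = (r x == 1%N).
Proof.
case=> mK fixm _; case: (eqVneq (r x) 1%N) => rx; last first.
  by rewrite (fixm _ rx); apply/negbTE.
apply: contraT => rmx; have := fixm _ rmx; rewrite mK => e.
by rewrite -e rx eqxx in rmx.
Qed.

Lemma compatible_refines (N : nat) (r : 'I_N -> nat) (m : 'I_N -> 'I_N)
    (R1 R2 K1 K2 : {set 'I_N}) :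
  noncrossing r m -> mult R1 R2 =1 r -> refines R1 R2 K1 K2 ->
  compatible m R1 R2 -> compatible m K1 K2.
Proof.
move=> ncm Rr [RK refRK] /forallP compR; have [mK fixm nc] := ncm.
have Kr : mult K1 K2 =1 r by move=> x; rewrite -Rr /mult RK.
apply/forallP=> x; case: (eqVneq (r x) 1%N) => rx; last first.
  have := color_eq0 K1 K2 x; rewrite Kr rx => /eqP cx.
  by rewrite (fixm _ rx) cx oppr0.
suff main (i : 'I_N) : (i < m i)%N -> r i = 1%N ->
    color K1 K2 (m i) = - color K1 K2 i.
  have [lt|lt|e] := ltngtP x (m x); first by rewrite main.
    rewrite -[X in - color _ _ X]mK (main (m x)) ?opprK ?mK //.
    by apply/eqP; rewrite (noncrossing_mult x ncm) rx.
  have := compR x; rewrite (_ : m x = x); last exact: val_inj.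
  have := color_eq0 R1 R2 x; rewrite Rr rx /= => c0.
  have : color R1 R2 x != 0 by rewrite c0.
  by lia.
move=> lt_i ri; set j := m i.
(* By noncrossing, [m] permutes the positions of multiplicity 1 strictly inside the arc and reverses
   their colours, so the sum of colours there equals its own negative. *)
have inner : height R1 R2 j = height R1 R2 i.+1.
  apply/eqP; rewrite -subr_eq0 height_diff //.
  set S := \sum_(_ | _) _; suff : S = - S by lia.
  rewrite {1}/S (bigID (fun y => r y == 1%N)) /= [X in _ + X]big1 ?addr0; last first.
    by move=> y /andP[_ ry]; apply/eqP; rewrite color_eq0 Rr.
  rewrite (reindex_inj (inv_inj mK)) /= /S.
  rewrite [in RHS](bigID (fun y => r y == 1%N)) /= [X in - (_ + X)]big1 ?addr0; last first.
    by move=> y /andP[_ ry]; apply/eqP; rewrite color_eq0 Rr.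
  rewrite -sumrN; apply: eq_big => [y|y _]; last exact/eqP/compR.
  rewrite (noncrossing_mult y ncm); case: (eqVneq (r y) 1%N) => ry; rewrite ?andbF // !andbT.
  case: (eqVneq y i) => [->|yi]; first by rewrite -/j; lia.
  case: (eqVneq y j) => [->|yj]; first by rewrite /j mK; lia.
  have myi : m y != i by apply: contra yj => /eqP e; rewrite /j -e mK.
  have myj : m y != j by rewrite (inj_eq (inv_inj mK)).
  have := nc i y ri ry yi yj; move: yi yj myi myj; rewrite -!val_eqE /= -/j.
  by move: lt_i; rewrite -/j; lia.
have cj : color R1 R2 j = - color R1 R2 i by apply/eqP; exact: compR.
have outer : height R1 R2 j.+1 = height R1 R2 i.
  by rewrite heightS inner heightS cj; lia.
have := refRK _ _ inner; have := refRK _ _ outer; rewrite !heightS.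
lia.
Qed.

(** * The cone spanned by indicators of noncrossing matchings *)

(** The multiplicities [r] are fixed because matchings join positions of multiplicity 1; [ConeExt]
    discards the values on pairs with other multiplicities. *)
Inductive cone (R : realType) (N : nat) (r : 'I_N -> nat) :
    ({set 'I_N} -> {set 'I_N} -> R) -> Prop :=
| ConeGen m : noncrossing r m -> cone r (fun R1 R2 => (compatible m R1 R2)%:R)
| ConeZero : cone r (fun _ _ => 0)
| ConeAdd F G : cone r F -> cone r G -> cone r (fun R1 R2 => F R1 R2 + G R1 R2)
| ConeScale c F : 0 <= c -> cone r F -> cone r (fun R1 R2 => c * F R1 R2)
| ConeExt F G : (forall R1 R2, mult R1 R2 =1 r -> F R1 R2 = G R1 R2) ->
    cone r F -> cone r G.

Lemma cone_refines (R : realType) (N : nat) (r : 'I_N -> nat)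
    (F : {set 'I_N} -> {set 'I_N} -> R) (R1 R2 K1 K2 : {set 'I_N}) :
  cone r F -> mult R1 R2 =1 r -> refines R1 R2 K1 K2 -> F R1 R2 <= F K1 K2.
Proof.
move=> coneF Rr ref; have Kr : mult K1 K2 =1 r.
  by move=> x; rewrite -Rr /mult ref.1.
elim: coneF => [m ncm||G H _ IG _ IH|c G c0 _ IG|G H GH _ IG].
- have := compatible_refines ncm Rr ref.
  by case: (compatible m R1 R2) => [->//|_]; rewrite ler0n.
- exact: lexx.
- exact: lerD.
- exact: ler_wpM2l.
- by rewrite -!GH.
Qed.

Lemma cone_ext0 (R : realType) (N : nat) (r : 'I_N -> nat)
    (F : {set 'I_N} -> {set 'I_N} -> R) :
  (forall R1 R2, mult R1 R2 =1 r -> F R1 R2 = 0) -> cone r F.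
Proof.
by move=> F0; apply: ConeExt (ConeZero _ _) => R1 R2 /F0 ->.
Qed.

Lemma cone_transfer (R : realType) (N : nat) (r r' : 'I_N -> nat)
    (T : ({set 'I_N} -> {set 'I_N} -> R) -> {set 'I_N} -> {set 'I_N} -> R) :
  (forall F G R1 R2, T (fun X Y => F X Y + G X Y) R1 R2 = T F R1 R2 + T G R1 R2) ->
  (forall c F R1 R2, T (fun X Y => c * F X Y) R1 R2 = c * T F R1 R2) ->
  (forall F G, (forall X Y, mult X Y =1 r' -> F X Y = G X Y) ->
     forall R1 R2, mult R1 R2 =1 r -> T F R1 R2 = T G R1 R2) ->
  (forall m, noncrossing r' m ->
     cone r (T (fun X Y => (compatible m X Y)%:R))) ->
  forall F, cone r' F -> cone r (T F).
Proof.
move=> TD TZ Text Tgen F; elim=> [m|| G H _ IG _ IH|c G c0 _ IG|G H GH _ IG].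
- exact: Tgen.
- apply: cone_ext0 => R1 R2 Rr.
  rewrite (Text _ (fun _ _ => 0 * 0)) // => [|X Y _]; last by rewrite mul0r.
  by rewrite TZ mul0r.
- by apply: ConeExt (ConeAdd IG IH) => R1 R2 _; rewrite TD.
- by apply: ConeExt (ConeScale c0 IG) => R1 R2 _; rewrite TZ.
- by apply: ConeExt IG; exact: Text.
Qed.

(** * Stability of the cone under moves *)

(** The coefficient of [t] when a chip with parameter [t] is applied to a product of two minors;
    [move_two] is the coefficient of [t ^+ 2]. *)
Definition move_one (R : realType) (N : nat) (x y : 'I_N)
    (F : {set 'I_N} -> {set 'I_N} -> R) (R1 R2 : {set 'I_N}) : R :=
  (if movable x y R1 then F (move_set x y R1) R2 else 0) +
  (if movable x y R2 then F R1 (move_set x y R2) else 0).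

Definition move_two (R : realType) (N : nat) (x y : 'I_N)
    (F : {set 'I_N} -> {set 'I_N} -> R) (R1 R2 : {set 'I_N}) : R :=
  if movable x y R1 && movable x y R2
  then F (move_set x y R1) (move_set x y R2) else 0.

Lemma in_move_set (N : nat) (x y : 'I_N) (X : {set 'I_N}) z :
  x != y -> movable x y X ->
  (z \in move_set x y X) = (tperm x y z \in X).
Proof.
move=> nxy mv; rewrite /move_set mv; case/andP: mv => xX yX.
rewrite !inE; case: tpermP => [->|->|/eqP zx /eqP zy].
- by rewrite eqxx (negPf nxy) (negPf yX).
- by rewrite eqxx xX.
- by rewrite (negPf zx) (negPf zy).
Qed.

Lemma adjacent_neq (N : nat) (x y : 'I_N) : adjacent x y -> x != y.
Proof. by apply: contraTneq => ->; rewrite /adjacent; lia. Qed.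

Lemma val_tperm (N : nat) (x y z : 'I_N) :
  tperm x y z = (if z == x :> nat then y else if z == y :> nat then x else z) :> nat.
Proof.
by rewrite permE /= !(inj_eq val_inj); case: eqP => // _; case: eqP.
Qed.

Lemma tperm_ltn (N : nat) (x y z w : 'I_N) : adjacent x y ->
  ~~ ((z \in [:: x; y]) && (w \in [:: x; y])) ->
  (tperm x y z < tperm x y w)%N = (z < w)%N.
Proof.
rewrite /adjacent !inE -!(inj_eq val_inj) !val_tperm /=.
by move=> adj; repeat case: ifP => /eqP ?; lia.
Qed.

Lemma color_moveL (N : nat) (x y : 'I_N) (X Y : {set 'I_N}) z : x != y ->
  movable x y X ->
  color (move_set x y X) Y z = color X Y z - (z == x)%:Z + (z == y)%:Z.
Proof.
move=> nxy mv; rewrite /color in_move_set //; case/andP: mv => xX yX.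
case: tpermP => [->|->|/eqP/negPf-> /eqP/negPf->]; last by rewrite subr0 addr0.
- by rewrite eqxx (negPf nxy) (negPf yX) xX /= addr0; ring.
- by rewrite eqxx eq_sym (negPf nxy) (negPf yX) xX /= subr0; ring.
Qed.

Lemma color_sym (T : finType) (X Y : {set T}) z : color X Y z = - color Y X z.
Proof. by rewrite /color opprB. Qed.

Lemma color_moveR (N : nat) (x y : 'I_N) (X Y : {set 'I_N}) z : x != y ->
  movable x y Y ->
  color X (move_set x y Y) z = color X Y z + (z == x)%:Z - (z == y)%:Z.
Proof.
by move=> nxy mv; rewrite color_sym color_moveL // (color_sym X); ring.
Qed.

Lemma mult_moveL (N : nat) (x y : 'I_N) (X Y : {set 'I_N}) z : x != y ->
  movable x y X ->
  mult (move_set x y X) Y z =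
  (if z == x then (mult X Y z).-1 else if z == y then (mult X Y z).+1
   else mult X Y z).
Proof.
move=> nxy mv; rewrite /mult in_move_set //; case/andP: mv => xX yX.
case: tpermP => [->|->|/eqP/negPf-> /eqP/negPf->]; last by [].
- by rewrite eqxx (negPf yX) xX.
- by rewrite eqxx eq_sym (negPf nxy) (negPf yX) xX.
Qed.

Lemma mult_sym (T : finType) (X Y : {set T}) z : mult X Y z = mult Y X z.
Proof. exact: addnC. Qed.

Lemma mult_moveR (N : nat) (x y : 'I_N) (X Y : {set 'I_N}) z : x != y ->
  movable x y Y ->
  mult X (move_set x y Y) z =
  (if z == x then (mult X Y z).-1 else if z == y then (mult X Y z).+1
   else mult X Y z).
Proof.
by move=> nxy mv; rewrite mult_sym mult_moveL // !(mult_sym Y).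
Qed.

(** Exactly one of the adjacent positions [x] and [y] has multiplicity 1, so exchanging them
    preserves the order of the positions that can be matched. *)
Lemma noncrossing_tperm (N : nat) (r : 'I_N -> nat) (m : 'I_N -> 'I_N)
    (x y : 'I_N) : adjacent x y ->
  (r x == 1%N) != (r y == 1%N) -> noncrossing (r \o tperm x y) m ->
  noncrossing r (tperm x y \o m \o tperm x y).
Proof.
move=> adj rxy ncm; have [mK fixm nc] := ncm; split=> [z|z rz|a c ra rc ca cma] /=.
- by rewrite tpermK mK tpermK.
- by rewrite fixm ?tpermK //= tpermK.
have ltE z w : r z = 1%N -> r w = 1%N -> z != w ->
    (z < w)%N = (tperm x y z < tperm x y w)%N.
  move=> rz rw nzw; rewrite tperm_ltn // !inE; apply: contraNN rxy.
  case/andP=> /orP[]/eqP ez /orP[]/eqP ew; move: rz rw nzw;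
  by rewrite ez ew ?eqxx // => -> ->.
have rm z : r z = 1%N -> r (tperm x y (m (tperm x y z))) = 1%N.
  move=> rz; apply/eqP; have /= -> := noncrossing_mult (tperm x y z) ncm.
  by rewrite tpermK rz.
have neq z w : (z == tperm x y (m (tperm x y w))) = (tperm x y z == m (tperm x y w)).
  by rewrite -(inj_eq (@perm_inj _ (tperm x y)) z) tpermK.
have tinj := inj_eq (@perm_inj _ (tperm x y)).
have rt z : r z = 1%N -> (r \o tperm x y) (tperm x y z) = 1%N by rewrite /= tpermK.
have nca : tperm x y c != tperm x y a by rewrite tinj.
have ncma : tperm x y c != m (tperm x y a) by rewrite -neq.
have namc : tperm x y a != m (tperm x y c).
  by apply: contraNneq ncma => ->; rewrite mK.
have mac : m (tperm x y a) != m (tperm x y c).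
  by rewrite (inj_eq (inv_inj mK)) eq_sym.
rewrite (ltE a c ra rc) 1?eq_sym // (ltE _ _ (rm a ra) rc); last by rewrite eq_sym neq.
rewrite (ltE _ _ ra (rm c rc)) ?neq // (ltE _ _ (rm a ra) (rm c rc)) ?tinj //.
rewrite !tpermK; exact: nc (rt _ ra) (rt _ rc) nca ncma.
Qed.

Lemma noncrossing_ext (N : nat) (r r' : 'I_N -> nat) (m : 'I_N -> 'I_N) :
  (forall z, (r z == 1%N) = (r' z == 1%N)) -> noncrossing r m -> noncrossing r' m.
Proof.
move=> rr [mK fixm nc]; split=> // [z|a c /eqP ra /eqP rc].
  by rewrite -rr; exact: fixm.
by apply: nc; apply/eqP; rewrite rr.
Qed.

Lemma compatible_tperm (N : nat) (m : 'I_N -> 'I_N) (x y : 'I_N)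
    (X Y X' Y' : {set 'I_N}) :
  (forall z, color X' Y' z = color X Y (tperm x y z)) ->
  compatible m X' Y' = compatible (tperm x y \o m \o tperm x y) X Y.
Proof.
move=> cE; apply/forallP/forallP => H z.
  by have := H (tperm x y z); rewrite !cE tpermK.
by rewrite !cE; have := H (tperm x y z); rewrite /= tpermK.
Qed.

Lemma adjacent_ltn (N : nat) (x y z : 'I_N) : adjacent x y -> z != x -> z != y ->
  ((z < x)%N = (z < y)%N) * ((x < z)%N = (y < z)%N).
Proof.
by rewrite /adjacent -!val_eqE /= => adj zx zy; split; lia.
Qed.

Definition moved_mult (N : nat) (x y : 'I_N) (r : 'I_N -> nat) (z : 'I_N) : nat :=
  if z == x then (r z).-1 else if z == y then (r z).+1 else r z.

(** Since [m] fixes [x] and [y], composing with the transposition adds the arc joining them, and an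
    arc between adjacent positions crosses nothing. *)
Lemma noncrossing_arc (N : nat) (r : 'I_N -> nat) (m : 'I_N -> 'I_N)
    (x y : 'I_N) : adjacent x y -> r x = 1%N -> r y = 1%N ->
  noncrossing (moved_mult x y r) m -> noncrossing r (m \o tperm x y).
Proof.
move=> adj rx ry [mK fixm nc]; have nxy := adjacent_neq adj.
have mx : m x = x by rewrite fixm // /moved_mult eqxx rx.
have my : m y = y by rewrite fixm // /moved_mult (eq_sym y) (negPf nxy) eqxx ry.
have mN z : z != x -> z != y -> (m z != x) * (m z != y).
  move=> zx zy; split; first by apply: contra zx => /eqP e; rewrite -[z]mK e mx.
  by apply: contra zy => /eqP e; rewrite -[z]mK e my.
have tN z : z != x -> z != y -> tperm x y z = z.
  by move=> zx zy; rewrite tpermD // eq_sym.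
have m'N z : z != x -> z != y -> (m \o tperm x y) z = m z by move=> zx zy /=; rewrite tN.
have m'x : (m \o tperm x y) x = y by rewrite /= tpermL.
have m'y : (m \o tperm x y) y = x by rewrite /= tpermR.
have rN z : z != x -> z != y -> moved_mult x y r z = r z.
  by rewrite /moved_mult => /negPf-> /negPf->.
split=> [z|z rz|a c ra rc].
- have [->|zx] := eqVneq z x; first by rewrite m'x m'y.
  have [->|zy] := eqVneq z y; first by rewrite m'y m'x.
  by rewrite (m'N z) // m'N ?mN // mK.
- have zx : z != x by apply: contraNneq rz => ->; rewrite rx.
  have zy : z != y by apply: contraNneq rz => ->; rewrite ry.
  by rewrite m'N // fixm // rN.
have nbr z : z != x -> z != y -> (x < z)%N (+) (y < z)%N = false.
  by move=> zx zy; rewrite (adjacent_ltn adj zx zy) addbb.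
have [->|ax] := eqVneq a x.
  by rewrite m'x => cx cy; rewrite m'N // !nbr ?mN.
have [->|ay] := eqVneq a y.
  by rewrite m'y => cy cx; rewrite m'N // ![_ (+) (x < _)%N]addbC !nbr ?mN.
rewrite (m'N a) //.
have [max may] := mN a ax ay.
have [->|cx] := eqVneq c x; first by rewrite m'x !(adjacent_ltn adj).
have [->|cy] := eqVneq c y; first by rewrite m'y !(adjacent_ltn adj).
by rewrite m'N //; apply: nc; rewrite rN.
Qed.

(** The capping operation of Temperley-Lieb diagrams: [x] and [y] are contracted, and their partners
    become partners of each other. *)
Definition join_partners (N : nat) (x y : 'I_N) (m : 'I_N -> 'I_N) (z : 'I_N) :
    'I_N :=
  if (z == x) || (z == y) then z
  else if (m z == x) || (m z == y) then m (tperm x y (m z)) else m z.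

(** Every other position lies on the same side of [x] as of [y], so the arcs ending at [x] and at
    [y] can be concatenated without creating a crossing. *)
Lemma noncrossing_join (N : nat) (r : 'I_N -> nat) (m : 'I_N -> 'I_N)
    (x y : 'I_N) : adjacent x y -> r x = 2%N -> r y = 0%N ->
  m x != x -> m y != y ->
  noncrossing (moved_mult x y r) m -> noncrossing r (join_partners x y m).
Proof.
move=> adj rx ry nmx nmy [mK fixm nc]; have nxy := adjacent_neq adj.
have m_inj := inv_inj mK.
have rN z : z != x -> z != y -> moved_mult x y r z = r z.
  by rewrite /moved_mult => /negPf-> /negPf->.
have r'x : moved_mult x y r x = 1%N by rewrite /moved_mult eqxx rx.
have r'y : moved_mult x y r y = 1%N.
  by rewrite /moved_mult (eq_sym y) (negPf nxy) eqxx ry.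
pose m' := join_partners x y m.
have m'n z : z != x -> z != y -> m z != x -> m z != y -> m' z = m z.
  by rewrite /m' /join_partners => /negPf-> /negPf-> /negPf-> /negPf->.
have m'x z : z != x -> z != y -> m z = x -> m' z = m y.
  by rewrite /m' /join_partners => /negPf-> /negPf-> ->; rewrite eqxx tpermL.
have m'y z : z != x -> z != y -> m z = y -> m' z = m x.
  by rewrite /m' /join_partners => /negPf-> /negPf-> ->; rewrite eqxx orbT tpermR.
have m'fx : m' x = x by rewrite /m' /join_partners eqxx.
have m'fy : m' y = y by rewrite /m' /join_partners eqxx orbT.
split=> [z|z rz|a c ra rc ca]; rewrite -/m'.
- have [->|zx] := eqVneq z x; first by rewrite !m'fx.
  have [->|zy] := eqVneq z y; first by rewrite !m'fy.
  have [e|mzx] := eqVneq (m z) x.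
    have mxz : m x = z by rewrite -e mK.
    have ne : m y != x by apply: contra zy => /eqP e2; rewrite -mxz -e2 mK.
    by rewrite (m'x z) // (m'y (m y)) ?mK // nmy.
  have [e|mzy] := eqVneq (m z) y.
    have myz : m y = z by rewrite -e mK.
    have ne : m x != y by apply: contra zx => /eqP e2; rewrite -myz -e2 mK.
    by rewrite (m'y z) // (m'x (m x)) ?mK // nmx.
  by rewrite (m'n z) // m'n ?mK.
- have [->|zx] := eqVneq z x; first by rewrite m'fx.
  have [->|zy] := eqVneq z y; first by rewrite m'fy.
  have mz : m z = z by rewrite fixm // rN.
  by rewrite m'n ?mz.
have neq z : r z = 1%N -> (z != x) * (z != y).
  by move=> rz; split; apply: contra_eq_neq rz => ->; rewrite ?rx ?ry.
have [[ax ay] [cx cy]] := (neq a ra, neq c rc).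
have ra' : moved_mult x y r a = 1%N by rewrite rN.
have rc' : moved_mult x y r c = 1%N by rewrite rN.
have swapc p q : adjacent p q -> moved_mult x y r q = 1%N ->
    a != p -> a != q -> m a != p -> m a != q -> c != m a -> m c = p ->
    (a < c)%N (+) (m a < c)%N = (a < m q)%N (+) (m a < m q)%N.
  move=> pq rq ap aq map maq cma mcp.
  rewrite nc // mcp !(adjacent_ltn pq) // nc //; first by rewrite eq_sym.
  by rewrite eq_sym.
have swapa p q : adjacent p q -> moved_mult x y r (m q) = 1%N ->
    c != p -> c != q -> m c != p -> m c != q -> c != m q -> m a = p ->
    (a < c)%N (+) (m q < c)%N = (a < m c)%N (+) (m q < m c)%N.
  move=> pq rmq cp cq mcp mcq cmq map.
  have := nc _ _ ra' rc' ca; rewrite map => /(_ cp).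
  have := nc _ _ rmq rc' cmq; rewrite mK => /(_ cq).
  rewrite !(adjacent_ltn pq cp cq) !(adjacent_ltn pq mcp mcq).
  by case: (a < c)%N; case: (q < c)%N; case: (a < m c)%N; case: (q < m c)%N;
    case: (m q < c)%N; case: (m q < m c)%N.
have rm z : moved_mult x y r z = 1%N -> moved_mult x y r (m z) = 1%N.
  by move=> rz; apply/eqP; rewrite (noncrossing_mult z (And3 mK fixm nc)) rz.
have yx : adjacent y x by rewrite adjacentC.
have [ea|max] := eqVneq (m a) x; [rewrite (m'x a) // | have [ea|may] := eqVneq (m a) y;
  [rewrite (m'y a) // | rewrite (m'n a) //]];
(have [ec|mcx] := eqVneq (m c) x; [rewrite (m'x c) // | have [ec|mcy] := eqVneq (m c) y;
  [rewrite (m'y c) // | rewrite (m'n c) //]]) => cma.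
- by case/eqP: ca; apply: m_inj; rewrite ea.
- by case/eqP: cma; rewrite -ec mK.
- by apply: (swapa x y) => //; exact: rm.
- by case/eqP: cma; rewrite -ec mK.
- by case/eqP: ca; apply: m_inj; rewrite ea.
- by apply: (swapa y x) => //; exact: rm.
- exact: (swapc x y).
- exact: (swapc y x).
- exact: nc.
Qed.

(** Exactly one of the two sets can move, and the colours at [x] and [y] are exchanged: for
    multiplicities 1, 0 the single element goes to [y], for 2, 1 the single position goes from [y]
    to [x]. *)
Lemma cone_move_one_swap (R : realType) (N : nat) (x y : 'I_N) (r : 'I_N -> nat)
    (m : 'I_N -> 'I_N) : adjacent x y ->
  (r x = 1%N /\ r y = 0%N) \/ (r x = 2%N /\ r y = 1%N) ->
  noncrossing (moved_mult x y r) m ->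
  cone r (move_one x y (fun X Y => (compatible m X Y)%:R : R)).
Proof.
move=> adj rxy ncm; have nxy := adjacent_neq adj.
have ncm' : noncrossing r (tperm x y \o m \o tperm x y).
  apply: noncrossing_tperm => //; first by case: rxy => -[-> ->].
  apply: noncrossing_ext ncm => z; congr (_ == _); rewrite /moved_mult /=.
  case: tpermP => [->|->|/eqP/negPf-> /eqP/negPf-> //].
    by rewrite eqxx; case: rxy => -[-> ->].
  by rewrite (eq_sym y) (negPf nxy) eqxx; case: rxy => -[-> ->].
apply: ConeExt (ConeGen _ ncm') => X Y Rr; rewrite /move_one.
have := Rr x; have := Rr y; rewrite /mult.
have cL : movable x y X -> (x \in Y) = (y \in Y) ->
    compatible m (move_set x y X) Y = compatible (tperm x y \o m \o tperm x y) X Y.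
  move=> mv xyY; apply: compatible_tperm => z; rewrite /color in_move_set //.
  by case: tpermP => [->|->|//]; rewrite xyY.
have cR : movable x y Y -> (x \in X) = (y \in X) ->
    compatible m X (move_set x y Y) = compatible (tperm x y \o m \o tperm x y) X Y.
  move=> mv xyX; apply: compatible_tperm => z; rewrite /color in_move_set //.
  by case: tpermP => [->|->|//]; rewrite xyX.
move: cL cR; rewrite /movable.
case: rxy => -[-> ->]; case: (x \in X); case: (y \in X); case: (x \in Y);
  case: (y \in Y) => // cL cR _ _ /=; by rewrite ?addr0 ?add0r ?cL ?cR.
Qed.

(** A move exists exactly when [x] and [y] have opposite colours, and then only one. It leaves [x]
    empty and [y] doubled, so the result tests compatibility with [m] enlarged by the arc joining
    [x] and [y]. *)
Lemma cone_move_one_arc (R : realType) (N : nat) (x y : 'I_N) (r : 'I_N -> nat)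
    (m : 'I_N -> 'I_N) : adjacent x y -> r x = 1%N -> r y = 1%N ->
  noncrossing (moved_mult x y r) m ->
  cone r (move_one x y (fun X Y => (compatible m X Y)%:R : R)).
Proof.
move=> adj rx ry ncm; have nxy := adjacent_neq adj.
have [mK fixm _] := ncm.
have mx : m x = x by rewrite fixm // /moved_mult eqxx rx.
have my : m y = y by rewrite fixm // /moved_mult (eq_sym y) (negPf nxy) eqxx ry.
have mN z : z != x -> z != y -> (m z != x) * (m z != y).
  move=> zx zy; split; first by apply: contra zx => /eqP e; rewrite -[z]mK e mx.
  by apply: contra zy => /eqP e; rewrite -[z]mK e my.
apply: ConeExt (ConeGen _ (noncrossing_arc adj rx ry ncm)) => X Y Rr.
have cE X' Y' : color X Y x = - color X Y y -> color X' Y' x = 0 ->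
    color X' Y' y = 0 -> (forall z, z != x -> z != y -> color X' Y' z = color X Y z) ->
    compatible m X' Y' = compatible (m \o tperm x y) X Y.
  move=> cxy c'x c'y c'; apply/forallP/forallP => H z /=.
    case: tpermP => [->|->|/eqP zx /eqP zy].
    - by rewrite my cxy opprK.
    - by rewrite mx cxy.
    - by rewrite -!c' ?mN.
  have [->|zx] := eqVneq z x; first by rewrite mx c'x oppr0.
  have [->|zy] := eqVneq z y; first by rewrite my c'y oppr0.
  have tz : tperm x y z = z by rewrite tpermD // eq_sym.
  by have := H z; rewrite /= tz !c' ?mN.
have cL : movable x y X -> color X Y x = 1 -> color X Y y = -1 ->
    compatible m (move_set x y X) Y = compatible (m \o tperm x y) X Y.
  move=> mv cx cy; apply: cE; rewrite ?cx ?cy //.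
  - by rewrite color_moveL // cx eqxx (negPf nxy).
  - by rewrite color_moveL // cy eqxx (eq_sym y) (negPf nxy).
  - by move=> z zx zy; rewrite color_moveL // (negPf zx) (negPf zy) subr0 addr0.
have cR : movable x y Y -> color X Y x = -1 -> color X Y y = 1 ->
    compatible m X (move_set x y Y) = compatible (m \o tperm x y) X Y.
  move=> mv cx cy; apply: cE; rewrite ?cx ?cy //.
  - by rewrite color_moveR // cx eqxx (negPf nxy).
  - by rewrite color_moveR // cy eqxx (eq_sym y) (negPf nxy).
  - by move=> z zx zy; rewrite color_moveR // (negPf zx) (negPf zy) subr0 addr0.
have cN : color X Y x <> - color X Y y -> compatible (m \o tperm x y) X Y = false.
  move=> ncxy; apply/negbTE/negP => /forallP/(_ y) /=; rewrite tpermR mx.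
  by move/eqP.
have := Rr x; have := Rr y; rewrite /move_one /mult rx ry; move: cL cR cN.
rewrite /movable /color.
case: (x \in X); case: (y \in X); case: (x \in Y); case: (y \in Y) => // cL cR cN _ _ /=;
rewrite ?addr0 ?add0r; by [rewrite cL | rewrite cR | rewrite cN].
Qed.

(* Exactly one of the two moves gives opposite colours to x and m x, unless x and
   y are matched to each other, when both do. *)
Lemma cone_move_one_join (R : realType) (N : nat) (x y : 'I_N) (r : 'I_N -> nat)
    (m : 'I_N -> 'I_N) : adjacent x y -> r x = 2%N -> r y = 0%N ->
  noncrossing (moved_mult x y r) m ->
  cone r (move_one x y (fun X Y => (compatible m X Y)%:R : R)).
Proof.
move=> adj rx ry ncm; have nxy := adjacent_neq adj.
have [mK fixm _] := ncm.
have data X Y : mult X Y =1 r -> [/\ movable x y X, movable x y Y,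
    color X Y x = 0 & color X Y y = 0].
  move=> Rr; have := Rr x; have := Rr y; rewrite /mult rx ry /movable /color.
  by case: (x \in X); case: (y \in X); case: (x \in Y); case: (y \in Y).
have cLE X Y z : mult X Y =1 r -> color (move_set x y X) Y z =
    (if z == x then -1 else if z == y then 1 else color X Y z).
  move=> /data[mvX _ cx cy]; rewrite color_moveL //.
  have [->|zx] := eqVneq z x; first by rewrite cx (negPf nxy).
  by have [->|zy] := eqVneq z y; rewrite ?cy ?subr0 ?addr0.
have cRE X Y z : mult X Y =1 r -> color X (move_set x y Y) z =
    (if z == x then 1 else if z == y then -1 else color X Y z).
  move=> /data[_ mvY cx cy]; rewrite color_moveR //.
  have [->|zx] := eqVneq z x; first by rewrite cx (negPf nxy).
  by have [->|zy] := eqVneq z y; rewrite ?cy ?subr0 ?addr0.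
have mE X Y : mult X Y =1 r ->
    move_one x y (fun X Y => (compatible m X Y)%:R : R) X Y =
    (compatible m (move_set x y X) Y)%:R + (compatible m X (move_set x y Y))%:R.
  by move=> /data[mvX mvY _ _]; rewrite /move_one mvX mvY.
(* After either move [x] and [y] have colour 1 or -1, which is incompatible with being a fixed
   point; the function is then zero. *)
have [mx|nmx] := eqVneq (m x) x.
  apply: cone_ext0 => X Y Rr; rewrite mE //.
  have -> : compatible m (move_set x y X) Y = false.
    by apply/negbTE/negP => /forallP/(_ x); rewrite mx !cLE // eqxx.
  have -> : compatible m X (move_set x y Y) = false.
    by apply/negbTE/negP => /forallP/(_ x); rewrite mx !cRE // eqxx.
  by rewrite addr0.
have [my|nmy] := eqVneq (m y) y.
  apply: cone_ext0 => X Y Rr; rewrite mE //.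
  have -> : compatible m (move_set x y X) Y = false.
    by apply/negbTE/negP => /forallP/(_ y); rewrite my !cLE // (eq_sym y) (negPf nxy) eqxx.
  have -> : compatible m X (move_set x y Y) = false.
    by apply/negbTE/negP => /forallP/(_ y); rewrite my !cRE // (eq_sym y) (negPf nxy) eqxx.
  by rewrite addr0.
have gen := ConeGen R (noncrossing_join adj rx ry nmx nmy ncm).
have [mxy|nmxy] := eqVneq (m x) y.
  have myx : m y = x by rewrite -mxy mK.
  apply: ConeExt (ConeAdd gen gen) => X Y Rr; rewrite mE //.
  have [_ _ cx cy] := data X Y Rr.
  have mN z : z != x -> z != y -> (m z != x) * (m z != y).
    move=> zx zy; split; first by apply: contra zy => /eqP e; rewrite -[z]mK e mxy.
    by apply: contra zx => /eqP e; rewrite -[z]mK e myx.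
  have -> : compatible m (move_set x y X) Y = compatible (join_partners x y m) X Y.
    apply/forallP/forallP => H z; have := H z; rewrite !cLE // /join_partners;
    (have [->|zx] := eqVneq z x; first by rewrite ?mxy ?eqxx ?(eq_sym y) ?(negPf nxy) ?cx ?oppr0);
    (have [->|zy] := eqVneq z y; first by rewrite ?myx ?eqxx ?cy ?oppr0 ?opprK);
    have [/negPf-> /negPf->] := mN z zx zy; by [].
  have -> : compatible m X (move_set x y Y) = compatible (join_partners x y m) X Y.
    apply/forallP/forallP => H z; have := H z; rewrite !cRE // /join_partners;
    (have [->|zx] := eqVneq z x; first by rewrite ?mxy ?eqxx ?(eq_sym y) ?(negPf nxy) ?cx ?oppr0);
    (have [->|zy] := eqVneq z y; first by rewrite ?myx ?eqxx ?cy ?oppr0 ?opprK);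
    have [/negPf-> /negPf->] := mN z zx zy; by [].
  by [].
pose j := m x; pose k := m y.
have nmyx : m y != x by apply: contra nmxy => /eqP <-; rewrite mK.
have njk : j != k by rewrite (inj_eq (inv_inj mK)).
apply: ConeExt gen => X Y Rr; rewrite mE //.
have [_ _ cx cy] := data X Y Rr.
pose rest := [forall z, (z \notin [:: x; y; j; k]) ==>
  (color X Y (m z) == - color X Y z)].
have mN z : z \notin [:: x; y; j; k] -> (m z != x) * (m z != y).
  rewrite !inE !negb_or => /and4P[_ _ zj zk]; split.
    by apply: contra zj => /eqP e; rewrite /j -e mK.
  by apply: contra zk => /eqP e; rewrite /k -e mK.
have inN z : z \notin [:: x; y; j; k] -> (z != x) * (z != y).
  by rewrite !inE !negb_or => /and4P[].
have nyx : y == x = false by rewrite eq_sym (negPf nxy).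
have njx : j == x = false by apply/negbTE.
have njy : j == y = false by apply/negbTE.
have nkx : k == x = false by apply/negbTE.
have nky : k == y = false by apply/negbTE.
have cases (P : 'I_N -> bool) : P x -> P y -> P j -> P k ->
    (forall z, z \notin [:: x; y; j; k] -> P z) -> forall z, P z.
  move=> Px Py Pj Pk PN z; case: (boolP (z \in [:: x; y; j; k])); last exact: PN.
  by rewrite !inE => /or4P[]/eqP->.
(* Here [s] is the colour of [y] after the move; it prescribes the colours of the partners [j] of
   [x] and [k] of [y], and [rest] collects the conditions on the other positions. *)
have eN X' Y' s : s = 1 \/ s = -1 ->
    (forall z, color X' Y' z =
      (if z == x then - s else if z == y then s else color X Y z)) ->
    compatible m X' Y' = [&& color X Y j == s, color X Y k == - s & rest].
  move=> s1 c'; apply/forallP/and3P => [H|[/eqP cj /eqP ck /forallP H]].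
    split; last first.
    - apply/forallP=> z; apply/implyP=> zN; have := H z; rewrite !c'.
      have [/negPf-> /negPf->] := mN z zN.
      by have [/negPf-> /negPf->] := inN z zN.
    - by have := H y; rewrite !c' -/k nyx eqxx nkx nky.
    - by have := H x; rewrite !c' -/j eqxx njx njy opprK.
  apply: cases => [||||z zN]; rewrite !c'.
  - by rewrite -/j eqxx njx njy cj opprK.
  - by rewrite -/k eqxx nyx nkx nky ck.
  - by rewrite /j mK eqxx -/j njx njy cj.
  - by rewrite /k mK eqxx nyx -/k nkx nky ck opprK.
  - have [/negPf-> /negPf->] := mN z zN; have [/negPf-> /negPf->] := inN z zN.
    by have := H z; rewrite zN.
have e1 := eN _ _ 1 (or_introl erefl) (fun z => cLE X Y z Rr).
have e2 := eN _ _ (-1) (or_intror erefl) (fun z => cRE X Y z Rr).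
have m'j : join_partners x y m j = k.
  by rewrite /join_partners njx njy /= /j mK eqxx tpermL.
have m'k : join_partners x y m k = j.
  by rewrite /join_partners nkx nky /= /k mK eqxx orbT tpermR.
have e3 : compatible (join_partners x y m) X Y =
    (color X Y k == - color X Y j) && rest.
  apply/forallP/andP => [H|[/eqP ck /forallP H]].
    split; first by have := H j; rewrite m'j.
    apply/forallP=> z; apply/implyP=> zN; have := H z; rewrite /join_partners.
    have [/negPf-> /negPf->] := mN z zN.
    by have [/negPf-> /negPf->] := inN z zN.
  apply: cases => [||||z zN].
  - by rewrite /join_partners eqxx cx oppr0.
  - by rewrite /join_partners eqxx orbT cy oppr0.
  - by rewrite m'j ck.
  - by rewrite m'k ck opprK.
  - rewrite /join_partners.
    have [/negPf-> /negPf->] := mN z zN; have [/negPf-> /negPf->] := inN z zN.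
    by have := H z; rewrite zN.
(* The sign of the colour of [j] decides which of the two moves contributes. *)
have cj : color X Y j = 1 \/ color X Y j = -1.
  have rj : r j = 1%N.
    apply/eqP; have := noncrossing_mult x ncm; rewrite -/j /moved_mult eqxx njx njy rx.
    by move=> ->.
  have := Rr j; rewrite rj /mult /color; case: (j \in X); case: (j \in Y) => // _.
    by left.
  by right.
rewrite e1 e2 e3 opprK; move: (rest) => rst.
by case: cj => ->; case: rst; rewrite /= ?andbF ?andbT /= ?addr0 ?add0r ?opprK.
Qed.

Lemma cone_move_one (R : realType) (N : nat) (x y : 'I_N)
    (F : {set 'I_N} -> {set 'I_N} -> R) : adjacent x y ->
  (forall r, cone r F) -> forall r, cone r (move_one x y F).
Proof.
move=> adj coneF r; have nxy := adjacent_neq adj.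
(* For other multiplicities no set can move from [x] to [y]. *)
have [rok|rbad] := boolP [&& 0 < r x <= 2 & r y <= 1]%N; last first.
  apply: cone_ext0 => X Y Rr; have := Rr x; have := Rr y; move: rbad.
  rewrite /move_one /movable /mult => rb e1 e2; move: rb; rewrite -e1 -e2.
  by case: (x \in X); case: (y \in X); case: (x \in Y); case: (y \in Y);
    rewrite //= addr0.
apply: (cone_transfer (r' := moved_mult x y r)) (coneF _).
- move=> G H X Y; rewrite /move_one.
  by case: (movable x y X); case: (movable x y Y); rewrite ?addr0 ?add0r //; ring.
- move=> c G X Y; rewrite /move_one.
  by case: (movable x y X); case: (movable x y Y); rewrite ?addr0 ?add0r ?mulr0 // mulrDr.
- move=> G H GH X Y Rr; rewrite /move_one; congr (_ + _); case: ifP => // mv.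
    by apply: GH => z; rewrite mult_moveL // Rr.
  by apply: GH => z; rewrite mult_moveR // Rr.
- move=> m ncm; case/andP: rok; case ex: (r x) => [|[|[|]]] //= _.
    case ey: (r y) => [|[|]] // _; last exact: cone_move_one_arc.
    by apply: cone_move_one_swap => //; left.
  case ey: (r y) => [|[|]] // _; first exact: cone_move_one_join.
  by apply: cone_move_one_swap => //; right.
Qed.

(** Both sets move only when [x] is doubled and [y] is empty, and the double move leaves all colours
    unchanged. *)
Lemma cone_move_two (R : realType) (N : nat) (x y : 'I_N)
    (F : {set 'I_N} -> {set 'I_N} -> R) : adjacent x y ->
  (forall r, cone r F) -> forall r, cone r (move_two x y F).
Proof.
move=> adj coneF r; have nxy := adjacent_neq adj.
have [/andP[/eqP rx /eqP ry]|rbad] := boolP ((r x == 2) && (r y == 0))%N; last first.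
  apply: cone_ext0 => X Y Rr; have := Rr x; have := Rr y; move: rbad.
  rewrite /move_two /movable /mult => rb e1 e2; move: rb; rewrite -e1 -e2.
  by case: (x \in X); case: (y \in X); case: (x \in Y); case: (y \in Y).
have data X Y : mult X Y =1 r -> [/\ movable x y X, movable x y Y,
    color X Y x = 0 & color X Y y = 0].
  move=> Rr; have := Rr x; have := Rr y; rewrite /mult rx ry /movable /color.
  by case: (x \in X); case: (y \in X); case: (x \in Y); case: (y \in Y).
apply: (cone_transfer (r' := moved_mult x y (moved_mult x y r))) (coneF _).
- by move=> G H X Y; rewrite /move_two; case: ifP; rewrite ?addr0.
- by move=> c G X Y; rewrite /move_two; case: ifP; rewrite ?mulr0.
- move=> G H GH X Y Rr; have [mvX mvY _ _] := data X Y Rr.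
  rewrite /move_two mvX mvY; apply: GH => z.
  by rewrite mult_moveL // mult_moveR // Rr.
- move=> m ncm.
  have ncm' : noncrossing r m.
    apply: noncrossing_ext ncm => z; rewrite /moved_mult.
    have [->|zx] := eqVneq z x; first by rewrite rx.
    by have [->|zy] := eqVneq z y; rewrite ?ry.
  apply: ConeExt (ConeGen _ ncm') => X Y Rr; have [mvX mvY cx cy] := data X Y Rr.
  rewrite /move_two mvX mvY; congr ((nat_of_bool _)%:R).
  have cE z : color (move_set x y X) (move_set x y Y) z = color X Y z.
    by rewrite color_moveL // color_moveR //; ring.
  by apply/forallP/forallP => H z; have := H z; rewrite !cE.
Qed.

(** * Products of two minors on the doubled index set *)

Definition upper_half (n : nat) (X : {set 'I_(n + n)}) : {set 'I_n} :=
  [set x | lshift n x \in X].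

Definition lower_half (n : nat) (X : {set 'I_(n + n)}) : {set 'I_n} :=
  [set y | rev_ord (lshift n y) \in X].

Lemma lshift_neq_rev (n : nat) (x y : 'I_n) : lshift n x != rev_ord (lshift n y).
Proof. by rewrite -val_eqE /=; have := ltn_ord x; have := ltn_ord y; lia. Qed.

Lemma in_double_setL (n : nat) (X Y : {set 'I_n}) x :
  (lshift n x \in double_set X Y) = (x \in X).
Proof.
rewrite inE mem_imset; last exact: lshift_inj.
case: (x \in X) => //=; apply/negbTE/negP => /imsetP[y _ e].
by have := lshift_neq_rev x y; rewrite e eqxx.
Qed.

Lemma in_double_setR (n : nat) (X Y : {set 'I_n}) y :
  (rev_ord (lshift n y) \in double_set X Y) = (y \in Y).
Proof.
rewrite inE orbC (mem_imset (f := fun y => rev_ord (lshift n y))); last first.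
  by move=> a b /rev_ord_inj /lshift_inj.
case: (y \in Y) => //=; apply/negbTE/negP => /imsetP[x _ e].
by have := lshift_neq_rev x y; rewrite e eqxx.
Qed.

Lemma half_ord_ind (n : nat) (P : 'I_(n + n) -> Prop) :
  (forall x, P (lshift n x)) -> (forall y, P (rev_ord (lshift n y))) ->
  forall z, P z.
Proof.
move=> Pl Pr z; case: (ltnP z n) => [lt|le].
  by rewrite (_ : z = lshift n (Ordinal lt)); [apply: Pl | exact: val_inj].
have lt : (n + n - z.+1 < n)%N by have := ltn_ord z; lia.
rewrite (_ : z = rev_ord (lshift n (Ordinal lt))); first exact: Pr.
by apply: val_inj; rewrite /=; have := ltn_ord z; lia.
Qed.

Lemma upper_double (n : nat) (X Y : {set 'I_n}) : upper_half (double_set X Y) = X.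
Proof. by apply/setP=> x; rewrite inE in_double_setL. Qed.

Lemma lower_double (n : nat) (X Y : {set 'I_n}) : lower_half (double_set X Y) = Y.
Proof. by apply/setP=> x; rewrite inE in_double_setR. Qed.

Lemma movable_upper (n : nat) (u v : 'I_n) (X : {set 'I_(n + n)}) :
  movable u v (upper_half X) = movable (lshift n u) (lshift n v) X.
Proof. by rewrite /movable !inE. Qed.

Lemma move_upper (n : nat) (u v : 'I_n) (X : {set 'I_(n + n)}) :
  upper_half (move_set (lshift n u) (lshift n v) X) = move_set u v (upper_half X).
Proof.
rewrite /move_set movable_upper; case: ifP => // _; apply/setP=> x.
by rewrite !inE !(inj_eq (@lshift_inj _ _)).
Qed.

Lemma move_lower (n : nat) (u v : 'I_n) (X : {set 'I_(n + n)}) :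
  lower_half (move_set (lshift n u) (lshift n v) X) = lower_half X.
Proof.
rewrite /move_set; case: ifP => // _; apply/setP=> y.
by rewrite !inE !(eq_sym (rev_ord _)) !(negPf (lshift_neq_rev _ _)).
Qed.

(* The lower halves are crossed, as in R1 = P1 ∪ (2n + 1 - Q2). *)
Definition minor_product (R : realType) (n : nat) (A : 'M[R]_n)
    (R1 R2 : {set 'I_(n + n)}) : R :=
  minor A (upper_half R1) (lower_half R2) * minor A (upper_half R2) (lower_half R1).

Lemma minor_product_chip (R : realType) (n : nat) (t : R) (u v : 'I_n)
    (A : 'M[R]_n) (R1 R2 : {set 'I_(n + n)}) : adjacent u v ->
  minor_product (chip t u v A) R1 R2 = minor_product A R1 R2 +
    (t * move_one (lshift n u) (lshift n v) (minor_product A) R1 R2 +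
     t ^+ 2 * move_two (lshift n u) (lshift n v) (minor_product A) R1 R2).
Proof.
move=> adj; rewrite /minor_product !minor_chip // /move_one /move_two.
rewrite !movable_upper !move_upper !move_lower.
by do 2!case: (movable _ _ _); rewrite /=; ring.
Qed.

(** The rainbow of nested arcs; it is the matching attached to the identity matrix. *)
Lemma noncrossing_rev (N : nat) (r : 'I_N -> nat) :
  (forall x, r (rev_ord x) = r x) ->
  noncrossing r (fun x => if r x == 1%N then rev_ord x else x).
Proof.
move=> rr; split=> [x|x /negPf-> //|a c ra rc].
  by case: (eqVneq (r x) 1%N) => [e|/negPf->//]; rewrite rr e eqxx rev_ordK.
rewrite ra rc !eqxx -!val_eqE /=.
by have := ltn_ord a; have := ltn_ord c; lia.
Qed.

Lemma minor_product1 (R : realType) (n : nat) (R1 R2 : {set 'I_(n + n)}) :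
  minor_product (1%:M : 'M[R]_n) R1 R2 =
  [forall x, (x \in R1) == (rev_ord x \in R2)]%:R.
Proof.
rewrite /minor_product !minor1 -natrM mulnb; congr ((nat_of_bool _)%:R).
apply/idP/forallP => [/andP[/eqP e1 /eqP e2]|H].
  apply: half_ord_ind => x.
    by have /setP/(_ x) := e1; rewrite !inE => ->.
  by have /setP/(_ x) := e2; rewrite !inE rev_ordK => ->.
apply/andP; split; apply/eqP/setP => x; rewrite !inE.
  by rewrite (eqP (H _)).
by rewrite -(rev_ordK (lshift n x)) -(eqP (H _)) rev_ordK.
Qed.

(** A chip relates pairs of multiplicities [r] to pairs of other multiplicities, so the induction
    has to carry all [r] at once. *)
Theorem cone_minor_product (R : realType) (n : nat) (A : 'M[R]_n) :
  chip_generated A -> forall r, cone r (minor_product A).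
Proof.
elim=> [|t u v B adj t0 _ IH|d u B d0 _ IH] r.
- have [/forallP rr|/forallPn[x0 rx0]] := boolP [forall x, r (rev_ord x) == r x].
    have gen := ConeGen R (noncrossing_rev (fun x => eqP (rr x))).
    apply: ConeExt gen => X Y Rr; rewrite minor_product1; congr ((nat_of_bool _)%:R).
    have H x : mult X Y (rev_ord x) = mult X Y x by rewrite !Rr (eqP (rr x)).
    apply/forallP/forallP => cXY x.
      have := cXY x; have := H x; rewrite -Rr; rewrite /mult /color.
      by case: (x \in X); case: (x \in Y) => /=; case: (rev_ord x \in X);
        case: (rev_ord x \in Y).
    have := cXY x; have := cXY (rev_ord x); rewrite rev_ordK -Rr /mult /color.
    by case e1: (x \in X); case e2: (x \in Y) => /=; case e3: (rev_ord x \in X) => //;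
      case e4: (rev_ord x \in Y); rewrite //= ?e1 ?e2 ?e3 ?e4.
  (* At the identity a nonzero product forces [r] to be symmetric under reflection. *)
  apply: cone_ext0 => X Y Rr; rewrite minor_product1.
  rewrite (_ : [forall x, _] = false) //; apply/negbTE/negP => /forallP H.
  case/eqP: rx0; rewrite -!Rr /mult (eqP (H x0)).
  by have := H (rev_ord x0); rewrite rev_ordK => /eqP <-; rewrite addnC.
- have adj' : adjacent (lshift n u) (lshift n v) by [].
  apply: ConeExt (ConeAdd (IH r) (ConeAdd (ConeScale t0 (cone_move_one adj' IH r))
    (ConeScale (exprn_ge0 2 t0) (cone_move_two adj' IH r)))) => X Y _.
  by rewrite minor_product_chip.
(* Scaling a row multiplies the product by a power of [d] that depends only on [r]. *)
- apply: ConeExt (ConeScale (exprn_ge0 (r (lshift n u)) d0) (IH r)) => X Y Rr.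
  rewrite /minor_product !minor_scale_row -Rr /mult !inE exprD; ring.
Qed.

(** * Contiguous sets *)

Lemma refines_tn_ineq (R : realType) (n : nat)
    (P1 P2 Q1 Q2 I1 I2 J1 J2 : {set 'I_n}) :
  refines (double_set P1 Q2) (double_set P2 Q1)
    (double_set I1 J2) (double_set I2 J1) ->
  tn_ineq R P1 P2 Q1 Q2 I1 I2 J1 J2.
Proof.
move=> ref A /tn_chip_generated genA.
have := cone_refines (cone_minor_product genA _) (fun=> erefl) ref.
by rewrite /minor_product !upper_double !lower_double.
Qed.

Lemma height_step (m : nat) (X1 X2 : {set 'I_m}) (s : nat) :
  (s < m)%N /\ (exists2 x : 'I_m, x = s :> nat &
    height X1 X2 s.+1 = height X1 X2 s + color X1 X2 x) \/
  (m <= s)%N /\ height X1 X2 s.+1 = height X1 X2 s.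
Proof.
case: (ltnP s m) => [lt|le]; [left | right]; split => //.
  by exists (Ordinal lt) => //; exact: (heightS X1 X2 (Ordinal lt)).
by rewrite !(@height_max _ _ _ _ le) height_max // leqW.
Qed.

(** Discrete intermediate values: the height changes by at most 1 at each step. *)
Lemma height_ivt (m : nat) (X1 X2 : {set 'I_m}) (s t : nat) (v : int) :
  (s <= t)%N ->
  (height X1 X2 s <= v <= height X1 X2 t) ||
  (height X1 X2 t <= v <= height X1 X2 s) ->
  exists2 u, (s <= u <= t)%N & height X1 X2 u = v.
Proof.
elim: t => [|t IH]; first by rewrite leqn0 => /eqP-> ?; exists 0%N; lia.
rewrite leq_eqVlt => /orP[/eqP->|st] hv; first by exists t.+1; lia.
have [|far] := boolP ((height X1 X2 s <= v <= height X1 X2 t) ||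
  (height X1 X2 t <= v <= height X1 X2 s)).
  by case/IH => // u su uv; exists u => //; lia.
exists t.+1; first lia.
have [[_ [x _ e]]|[_ e]] := height_step X1 X2 t; last first.
  by rewrite e in hv; rewrite hv in far.
move: hv far; rewrite e /color; case: (x \in X1); case: (x \in X2) => /=; lia.
Qed.

Lemma refines_step (m : nat) (R1 R2 K1 K2 : {set 'I_m}) s :
  same_multiset R1 R2 K1 K2 ->
  exists a b : int, [/\ height R1 R2 s.+1 = height R1 R2 s + a,
    height K1 K2 s.+1 = height K1 K2 s + b,
    (a = 0 \/ a = 1 \/ a = -1) & `|a| = `|b|].
Proof.
move=> RK; case: (height_step R1 R2 s) => -[sm]; last first.
  move=> ->; exists 0, 0; rewrite !addr0; split=> //; last by left.
  by case: (height_step K1 K2 s) => -[] //; rewrite ltnNge sm.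
case=> x xs ->; case: (height_step K1 K2 s) => -[]; last by rewrite leqNgt sm.
move=> _ [y ys ->]; have {y ys} -> : y = x by apply: val_inj; rewrite /= ys xs.
exists (color R1 R2 x), (color K1 K2 x); split=> //; have := RK x; rewrite /color;
case: (x \in R1); case: (x \in R2); case: (x \in K1); case: (x \in K2) => //= _;
by [left | right; left | right; right].
Qed.

(** Induction on the length of the interval. A first step towards the final height uses one unit of
    the bound, and a flat step uses none. After a step in the wrong direction the path returns to
    its initial height, and there [refines] restores the initial height of the other pair too. *)
Lemma refines_lipschitz (m : nat) (R1 R2 K1 K2 : {set 'I_m}) (s t : nat) :
  refines R1 R2 K1 K2 ->
  `|height K1 K2 t - height K1 K2 s| <= `|height R1 R2 t - height R1 R2 s|.
Proof.
move=> [RK ref]; wlog st : s t / (s <= t)%N.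
  move=> H; case/orP: (leq_total s t) => [/H//|/H].
  by rewrite distrC [X in _ <= X]distrC.
have [k] := ubnP (t - s); elim: k s t st => // k IH s t st ltk.
have [e|ne] := eqVneq (height R1 R2 t) (height R1 R2 s).
  by rewrite (ref _ _ e) subrr normr_ge0.
have {}st : (s < t)%N by rewrite ltn_neqAle st andbT; apply: contraNneq ne => ->.
have [a [b [ea eb a1 ab]]] := refines_step s RK.
have [opp|same] := boolP ((a == 0) || (0 < a * (height R1 R2 t - height R1 R2 s))).
  have := IH s.+1 t st; rewrite ea eb.
  have -> : (t - s.+1 < k)%N by lia.
  by move=> /(_ isT); case: a1 opp ab => [->|[->|->]] /=; lia.
have [u su eu] : exists2 u, (s.+1 <= u <= t)%N & height R1 R2 u = height R1 R2 s.
  apply: height_ivt => //; rewrite ea.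
  by move: same; case: a1 => [->|[->|->]] //=; lia.
have := IH u t; rewrite (ref _ _ eu) eu; apply; lia.
Qed.

Lemma refines_parity (m : nat) (R1 R2 K1 K2 : {set 'I_m}) s :
  same_multiset R1 R2 K1 K2 ->
  exists z : int, height R1 R2 s - height K1 K2 s = 2 * z.
Proof.
move=> RK; exists (\sum_(x < m | (x < s)%N) ((x \in R1)%:Z - (x \in K1)%:Z)).
rewrite /height -sumrB big_distrr /=; apply: eq_bigr => x _.
have := RK x; rewrite /color.
by case: (x \in R1); case: (x \in R2); case: (x \in K1); case: (x \in K2).
Qed.

(** The difference is at most 1 by the Lipschitz bound and odd by parity. *)
Lemma refines_adjacent_heights (m : nat) (R1 R2 K1 K2 : {set 'I_m}) (s t : nat) :
  refines R1 R2 K1 K2 -> `|height R1 R2 t - height R1 R2 s| = 1 ->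
  `|height K1 K2 t - height K1 K2 s| = 1.
Proof.
move=> ref h1; have := refines_lipschitz s t ref; rewrite h1.
have [z1 e1] := refines_parity s ref.1; have [z2 e2] := refines_parity t ref.1.
lia.
Qed.

Lemma card_setI_sum (T : finType) (S X : {set T}) :
  (#|S :&: X| = \sum_(x in S) (x \in X))%N.
Proof.
rewrite -sum1_card big_mkcond [RHS]big_mkcond.
by apply: eq_bigr => x _; rewrite inE; case: (x \in S); case: (x \in X).
Qed.

Lemma card_diff_height (m : nat) (X1 X2 M S : {set 'I_m}) (s t : nat) :
  (s <= t)%N -> (forall x, x \notin M -> color X1 X2 x = 0) ->
  S = [set x in M | (s <= x < t)%N] ->
  (#|S :&: X1|)%:Z - (#|S :&: X2|)%:Z = height X1 X2 t - height X1 X2 s.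
Proof.
move=> st cM ->; rewrite height_diff // !card_setI_sum.
rewrite -!natz !natr_sum -sumrB big_mkcond [RHS]big_mkcond.
apply: eq_bigr => x _; rewrite inE !natz -/(color X1 X2 x).
by case: (boolP (x \in M)) => //= /cM ->; rewrite if_same.
Qed.

(** Trades intervals of ranks in [M] for intervals of positions, where differences of cardinalities
    become differences of heights. *)
Lemma contiguousP (m : nat) (M S : {set 'I_m}) :
  contiguous M S <->
  exists s t : nat, (s <= t)%N /\ S = [set x in M | (s <= x < t)%N].
Proof.
have incr := @enum_val_increasing m M.
have mono (j k : 'I_#|M|) : (enum_val j < enum_val k)%N = (j < k)%N.
  case: (ltngtP j k) => [/incr//|/incr lt|/val_inj->]; last by rewrite ltnn.
  by apply/negbTE; rewrite -leqNgt ltnW.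
have inS (P : pred nat) (Q : pred nat) : (forall k : 'I_#|M|, P k = Q (enum_val k)) ->
    [set enum_val k | k : 'I_#|M| & P k] = [set x in M | Q x].
  move=> PQ; apply/setP=> x; rewrite inE; apply/imsetP/andP => [[k]|[Mx Qx]].
    by rewrite inE PQ => Qk ->; rewrite enum_valP.
  exists (enum_rank_in Mx x); last by rewrite enum_rankK_in.
  by rewrite inE PQ enum_rankK_in.
split=> [[a [b ->]]|[s [t [st ->]]]].
  pose f a : nat := (\max_(j : 'I_#|M| | j < a) (enum_val j).+1)%N.
  have fE c (k : 'I_#|M|) : (c <= k)%N = (f c <= enum_val k)%N.
    apply/idP/bigmax_leqP => [ck j jc|H]; first by rewrite mono (leq_trans jc).
    by rewrite leqNgt; apply/negP => /H; rewrite ltnn.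
  case: (leqP (f a) (f b)) => ab.
    exists (f a), (f b); split => //.
    by apply: (inS (fun k => a <= k < b)%N (fun x => f a <= x < f b)%N) => k; rewrite (fE a) (ltnNge k) (fE b) -ltnNge.
  exists 0%N, 0%N; split=> //.
  apply: (inS (fun k => a <= k < b)%N (fun x => 0 <= x < 0)%N) => k.
  by rewrite (fE a) (ltnNge k) (fE b); lia.
pose g c := #|[set j : 'I_#|M| | (enum_val j < c)%N]|.
have gE c (k : 'I_#|M|) : (g c <= k)%N = (c <= enum_val k)%N.
  have cardlt (l : nat) : (l <= #|M|)%N -> #|[set j : 'I_#|M| | (j < l)%N]| = l.
    move=> lM; have wi : injective (widen_ord lM).
      by move=> i j /(congr1 val) /= /val_inj.
    rewrite cardsE -[RHS](card_ord l) -(card_image wi).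
    apply: eq_card => j; rewrite unfold_in /=; apply/idP/imageP => [jl|[i _ ->]]; last exact: (ltn_ord i).
    by exists (Ordinal jl) => //; exact: val_inj.
  case: (leqP c (enum_val k)) => ck.
    rewrite -[X in (_ <= X)%N](cardlt k) ?(ltnW (ltn_ord k)) //.
    apply: subset_leq_card; apply/subsetP => j; rewrite !inE -mono => lt.
    exact: leq_trans lt ck.
  apply/negbTE; rewrite -ltnNge -[X in (X <= _)%N](cardlt k.+1) ?ltn_ord //.
  apply: subset_leq_card; apply/subsetP => j; rewrite !inE ltnS => le.
  by apply: leq_ltn_trans ck; rewrite increasing_leq.
exists (g s), (g t); apply/esym.
apply: (inS (fun k => g s <= k < g t)%N (fun x => s <= x < t)%N) => k.
by rewrite gE ltnNge gE -ltnNge.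
Qed.

(** For a fixed sum, the larger of two numbers is governed by their difference, so the inequality of
    maxima compares absolute height differences and follows from the Lipschitz bound. Conversely,
    equal heights at the two ends make the interval even and split evenly by [R1] and [R2], which
    forces an even split by [K1] and [K2]. *)
Lemma contiguous_set_conditionP (m : nat) (R1 R2 K1 K2 : {set 'I_m}) :
  contiguous_set_condition R1 R2 K1 K2 <-> refines R1 R2 K1 K2.
Proof.
pose M := symdiff R1 R2.
have MR x : x \notin M -> color R1 R2 x = 0.
  by rewrite !inE /color; case: (x \in R1); case: (x \in R2).
have MK x : same_multiset R1 R2 K1 K2 -> x \notin M -> color K1 K2 x = 0.
  move=> /(_ x) + /MR; rewrite /color; case: (x \in R1); case: (x \in R2);
  by case: (x \in K1); case: (x \in K2).
have split_card (X1 X2 S : {set 'I_m}) :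
    (#|S :&: X1| + #|S :&: X2| = \sum_(x in S) ((x \in X1) + (x \in X2)))%N.
  by rewrite !card_setI_sum -big_split.
have size_S (S : {set 'I_m}) : S \subset M -> (#|S :&: R1| + #|S :&: R2| = #|S|)%N.
  move=> /subsetP SM; rewrite split_card -sum1_card; apply: eq_bigr => x /SM.
  by rewrite !inE; case: (x \in R1); case: (x \in R2).
split=> [[RK cond]|ref]; split=> //; last first.
- move=> S SM /contiguousP[s [t [st eS]]] _.
  have := refines_lipschitz s t ref.
  rewrite -(card_diff_height st MR eS) -(card_diff_height st (fun x => MK x ref.1) eS).
  have : (#|S :&: K1| + #|S :&: K2| = #|S :&: R1| + #|S :&: R2|)%N.
    by rewrite !split_card; apply: eq_bigr => x _; rewrite ref.1.
  lia.
- by case: ref.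
move=> s t; wlog st : s t / (s <= t)%N.
  move=> H e; case/orP: (leq_total s t) => [/H->//|/H e'].
  by rewrite e'.
move=> e; pose S := [set x in M | (s <= x < t)%N].
have SM : S \subset M by apply/subsetP => x; rewrite inE => /andP[].
have eR := card_diff_height st MR (erefl S).
have eK := card_diff_height st (fun x => MK x RK) (erefl S).
have cS : contiguous M S by apply/contiguousP; exists s, t.
have sumK : (#|S :&: K1| + #|S :&: K2| = #|S :&: R1| + #|S :&: R2|)%N.
  by rewrite !split_card; apply: eq_bigr => x _; rewrite RK.
have := cond S SM cS; have := size_S S SM.
move: eR eK; rewrite -/S e subrr; lia.
Qed.

(** * Necessity of the condition on heights *)

Lemma tn_ineq_tr (R : realType) (n : nat) (P1 P2 Q1 Q2 I1 I2 J1 J2 : {set 'I_n}) :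
  tn_ineq R P1 P2 Q1 Q2 I1 I2 J1 J2 -> tn_ineq R Q1 Q2 P1 P2 J1 J2 I1 I2.
Proof. by move=> H A /tn_tr /H; rewrite !minor_tr. Qed.

Lemma quadratic_leading (R : realType) (a0 a1 a2 b0 b1 b2 : R) :
  (forall t, 0 <= t -> a0 + a1 * t + a2 * t ^+ 2 <= b0 + b1 * t + b2 * t ^+ 2) ->
  a2 <= b2 /\ (a2 = b2 -> a1 <= b1).
Proof.
move=> H; split=> [|e]; rewrite leNgt; apply/negP => lt.
  pose d := a2 - b2; have d0 : 0 < d by rewrite subr_gt0.
  (* Chosen so that [d * t] exceeds the sum of the lower-order differences while [t >= 1]. *)
  pose t := 1 + (`|a1 - b1| + `|a0 - b0|) / d.
  have q0 : 0 <= (`|a1 - b1| + `|a0 - b0|) / d.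
    by apply: divr_ge0; [apply: addr_ge0; exact: normr_ge0 | exact: ltW].
  have t1 : 1 <= t by rewrite lerDl.
  have dt : d * t = d + `|a1 - b1| + `|a0 - b0| by rewrite /t; field; rewrite gt_eqF.
  have := H t (le_trans ler01 t1).
  have h1 : - (a1 - b1) <= `|a1 - b1| by rewrite -normrN ler_norm.
  have h0 : - (a0 - b0) <= `|a0 - b0| by rewrite -normrN ler_norm.
  have e2 : a2 * t ^+ 2 = b2 * t ^+ 2 + (d * t) * t by rewrite /d; ring.
  rewrite e2 dt; have n0 := normr_ge0 (a0 - b0); have n1 := normr_ge0 (a1 - b1).
  move: (`|a0 - b0|) (`|a1 - b1|) h0 h1 n0 n1 {dt q0 e2} => w0 w1 h0 h1 n0 n1.
  have k0 : 0 <= w0 * (t - 1) by rewrite mulr_ge0 // subr_ge0.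
  have k1 : 0 <= (w1 + (a1 - b1)) * t by apply: mulr_ge0; [lra | exact: le_trans ler01 t1].
  have k2 : 0 < d * t by rewrite mulr_gt0 // (lt_le_trans ltr01).
  by lra.
pose d := a1 - b1; have d0 : 0 < d by rewrite subr_gt0.
pose t := (1 + `|a0 - b0|) / d.
have t0 : 0 <= t by apply: divr_ge0; [apply: addr_ge0 | exact: ltW].
have dt : d * t = 1 + `|a0 - b0| by rewrite /t; field; rewrite gt_eqF.
have := H t t0; rewrite e.
have h0 : - (a0 - b0) <= `|a0 - b0| by rewrite -normrN ler_norm.
have e1 : a1 * t = b1 * t + d * t by rewrite /d; ring.
by rewrite e1 dt; lra.
Qed.

(** * Downward moves and positive minors *)

(** The termination measure of downward moves. *)
Definition rank_sum (n : nat) (X : {set 'I_n}) : nat := (\sum_(x in X) x)%N.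

Lemma rank_sum_move (n : nat) (u v : 'I_n) (X : {set 'I_n}) : movable u v X ->
  (rank_sum (move_set u v X) + u = rank_sum X + v)%N.
Proof.
move=> mv; rewrite /move_set mv; case/andP: mv => uX vX.
have -> : rank_sum X = (u + rank_sum (X :\ u))%N.
  by rewrite /rank_sum (big_setD1 u uX).
have -> : rank_sum (v |: X :\ u) = (v + rank_sum (X :\ u))%N.
  by rewrite /rank_sum big_setU1 //= !inE (negPf vX) andbF.
by lia.
Qed.

Lemma rank_sum_move_le (n : nat) (u v : 'I_n) (X : {set 'I_n}) : u = v.+1 :> nat ->
  (rank_sum (move_set u v X) + movable u v X = rank_sum X)%N.
Proof.
move=> uv; case: (boolP (movable u v X)) => [/rank_sum_move|/negPf mv]; first lia.
by rewrite /move_set mv addn0.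
Qed.

Lemma down_closed (n : nat) (X : {set 'I_n}) (s t : nat) :
  (forall u v : 'I_n, u = v.+1 :> nat -> (s <= v)%N -> (u < t)%N -> ~~ movable u v X) ->
  forall x y : 'I_n, (s <= y)%N -> (y <= x)%N -> (x < t)%N -> x \in X -> y \in X.
Proof.
move=> nomov x y sy yx xt xX; have [k] := ubnP (x - y).
elim: k y sy yx => // k IH y sy yx ltk.
move: yx; rewrite leq_eqVlt => /orP[/eqP/val_inj->//|yx].
have lt : (y.+1 < n)%N by apply: leq_trans (ltn_ord x).
have yX : Ordinal lt \in X by apply: IH => //=; lia.
have := nomov (Ordinal lt) y erefl sy; rewrite /movable yX /= negbK; apply; lia.
Qed.

Lemma initial_eq (n : nat) (X Y : {set 'I_n}) : #|X| = #|Y| ->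
  (forall x y : 'I_n, y \in Y -> x \in X -> (y <= x)%N -> y \in X) ->
  (forall x y : 'I_n, y \in X -> x \in Y -> (y <= x)%N -> y \in Y) -> X = Y.
Proof.
move=> cXY dX dY; apply/eqP; rewrite eqEcard cXY leqnn andbT.
apply: contraT => /subsetPn[x xX xY].
have YX : Y \subset X.
  apply/subsetP => y yY; apply: (dX x) => //; rewrite leqNgt.
  by apply: contra xY => /ltnW; exact: dY.
have := eqEcard Y X; rewrite YX cXY leqnn => /eqP e.
by rewrite e xX in xY.
Qed.

Lemma card_below (n t : nat) : (t <= n)%N -> #|[set x : 'I_n | (x < t)%N]| = t.
Proof.
move=> tn; rewrite -sum1_card.
under eq_bigl => i do rewrite inE.
by rewrite (big_ord_narrow tn) sum1_card card_ord.
Qed.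

Lemma card_interval (n s t : nat) : (s <= t)%N -> (t <= n)%N ->
  #|[set x : 'I_n | (s <= x < t)%N]| = (t - s)%N.
Proof.
move=> st tn.
have <- : [set x : 'I_n | (x < t)%N] :\: [set x : 'I_n | (x < s)%N] =
    [set x : 'I_n | (s <= x < t)%N].
  by apply/setP=> x; rewrite !inE -leqNgt.
rewrite cardsD (setIidPr _) ?card_below // ?(leq_trans st) //.
by apply/subsetP => x; rewrite !inE => /leq_trans; apply.
Qed.

Definition count_below (n : nat) (X : {set 'I_n}) (s : nat) : nat :=
  #|[set x in X | (x < s)%N]|.

Lemma height_count (n : nat) (X1 X2 : {set 'I_n}) (s : nat) :
  height X1 X2 s = (count_below X1 s)%:Z - (count_below X2 s)%:Z.
Proof.
have e X : (count_below X s)%:Z = \sum_(x < n | (x < s)%N) (x \in X)%:Z.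
  rewrite /count_below -sum1_card -natz natr_sum big_mkcond [RHS]big_mkcond.
  by apply: eq_bigr => x _; rewrite inE; case: (x \in X); case: ifP.
by rewrite !e -sumrB.
Qed.

Lemma minors_positive_move (R : realType) (n : nat) (u v : 'I_n) (A : 'M[R]_n)
    (X Y : {set 'I_n}) : adjacent u v -> totally_nonnegative A ->
  0 < minor A (move_set u v X) Y -> 0 < minor (chip 1 u v A) X Y.
Proof.
move=> adj tnA pos; rewrite minor_chip // mul1r.
have cXY : #|X| = #|Y|.
  apply/eqP; apply: contraLR pos => ne.
  by rewrite minor_card ?ltxx // card_move_set.
case: (boolP (movable u v X)) => [_|/negPf mv]; first by rewrite ltr_wpDl ?tnA.
by move: pos; rewrite /move_set mv addr0.
Qed.

(** Downward moves on rows and columns lead to initial segments, where the identity matrix has both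
    minors equal to 1. Each move is undone by a chip with [t = 1], which keeps positive minors
    positive. *)
Lemma minors_positive (R : realType) (n : nat) (P1 P2 Q1 Q2 : {set 'I_n}) :
  #|P1| = #|Q1| -> #|P2| = #|Q2| ->
  exists A : 'M[R]_n,
    [/\ totally_nonnegative A, 0 < minor A P1 Q1 & 0 < minor A P2 Q2].
Proof.
have step (X1 X2 : {set 'I_n}) (u v : 'I_n) : u = v.+1 :> nat ->
    movable u v X1 || movable u v X2 ->
    (rank_sum (move_set u v X1) + rank_sum (move_set u v X2) <
     rank_sum X1 + rank_sum X2)%N.
  move=> uv; have := rank_sum_move_le X1 uv; have := rank_sum_move_le X2 uv.
  by case: (movable u v X1); case: (movable u v X2) => //=; lia.
have [k] := ubnP (rank_sum P1 + rank_sum P2 + (rank_sum Q1 + rank_sum Q2)).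
elim: k P1 P2 Q1 Q2 => // k IH P1 P2 Q1 Q2 ltk c1 c2.
pose red X1 X2 := [exists u : 'I_n, exists v : 'I_n,
  (u == v.+1 :> nat) && (movable u v X1 || movable u v X2)].
have adjS (u v : 'I_n) : u = v.+1 :> nat -> adjacent u v.
  by move=> uv; rewrite /adjacent uv eqxx orbT.
have [/existsP[u /existsP[v /andP[/eqP uv mv]]]|nP] := boolP (red P1 P2).
  have lt := step _ _ _ _ uv mv.
  have [||| A [tnA p1 p2]] := IH (move_set u v P1) (move_set u v P2) Q1 Q2.
  - lia.
  - by rewrite card_move_set.
  - by rewrite card_move_set.
  exists (chip 1 u v A); split; first by apply: tn_chip => //; exact: adjS.
  - by apply: minors_positive_move => //; exact: adjS.
  - by apply: minors_positive_move => //; exact: adjS.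
have [/existsP[u /existsP[v /andP[/eqP uv mv]]]|nQ] := boolP (red Q1 Q2).
  have lt := step _ _ _ _ uv mv.
  have [||| A [tnA p1 p2]] := IH P1 P2 (move_set u v Q1) (move_set u v Q2).
  - lia.
  - by rewrite card_move_set.
  - by rewrite card_move_set.
  exists (chip 1 u v A^T)^T; split.
  - by apply/tn_tr/tn_chip/tn_tr => //; exact: adjS.
  - rewrite minor_tr; apply: minors_positive_move; [exact: adjS | exact: tn_tr |].
    by rewrite minor_tr.
  - rewrite minor_tr; apply: minors_positive_move; [exact: adjS | exact: tn_tr |].
    by rewrite minor_tr.
have closed X1 X2 : ~~ red X1 X2 ->
    (forall x y : 'I_n, (y <= x)%N -> x \in X1 -> y \in X1) /\
    (forall x y : 'I_n, (y <= x)%N -> x \in X2 -> y \in X2).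
  move=> /existsPn nX; have nm (u v : 'I_n) : u = v.+1 :> nat -> ~~ movable u v X1 && ~~ movable u v X2.
    by move=> uv; have /existsPn/(_ v) := nX u; rewrite uv eqxx negb_or.
  split=> x y yx; apply: (down_closed (s := 0) (t := n)) => // u v uv _ _;
  by case/andP: (nm u v uv).
have [dP1 dP2] := closed _ _ nP; have [dQ1 dQ2] := closed _ _ nQ.
exists 1%:M; rewrite !minor1.
rewrite (initial_eq c1) => [|x y _ xX yx|x y _ xX yx]; [|exact: dP1 xX|exact: dQ1 xX].
rewrite (initial_eq c2) => [|x y _ xX yx|x y _ xX yx]; [|exact: dP2 xX|exact: dQ2 xX].
rewrite !eqxx.
by split; [exact: tn1 | exact: ltr01 | exact: ltr01].
Qed.

Lemma tn_ineq_move (R : realType) (n : nat)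
    (P1 P2 Q1 Q2 I1 I2 J1 J2 : {set 'I_n}) (u v : 'I_n) :
  #|P1| = #|Q1| -> #|P2| = #|Q2| -> adjacent u v ->
  tn_ineq R P1 P2 Q1 Q2 I1 I2 J1 J2 ->
  (movable u v P1 + movable u v P2 <= movable u v I1 + movable u v I2)%N /\
  ((movable u v P1 + movable u v P2 = movable u v I1 + movable u v I2)%N ->
   tn_ineq R (move_set u v P1) (move_set u v P2) Q1 Q2
     (move_set u v I1) (move_set u v I2) J1 J2).
Proof.
move=> c1 c2 adj valid.
have main (A : 'M[R]_n) : totally_nonnegative A ->
    let L' := minor A (move_set u v P1) Q1 * minor A (move_set u v P2) Q2 in
    let K' := minor A (move_set u v I1) J1 * minor A (move_set u v I2) J2 in
    ((movable u v I1 + movable u v I2 < movable u v P1 + movable u v P2)%N ->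
      L' <= 0) /\
    ((movable u v P1 + movable u v P2 = movable u v I1 + movable u v I2)%N ->
      L' <= K').
  move=> tnA L' K'.
  have : forall t : R, 0 <= t ->
      (minor A P1 Q1 + (if movable u v P1 then t * minor A (move_set u v P1) Q1 else 0)) *
      (minor A P2 Q2 + (if movable u v P2 then t * minor A (move_set u v P2) Q2 else 0)) <=
      (minor A I1 J1 + (if movable u v I1 then t * minor A (move_set u v I1) J1 else 0)) *
      (minor A I2 J2 + (if movable u v I2 then t * minor A (move_set u v I2) J2 else 0)).
    move=> t t0; rewrite -!minor_chip //; exact/valid/tn_chip.
  rewrite /L' /K'.
  set p1 := minor A P1 Q1; set p2 := minor A P2 Q2.
  set i1 := minor A I1 J1; set i2 := minor A I2 J2.
  set p1' := minor A (move_set u v P1) Q1; set p2' := minor A (move_set u v P2) Q2.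
  set i1' := minor A (move_set u v I1) J1; set i2' := minor A (move_set u v I2) J2.
  have n1 : p1' = if movable u v P1 then p1' else p1 by rewrite /p1' /move_set; case: ifP.
  have n2 : p2' = if movable u v P2 then p2' else p2 by rewrite /p2' /move_set; case: ifP.
  have n3 : i1' = if movable u v I1 then i1' else i1 by rewrite /i1' /move_set; case: ifP.
  have n4 : i2' = if movable u v I2 then i2' else i2 by rewrite /i2' /move_set; case: ifP.
  have -> : p1' * p2' = (if movable u v P1 then p1' else p1) *
      (if movable u v P2 then p2' else p2) by rewrite -n1 -n2.
  have -> : i1' * i2' = (if movable u v I1 then i1' else i1) *
      (if movable u v I2 then i2' else i2) by rewrite -n3 -n4.
  (* The coefficients of [t] and [t ^+ 2] in either side. *)
  pose a1 (b1 b2 : bool) (x1 x2 x1' x2' : R) := (if b1 then x1' * x2 else 0) + (if b2 then x1 * x2' else 0).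
  pose a2 (b1 b2 : bool) (x1' x2' : R) := if b1 && b2 then x1' * x2' else 0.
  move=> H; have := @quadratic_leading _ (p1 * p2)
    (a1 (movable u v P1) (movable u v P2) p1 p2 p1' p2')
    (a2 (movable u v P1) (movable u v P2) p1' p2') (i1 * i2)
    (a1 (movable u v I1) (movable u v I2) i1 i2 i1' i2')
    (a2 (movable u v I1) (movable u v I2) i1' i2').
  have H0 := H 0 (lexx _).
  case=> [t t0|].
    have := H t t0; rewrite /a1 /a2.
    have ring_eq (b1 b2 : bool) (x1 x2 x1' x2' : R) :
      (x1 + (if b1 then t * x1' else 0)) * (x2 + (if b2 then t * x2' else 0)) =
      x1 * x2 + ((if b1 then x1' * x2 else 0) + (if b2 then x1 * x2' else 0)) * t +
      (if b1 && b2 then x1' * x2' else 0) * t ^+ 2.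
      by case: b1; case: b2 => /=; ring.
    by rewrite !ring_eq.
  move: H0; rewrite /a1 /a2.
  case: (movable u v P1); case: (movable u v P2); case: (movable u v I1);
  case: (movable u v I2); rewrite /= ?mul0r ?addr0 ?add0r => H0 le2 le1;
  split=> // _; by [exact: le2 | exact: (le1 erefl) | exact: H0].
split=> [|e A tnA]; last by case: (main A tnA) => _; apply.
rewrite leqNgt; apply/negP => lt.
have [| | A [tnA pos1 pos2]] := @minors_positive R n (move_set u v P1) (move_set u v P2) Q1 Q2.
- by rewrite card_move_set.
- by rewrite card_move_set.
have [/(_ lt)] := main A tnA.
by rewrite leNgt mulr_gt0.
Qed.

(** Scaling row [x] by [d] multiplies each side by [d] to the multiplicity of [x]; small and large
    [d] compare the exponents. *)
Lemma tn_ineq_mult (R : realType) (n : nat)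
    (P1 P2 Q1 Q2 I1 I2 J1 J2 : {set 'I_n}) :
  #|P1| = #|Q1| -> #|P2| = #|Q2| -> #|I1| = #|J1| -> #|I2| = #|J2| ->
  tn_ineq R P1 P2 Q1 Q2 I1 I2 J1 J2 -> same_multiset P1 P2 I1 I2.
Proof.
move=> c1 c2 d1 d2 valid x.
have [A [tnA pos1 pos2]] := @minors_positive R n P1 P2 Q1 Q2 c1 c2.
pose L := minor A P1 Q1 * minor A P2 Q2; pose K := minor A I1 J1 * minor A I2 J2.
have L0 : 0 < L by rewrite mulr_gt0.
have K0 : 0 <= K by rewrite mulr_ge0 // tnA.
have H d : 0 <= d -> d ^+ ((x \in P1) + (x \in P2)) * L <= d ^+ ((x \in I1) + (x \in I2)) * K.
  have e (b1 b2 : bool) m1 m2 :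
      d ^+ (b1 + b2) * (m1 * m2) = (d ^+ b1 * m1) * (d ^+ b2 * m2).
    by rewrite exprD; ring.
  by move=> d0; rewrite /L /K !e -!minor_scale_row; exact/valid/tn_scale_row.
have key (a b : nat) : (forall d, 0 <= d -> d ^+ a * L <= d ^+ b * K) -> a = b.
  move=> {}H; case: (ltngtP a b) => // [ab|ba].
    (* With [a < b], this [d] would give [L <= d * K < L / 2]. *)
    pose d := L / (2 * (K + L)).
    have KL : 0 < K + L by lra.
    have d0 : 0 < d by rewrite divr_gt0 // mulr_gt0.
    have dle1 : d <= 1 by rewrite ler_pdivrMr ?mulr_gt0 //; lra.
    have := H d (ltW d0); rewrite -(subnKC ab) addSnnS exprD -mulrA ler_pM2l ?exprn_gt0 //.
    set w := d ^+ _ => h1.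
    have h2 : w * K <= d * K.
      by rewrite ler_wpM2r // /w exprS ler_piMr ?(ltW d0) // exprn_ile1 // ltW.
    have h3 : d * (K + L) = L / 2 by rewrite /d; field; rewrite gt_eqF.
    have h4 : 0 < d * L by rewrite mulr_gt0.
    exfalso; clearbody w; clear -L0 K0 h1 h2 h3 h4; lra.
  (* With [b < a], this [d] would give [L + K = d * L <= K]. *)
  pose d := 1 + K / L.
  have dge1 : 1 <= d by rewrite lerDl divr_ge0 // ltW.
  have d0 : 0 < d by rewrite (lt_le_trans ltr01).
  have := H d (ltW d0); rewrite -(subnKC ba) addSnnS exprD -mulrA ler_pM2l ?exprn_gt0 //.
  set w := d ^+ _ => h1.
  have h2 : d * L <= w * L.
    by rewrite ler_wpM2r ?(ltW L0) // /w exprS ler_peMr ?(ltW d0) // exprn_ege1.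
  have h3 : d * L = L + K by rewrite /d; field; rewrite gt_eqF.
  exfalso; clearbody w; clear -L0 K0 h1 h2 h3; lra.
exact: key.
Qed.

(** * Coincidences of heights *)

Lemma height_moveL (n : nat) (u v : 'I_n) (X Y : {set 'I_n}) (s : nat) :
  u != v -> movable u v X ->
  height (move_set u v X) Y s = height X Y s - (u < s)%N%:Z + (v < s)%N%:Z.
Proof.
move=> nuv mv; rewrite /height.
under eq_bigr => x _ do rewrite color_moveL // -addrA.
rewrite big_split /= -addrA; congr (_ + _); rewrite big_split /=; congr (_ + _).
  rewrite sumrN; congr (- _); case: ltnP => us.
    rewrite (bigD1 u) //= eqxx big1 ?addr0 // => x /andP[_ /negPf->//].
  rewrite big1 // => x xs; case: eqP => // e; by rewrite e ltnNge us in xs.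
case: ltnP => us.
  rewrite (bigD1 v) //= eqxx big1 ?addr0 // => x /andP[_ /negPf->//].
by rewrite big1 // => x xs; case: eqP => // e; rewrite e ltnNge us in xs.
Qed.

Lemma height_sym (n : nat) (X Y : {set 'I_n}) (s : nat) : height X Y s = - height Y X s.
Proof. by rewrite /height -sumrN; apply: eq_bigr => x _; exact: color_sym. Qed.

Lemma height_move_off (n : nat) (u v : 'I_n) (X Y : {set 'I_n}) (s : nat) :
  u = v.+1 :> nat -> s != u :> nat ->
  height (move_set u v X) (move_set u v Y) s = height X Y s.
Proof.
move=> uv su; have nuv : u != v by rewrite -val_eqE /= uv; lia.
have half X' Y' : height (move_set u v X') Y' s = height X' Y' s.
  case: (boolP (movable u v X')) => [mv|/negPf mv]; last by rewrite /move_set mv.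
  by rewrite height_moveL // (_ : (u < s)%N = (v < s)%N) ?subrK //; lia.
by rewrite half height_sym half -height_sym.
Qed.

(** The number of moves depends only on the multiplicities of [u] and [v], unless both are 1; in
    that case it is 0 or 1, and the assumed move on the left makes it 1 on both sides. *)
Lemma movable_mult (n : nat) (P1 P2 I1 I2 : {set 'I_n}) (u v : 'I_n) :
  same_multiset P1 P2 I1 I2 ->
  (movable u v P1 + movable u v P2 <= movable u v I1 + movable u v I2)%N ->
  movable u v P1 || movable u v P2 ->
  (movable u v P1 + movable u v P2 = movable u v I1 + movable u v I2)%N.
Proof.
move=> H; have := H u; have := H v; rewrite /movable.
case: (u \in P1); case: (v \in P1); case: (u \in P2); case: (v \in P2) => //=;
by case: (u \in I1); case: (v \in I1); case: (u \in I2); case: (v \in I2).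
Qed.

Lemma tn_ineq_move_back (R : realType) (n : nat)
    (P1 P2 Q1 Q2 I1 I2 J1 J2 : {set 'I_n}) (u v : 'I_n) :
  #|P1| = #|Q1| -> #|P2| = #|Q2| -> u = v.+1 :> nat ->
  same_multiset P1 P2 I1 I2 -> movable u v P1 || movable u v P2 ->
  tn_ineq R P1 P2 Q1 Q2 I1 I2 J1 J2 ->
  tn_ineq R (move_set u v P1) (move_set u v P2) Q1 Q2
     (move_set u v I1) (move_set u v I2) J1 J2 /\
  (rank_sum (move_set u v P1) + rank_sum (move_set u v P2) <
     rank_sum P1 + rank_sum P2)%N.
Proof.
move=> c1 c2 uv PI mv valid.
have adj : adjacent u v by rewrite /adjacent uv eqxx orbT.
have [le mvalid] := tn_ineq_move c1 c2 adj valid; split.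
  by apply: mvalid; exact: movable_mult.
have := rank_sum_move_le P1 uv; have := rank_sum_move_le P2 uv.
by case/orP: mv => ->; lia.
Qed.

(** Downward moves inside the window between [s] and [t] do not affect the heights at its ends. When
    none is left, [P1] and [P2] are initial segments of the window of equal size. All multiplicities
    there are then 0 or 2, so [I1] and [I2] agree on the window as well. *)
Lemma tn_ineq_heights_rows (R : realType) (n : nat)
    (P1 P2 Q1 Q2 I1 I2 J1 J2 : {set 'I_n}) (s t : nat) :
  #|P1| = #|Q1| -> #|P2| = #|Q2| -> #|I1| = #|J1| -> #|I2| = #|J2| ->
  tn_ineq R P1 P2 Q1 Q2 I1 I2 J1 J2 ->
  height P1 P2 s = height P1 P2 t -> height I1 I2 s = height I1 I2 t.
Proof.
wlog st : s t / (s <= t)%N.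
  move=> H c1 c2 d1 d2 valid e; case/orP: (leq_total s t) => st.
    exact: H.
  by apply/esym/H.
have [k] := ubnP (rank_sum P1 + rank_sum P2).
elim: k P1 P2 I1 I2 => // k IH P1 P2 I1 I2 ltk c1 c2 d1 d2 valid e.
have PI := tn_ineq_mult c1 c2 d1 d2 valid.
have [/existsP[u /existsP[v /and4P[/eqP uv sv ut mv]]]|none] := boolP
  [exists u : 'I_n, exists v : 'I_n, [&& u == v.+1 :> nat, s <= v, u < t &
     movable u v P1 || movable u v P2]%N].
  have [valid' lt] := tn_ineq_move_back c1 c2 uv PI mv valid.
  have su : s != u by lia.
  have tu : t != u by lia.
  have := IH _ _ (move_set u v I1) (move_set u v I2) _ _ _ _ _ valid'.
  rewrite !card_move_set !height_move_off //; apply => //; lia.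
have nomov (u v : 'I_n) : u = v.+1 :> nat -> (s <= v)%N -> (u < t)%N ->
    ~~ movable u v P1 && ~~ movable u v P2.
  move=> uv sv ut; move/existsPn: none => /(_ u) /existsPn/(_ v).
  by rewrite uv eqxx sv -uv ut -negb_or.
have dc1 := down_closed (fun u v uv sv ut => proj1 (andP (nomov u v uv sv ut))).
have dc2 := down_closed (fun u v uv sv ut => proj2 (andP (nomov u v uv sv ut))).
pose S := [set x in [set: 'I_n] | (s <= x < t)%N].
have inS x : (x \in S) = (s <= x < t)%N by rewrite !inE.
have notT x : x \notin [set: 'I_n] -> color P1 P2 x = 0 by rewrite inE.
have := card_diff_height st notT (erefl S); rewrite e subrr => cS.
have eqS : S :&: P1 = S :&: P2.
  apply: initial_eq => [|x y|x y]; first by move: cS; lia.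
    rewrite !in_setI !inS => /andP[/andP[sy yt] _] /andP[/andP[sx xt] xP] yx.
    by rewrite sy yt /=; exact: dc1 xP.
  rewrite !in_setI !inS => /andP[/andP[sy yt] _] /andP[/andP[sx xt] xP] yx.
  by rewrite sy yt /=; exact: dc2 xP.
apply/esym/eqP; rewrite -subr_eq0 height_diff // big1 // => x xst.
have := PI x; have /setP/(_ x) := eqS; rewrite !in_setI inS xst /= /color => ->.
by case: (x \in P2); case: (x \in I1); case: (x \in I2).
Qed.

(** The move changes at most the height at the cut [u]. If [v] or [u] has multiplicity other than 1,
    its colour is 0 and the cut next to it has the same height; this depends on multiplicities only,
    so one cut serves both pairs. *)
Lemma height_move_shift (n : nat) (u v : 'I_n) (P1 P2 : {set 'I_n}) (a : nat) :
  u = v.+1 :> nat ->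
  ~~ [&& a == u, mult P1 P2 v == 1%N & mult P1 P2 u == 1%N] ->
  exists2 a', (a <= n)%N -> (a' <= n)%N & forall X1 X2, mult X1 X2 =1 mult P1 P2 ->
    height (move_set u v X1) (move_set u v X2) a' = height X1 X2 a.
Proof.
move=> uv; case: (eqVneq a u) => [->|au _]; last first.
  by exists a => // X1 X2 _; rewrite height_move_off.
rewrite /= negb_and => guard; have c0 X1 X2 x : mult X1 X2 =1 mult P1 P2 ->
    mult P1 P2 x != 1%N -> color X1 X2 x = 0.
  by move=> eX mx; apply/eqP; rewrite color_eq0 eX.
case/orP: guard => guard.
  exists v => [_|X1 X2 eX]; first exact: ltnW.
  by rewrite height_move_off // uv ?heightS ?(c0 _ _ _ eX guard) ?addr0 //; lia.
exists u.+1 => // X1 X2 eX.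
by rewrite height_move_off // ?heightS ?(c0 _ _ _ eX guard) ?addr0 //; lia.
Qed.

Lemma count_below_le (n : nat) (X : {set 'I_n}) (s t : nat) : (s <= t)%N ->
  (count_below X s <= count_below X t)%N.
Proof.
move=> st; apply/subset_leq_card/subsetP => x; rewrite !inE => /andP[-> xs] /=.
exact: leq_trans st.
Qed.

Lemma count_below_n (n : nat) (X : {set 'I_n}) : count_below X n = #|X|.
Proof. by apply: eq_card => x; rewrite !inE ltn_ord andbT. Qed.

Lemma interval_mem (n : nat) (X : {set 'I_n}) (s t : nat) (x : 'I_n) :
  (t <= n)%N ->
  (forall u v : 'I_n, u = v.+1 :> nat -> (s <= v)%N -> (u < t)%N -> ~~ movable u v X) ->
  (s <= x)%N -> (x < t)%N ->
  (x \in X) = (x < s + (count_below X t - count_below X s))%N.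
Proof.
move=> tn nomov sx xt; have closed := down_closed nomov.
pose S := [set y in X | (s <= y < t)%N].
have -> : (count_below X t - count_below X s)%N = #|S|.
  rewrite /count_below; have -> : S = [set y in X | (y < t)%N] :\: [set y in X | (y < s)%N].
    apply/setP=> y; rewrite !inE; case: (y \in X) => //=.
    by rewrite -leqNgt.
  rewrite cardsD (setIidPr _) //; apply/subsetP => y; rewrite !inE => /andP[-> ys] /=.
  by apply: leq_trans ys _; lia.
case: (boolP (x \in X)) => xX; apply/esym.
  have : ([set y : 'I_n | (s <= y < x.+1)%N] \subset S).
    apply/subsetP => y; rewrite !inE ltnS => /andP[sy yx].
    by rewrite (closed _ _ sy yx xt xX) sy (leq_ltn_trans yx).
  move=> /subset_leq_card; rewrite card_interval ?ltn_ord ?leqW //.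
  by rewrite leq_subLR.
have : (S \subset [set y : 'I_n | (s <= y < x)%N]).
  apply/subsetP => y; rewrite !inE => /and3P[yX sy yt]; rewrite sy /= ltnNge.
  by apply: contra xX => xy; exact: closed yX.
move=> /subset_leq_card; rewrite card_interval // ?(ltnW (ltn_ord x)) //.
by move=> le; apply/negbTE; rewrite -leqNgt -(subnKC sx) leq_add2l.
Qed.

(** [x1] and [x2] count the elements below the cut [a]; each set is packed downwards on both sides
    of it. A set with a gap below the cut and an element above it can move across, which is
    tolerated only if both positions beside the cut have multiplicity 1; the other set is then
    exactly the part below the cut. *)
Lemma terminal_form (n : nat) (P1 P2 : {set 'I_n}) (a : nat) : (a <= n)%N ->
  (forall u v : 'I_n, u = v.+1 :> nat -> movable u v P1 || movable u v P2 ->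
     [&& a == u, mult P1 P2 v == 1%N & mult P1 P2 u == 1%N]) ->
  exists x1 x2 : nat,
  [/\ (x1 <= a)%N && (x2 <= a)%N, (x1 <= #|P1|)%N && (x2 <= #|P2|)%N,
      [\/ (x1 = #|P1| \/ x1 = a) /\ (x2 = #|P2| \/ x2 = a),
        [/\ (x1 < #|P1|)%N, (x1 < a)%N, x2 = #|P2| & x2 = a] |
        [/\ (x2 < #|P2|)%N, (x2 < a)%N, x1 = #|P1| & x1 = a]],
      (forall z : 'I_n,
        (z \in P1) = (if z < a then z < x1 else z < a + (#|P1| - x1))%N /\
        (z \in P2) = (if z < a then z < x2 else z < a + (#|P2| - x2))%N)
    & height P1 P2 a = x1%:Z - x2%:Z].
Proof.
move=> an term.
have nomov s t : (s < a)%N && (t <= a)%N || (a <= s)%N && (t <= n)%N ->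
    forall u v : 'I_n, u = v.+1 :> nat -> (s <= v)%N -> (u < t)%N ->
    ~~ (movable u v P1 || movable u v P2).
  move=> st u v uv sv ut; apply/negP => /(term u v uv)/and3P[/eqP au _ _].
  by move: st; lia.
have memP (X : {set 'I_n}) : (forall u v, movable u v X -> movable u v P1 || movable u v P2) ->
    forall z : 'I_n, (z \in X) = (if z < a then z < count_below X a
      else z < a + (#|X| - count_below X a))%N.
  move=> sub z; case: ltnP => za.
    have c0 : count_below X 0 = 0%N by rewrite /count_below eq_card0 // => y; rewrite !inE andbF.
    rewrite (@interval_mem n X 0 a z an _ _ za) ?c0 ?subn0 // => u v uv sv ut.
    by apply: contra (nomov 0%N a _ u v uv sv ut); [exact: sub | lia].
  rewrite (@interval_mem n X a n z (leqnn n) _ za (ltn_ord z)) ?count_below_n // => u v uv sv ut.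
  by apply: contra (nomov a n _ u v uv sv ut); [exact: sub | lia].
have memP1 := memP P1 (fun u v m => introT orP (or_introl m)).
have memP2 := memP P2 (fun u v m => introT orP (or_intror m)).
have cle (X : {set 'I_n}) : (count_below X a <= a)%N && (count_below X a <= #|X|)%N.
  rewrite -(count_below_n X) count_below_le // andbT.
  rewrite -[X in (_ <= X)%N](card_below an); apply/subset_leq_card/subsetP => y.
  by rewrite !inE => /andP[].
have [/andP[x1a x1p] /andP[x2a x2p]] := (cle P1, cle P2).
exists (count_below P1 a), (count_below P2 a); split; rewrite ?x1a ?x2a ?x1p ?x2p //.
- have [cross|] := boolP ((count_below P1 a < #|P1|) && (count_below P1 a < a) ||
      (count_below P2 a < #|P2|) && (count_below P2 a < a))%N; last first.
    rewrite negb_or !negb_and -!leqNgt => /andP[u1 u2]; constructor 1; split.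
      by case/orP: u1 => u1; [left | right]; apply/eqP; rewrite eqn_leq ?x1p ?x1a.
    by case/orP: u2 => u2; [left | right]; apply/eqP; rewrite eqn_leq ?x2p ?x2a.
  have a0 : (0 < a)%N by move: cross; lia.
  have an' : (a < n)%N.
    rewrite ltn_neqAle an andbT; apply/eqP => e; move: cross.
    by rewrite e !count_below_n; lia.
  have ltv : (a.-1 < n)%N by lia.
  have := term (Ordinal an') (Ordinal ltv); rewrite /movable /mult !memP1 !memP2 /=.
  have -> : (a.-1 < a)%N by lia.
  move: (count_below P1 a) (count_below P2 a) x1a x1p x2a x2p cross => y1 y2.
  rewrite ltnn eqxx => x1a x1p x2a x2p cross /(_ (esym (prednK a0))); clear -a0 x1a x1p x2a x2p cross.
  move: #|P1| #|P2| x1p x2p cross => p1 p2 x1p x2p cross.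
  have -> : (a < a + (p1 - y1))%N = (y1 < p1)%N by lia.
  have -> : (a < a + (p2 - y2))%N = (y2 < p2)%N by lia.
  have -> : (a.-1 < y1)%N = (y1 == a)%N by lia.
  have -> : (a.-1 < y2)%N = (y2 == a)%N by lia.
  case: (ltnP y1 p1) => h1; case: (ltnP y2 p2) => h2;
  case: (eqVneq y1 a) => h3; case: (eqVneq y2 a) => h4 //= H; try (by have := H isT);
  try (by move: cross; lia).
  - by constructor 2; split; lia.
  - by constructor 3; split; lia.
- exact: height_count.
Qed.

(** Either both sets are initial segments, fixed by their sizes, or one is the whole part below the
    cut and the height says where the other one breaks. *)
Lemma terminal_unique (p1 p2 a b x1 x2 y1 y2 : nat) :
  (x1 <= a)%N && (x2 <= a)%N -> (x1 <= p1)%N && (x2 <= p2)%N ->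
  (y1 <= b)%N && (y2 <= b)%N -> (y1 <= p1)%N && (y2 <= p2)%N ->
  [\/ (x1 = p1 \/ x1 = a) /\ (x2 = p2 \/ x2 = a),
    [/\ (x1 < p1)%N, (x1 < a)%N, x2 = p2 & x2 = a] |
    [/\ (x2 < p2)%N, (x2 < a)%N, x1 = p1 & x1 = a]] ->
  [\/ (y1 = p1 \/ y1 = b) /\ (y2 = p2 \/ y2 = b),
    [/\ (y1 < p1)%N, (y1 < b)%N, y2 = p2 & y2 = b] |
    [/\ (y2 < p2)%N, (y2 < b)%N, y1 = p1 & y1 = b]] ->
  x1%:Z - x2%:Z = y1%:Z - y2%:Z ->
  forall z,
    (if z < a then z < x1 else z < a + (p1 - x1))%N =
    (if z < b then z < y1 else z < b + (p1 - y1))%N /\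
    (if z < a then z < x2 else z < a + (p2 - x2))%N =
    (if z < b then z < y2 else z < b + (p2 - y2))%N.
Proof.
move=> xa xp yb yp.
case=> [[hx1 hx2]|[hx1 hx2 hx3 hx4]|[hx1 hx2 hx3 hx4]];
case=> [[hy1 hy2]|[hy1 hy2 hy3 hy4]|[hy1 hy2 hy3 hy4]] e z;
case: (ltnP z a) => za; case: (ltnP z b) => zb; split; lia.
Qed.

(** Each move carries its watched cut along. Once rows and columns coincide, row and column heights
    become two heights of one and the same pair. *)
Lemma tn_ineq_heights_mixed (R : realType) (n : nat)
    (P1 P2 Q1 Q2 I1 I2 J1 J2 : {set 'I_n}) (a b : nat) :
  (a <= n)%N -> (b <= n)%N ->
  #|P1| = #|Q1| -> #|P2| = #|Q2| -> #|I1| = #|J1| -> #|I2| = #|J2| ->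
  tn_ineq R P1 P2 Q1 Q2 I1 I2 J1 J2 ->
  height P1 P2 a = height Q1 Q2 b -> height I1 I2 a = height J1 J2 b.
Proof.
have [k] := ubnP (rank_sum P1 + rank_sum P2 + (rank_sum Q1 + rank_sum Q2)).
elim: k P1 P2 Q1 Q2 I1 I2 J1 J2 a b => // k IH P1 P2 Q1 Q2 I1 I2 J1 J2 a b.
move=> ltk an bn c1 c2 d1 d2 valid e.
have PI := tn_ineq_mult c1 c2 d1 d2 valid.
have QJ := tn_ineq_mult (esym c1) (esym c2) (esym d1) (esym d2) (tn_ineq_tr valid).
pose red X1 X2 c := [exists u : 'I_n, exists v : 'I_n,
  [&& u == v.+1 :> nat, movable u v X1 || movable u v X2 &
   ~~ [&& c == u :> nat, mult X1 X2 v == 1 & mult X1 X2 u == 1]]%N].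
have [/existsP[u /existsP[v /and3P[/eqP uv mv guard]]]|nP] := boolP (red P1 P2 a).
  have [valid' lt] := tn_ineq_move_back c1 c2 uv PI mv valid.
  have [a' a'n shift] := height_move_shift uv guard.
  have := IH _ _ Q1 Q2 _ _ J1 J2 a' b _ (a'n an) bn _ _ _ _ valid'.
  rewrite !card_move_set !shift //; last by move=> x; rewrite /mult PI.
  by apply => //; lia.
have [/existsP[u /existsP[v /and3P[/eqP uv mv guard]]]|nQ] := boolP (red Q1 Q2 b).
  have [valid' lt] := tn_ineq_move_back (esym c1) (esym c2) uv QJ mv (tn_ineq_tr valid).
  have [b' b'n shift] := height_move_shift uv guard.
  have := IH P1 P2 _ _ I1 I2 _ _ a b' _ an (b'n bn) _ _ _ _ (tn_ineq_tr valid').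
  rewrite !card_move_set !shift //; last by move=> x; rewrite /mult QJ.
  by apply => //; lia.
have term X1 X2 c : ~~ red X1 X2 c ->
    forall u v : 'I_n, u = v.+1 :> nat -> movable u v X1 || movable u v X2 ->
     [&& c == u, mult X1 X2 v == 1%N & mult X1 X2 u == 1%N].
  move=> /existsPn nX u v uv mv; have /existsPn/(_ v) := nX u.
  by rewrite uv eqxx mv /= negbK -uv.
have [x1 [x2 [xa xp xc xm xh]]] := terminal_form an (term _ _ _ nP).
have [y1 [y2 [yb yq yc ym yh]]] := terminal_form bn (term _ _ _ nQ).
move: xh yh; rewrite e => hx hy.
have exy : x1%:Z - x2%:Z = y1%:Z - y2%:Z by rewrite -hx -hy.
rewrite -c1 -c2 in yq yc ym.
have uniq := terminal_unique xa xp yb yq xc yc exy.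
have eP1 : P1 = Q1.
  by apply/setP=> z; have [-> _] := xm z; have [-> _] := ym z; case: (uniq z).
have eP2 : P2 = Q2.
  by apply/setP=> z; have [_ ->] := xm z; have [_ ->] := ym z; case: (uniq z).
(* At the identity the left side is 1, so neither minor on the right vanishes. *)
have := valid _ (@tn1 R n); rewrite !minor1 eP1 eP2 !eqxx mulr1 -natrM mulnb ler1n.
rewrite lt0b => /andP[/eqP eI1 /eqP eI2].
rewrite -eI1 -eI2; apply: (tn_ineq_heights_rows c1 c2 d1 d2 valid).
by rewrite e eP1 eP2.
Qed.

(** * Heights on the doubled index set *)

Lemma height_full (n : nat) (X1 X2 : {set 'I_n}) :
  height X1 X2 n = #|X1|%:Z - #|X2|%:Z.
Proof. by rewrite height_count !count_below_n. Qed.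

Lemma height_double_low (n : nat) (P1 P2 Q1 Q2 : {set 'I_n}) (t : nat) :
  (t <= n)%N ->
  height (double_set P1 Q2) (double_set P2 Q1) t = height P1 P2 t.
Proof.
move=> tn; rewrite /height big_split_ord /= [X in _ + X]big1 ?addr0; last first.
  by move=> x; rewrite ltnNge (leq_trans tn) // leq_addr.
by apply: eq_bigr => x _; rewrite /color !in_double_setL.
Qed.

Lemma height_double_high (n : nat) (P1 P2 Q1 Q2 : {set 'I_n}) (b : nat) :
  (b <= n)%N ->
  height (double_set P1 Q2) (double_set P2 Q1) (n + n - b) =
  height P1 P2 n - height Q1 Q2 n + height Q1 Q2 b.
Proof.
move=> bn; rewrite -addrA -[X in _ + X]opprK opprD opprK.
have nb : (n <= n + n - b)%N by lia.
rewrite -(height_double_low P1 P2 Q1 Q2 (leqnn n)).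
apply/eqP; rewrite addrC -subr_eq height_diff // height_diff //.
rewrite (reindex_inj rev_ord_inj) /= big_split_ord /= [X in _ + X]big1 ?addr0.
  rewrite -sumrN; apply/eqP; apply: eq_big => [y|y _].
    by have := ltn_ord y; lia.
  by rewrite /color !in_double_setR opprB.
move=> y; have := ltn_ord y; lia.
Qed.

(** The relation [refines] of the doubled pairs, kept separate for rows and columns because each
    move acts on only one of them. *)
Definition pair_refines (n : nat) (P1 P2 Q1 Q2 I1 I2 J1 J2 : {set 'I_n}) : Prop :=
  [/\ same_multiset P1 P2 I1 I2, same_multiset Q1 Q2 J1 J2 &
  forall s t, (s <= n)%N -> (t <= n)%N ->
  [/\ height P1 P2 s = height P1 P2 t -> height I1 I2 s = height I1 I2 t,
      height Q1 Q2 s = height Q1 Q2 t -> height J1 J2 s = height J1 J2 t &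
      height P1 P2 s = height Q1 Q2 t -> height I1 I2 s = height J1 J2 t]].

(** Equal cardinalities make row and column heights agree at [n], so the second half of the line
    carries the column heights without an offset. *)
Lemma refines_doubleP (n : nat) (P1 P2 Q1 Q2 I1 I2 J1 J2 : {set 'I_n}) :
  #|P1| = #|Q1| -> #|P2| = #|Q2| -> #|I1| = #|J1| -> #|I2| = #|J2| ->
  refines (double_set P1 Q2) (double_set P2 Q1)
    (double_set I1 J2) (double_set I2 J1) <->
  pair_refines P1 P2 Q1 Q2 I1 I2 J1 J2.
Proof.
move=> c1 c2 d1 d2.
have lowP t : (t <= n)%N -> _ := @height_double_low n P1 P2 Q1 Q2 t.
have lowI t : (t <= n)%N -> _ := @height_double_low n I1 I2 J1 J2 t.
have highP b : (b <= n)%N -> height (double_set P1 Q2) (double_set P2 Q1) (n + n - b) = height Q1 Q2 b.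
  by move=> bn; rewrite height_double_high // !height_full c1 c2 subrr add0r.
have highI b : (b <= n)%N -> height (double_set I1 J2) (double_set I2 J1) (n + n - b) = height J1 J2 b.
  by move=> bn; rewrite height_double_high // !height_full d1 d2 subrr add0r.
split=> [[RK ref]|[PI QJ ref]].
  split=> [x|y|s t sn tn].
  - by have := RK (lshift n x); rewrite !in_double_setL.
  - by have := RK (rev_ord (lshift n y)); rewrite !in_double_setR addnC [RHS]addnC.
  - by rewrite -!(lowP, lowI) // -!(highP, highI) //; split; exact: ref.
split.
  apply: half_ord_ind => x; first by rewrite !in_double_setL.
  by rewrite !in_double_setR addnC [RHS]addnC.
have cover s : (exists2 a, (a <= n)%N &
    height (double_set P1 Q2) (double_set P2 Q1) s = height P1 P2 a /\
    height (double_set I1 J2) (double_set I2 J1) s = height I1 I2 a) \/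
  (exists2 b, (b <= n)%N &
    height (double_set P1 Q2) (double_set P2 Q1) s = height Q1 Q2 b /\
    height (double_set I1 J2) (double_set I2 J1) s = height J1 J2 b).
  case: (leqP s n) => sn; first by left; exists s => //; rewrite lowP ?lowI.
  right; exists (n + n - s)%N; first lia.
  rewrite -highP -?highI; try lia.
  case: (leqP s (n + n)) => s2; first by rewrite subKn.
  rewrite (_ : n + n - (n + n - s) = n + n)%N; last lia.
  by rewrite ![height _ _ s]height_max // ltnW.
move=> s t; case: (cover s) => -[a an [-> ->]]; case: (cover t) => -[b bn [-> ->]];
have [rr cc rc] := ref a b an bn => //.
have [_ _ cr] := ref b a bn an.
by move=> e; rewrite cr.
Qed.

Theorem tn_ineqP (R : realType) (n : nat) (P1 P2 Q1 Q2 I1 I2 J1 J2 : {set 'I_n}) :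
  #|P1| = #|Q1| -> #|P2| = #|Q2| -> #|I1| = #|J1| -> #|I2| = #|J2| ->
  tn_ineq R P1 P2 Q1 Q2 I1 I2 J1 J2 <-> pair_refines P1 P2 Q1 Q2 I1 I2 J1 J2.
Proof.
move=> c1 c2 d1 d2; split; last first.
  by rewrite -refines_doubleP //; exact: refines_tn_ineq.
move=> valid; have valid' := tn_ineq_tr valid; split.
- exact: tn_ineq_mult valid.
- exact: tn_ineq_mult valid'.
- move=> s t sn tn; split.
  + exact: (tn_ineq_heights_rows c1 c2 d1 d2 valid).
  + exact: (tn_ineq_heights_rows (esym c1) (esym c2) (esym d1) (esym d2) valid').
  + exact: (tn_ineq_heights_mixed sn tn c1 c2 d1 d2 valid).
Qed.

(** The case of equal row and column sets: the three conditions on heights become one. *)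
Lemma principal_tn_ineqP (R : realType) (m : nat) (R1 R2 K1 K2 : {set 'I_m}) :
  principal_tn_ineq R R1 R2 K1 K2 <-> refines R1 R2 K1 K2.
Proof.
rewrite -[principal_tn_ineq _ _ _ _ _]/(tn_ineq R R1 R2 R1 R2 K1 K2 K1 K2).
rewrite tn_ineqP //; split=> [[RK _ ref]|[RK ref]]; last first.
  by split=> // s t _ _; split; exact: ref.
split=> // s t.
have trunc (X Y : {set 'I_m}) k : height X Y k = height X Y (minn k m).
  by case: (leqP k m) => // /ltnW; exact: height_max.
rewrite ![height _ _ s]trunc ![height _ _ t]trunc.
by case: (ref (minn s m) (minn t m) (geq_minr _ _) (geq_minr _ _)).
Qed.

(** * Index operations *)

(** A product replaced by 0 never returns, so one zero excludes the target expression. *)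
Definition has_zero (n : nat) (e : det_expr n) : bool :=
  has (fun s => if s is SymZero then true else false) e.

Lemma has_zero_index_op (n : nat) (hit : pred (formal_minor n)) upd e :
  has_zero e -> has_zero (index_op hit upd e).
Proof.
rewrite /has_zero /index_op has_map; apply: sub_has => s /=.
by case: s.
Qed.

Lemma has_zero_row_ops (n : nat) s (e : det_expr n) :
  has_zero e -> has_zero (row_ops s e).
Proof.
rewrite /row_ops; elim: s e => //= uv s IH e ze.
by apply: IH; exact: has_zero_index_op.
Qed.

Lemma row_op_formal (n : nat) (u v : 'I_n) (X1 Y1 X2 Y2 Z1 W1 Z2 W2 : {set 'I_n}) :
  let e := formal_ineq X1 Y1 X2 Y2 Z1 W1 Z2 W2 in
  if (movable u v X1 + movable u v X2 == movable u v Z1 + movable u v Z2)%N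
  then row_op u v e = formal_ineq (move_set u v X1) Y1 (move_set u v X2) Y2
    (move_set u v Z1) W1 (move_set u v Z2) W2
  else has_zero (row_op u v e).
Proof.
rewrite /row_op /index_op /formal_ineq /has_zero /= !big_cons big_nil /= !addn0.
case: (movable u v X1); case: (movable u v X2); case: (movable u v Z1);
by case: (movable u v Z2).
Qed.

Lemma near_pairP (n : nat) (u v : 'I_n) :
  near_pair (u, v) = (u == v) || adjacent u v.
Proof.
rewrite /near_pair /adjacent /= -val_eqE /= (eq_sym (u : nat) v.+1).
by case: (_ == _); case: (_ == _); case: (_ == _).
Qed.

Lemma movable_same (n : nat) (u : 'I_n) (X : {set 'I_n}) : movable u u X = false.
Proof. by rewrite /movable andbN. Qed.

Lemma row_ops_sound (R : realType) (n : nat) s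
    (X1 Y1 X2 Y2 Z1 W1 Z2 W2 : {set 'I_n}) :
  all (@near_pair n) s -> #|X1| = #|Y1| -> #|X2| = #|Y2| ->
  tn_ineq R X1 X2 Y1 Y2 Z1 Z2 W1 W2 ->
  has_zero (row_ops s (formal_ineq X1 Y1 X2 Y2 Z1 W1 Z2 W2)) \/
  exists X1' X2' Z1' Z2',
    [/\ row_ops s (formal_ineq X1 Y1 X2 Y2 Z1 W1 Z2 W2) =
          formal_ineq X1' Y1 X2' Y2 Z1' W1 Z2' W2,
        #|X1'| = #|Y1|, #|X2'| = #|Y2| &
        tn_ineq R X1' X2' Y1 Y2 Z1' Z2' W1 W2].
Proof.
elim: s X1 X2 Z1 Z2 => [|[u v] s IH] X1 X2 Z1 Z2 /=.
  by move=> _ c1 c2 valid; right; exists X1, X2, Z1, Z2.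
rewrite near_pairP => /andP[uv ns] c1 c2 valid; rewrite /row_ops /=.
have := row_op_formal u v X1 Y1 X2 Y2 Z1 W1 Z2 W2 => /=.
case: eqP => [e ->|_ z]; last by left; exact: has_zero_row_ops.
apply: IH => //; rewrite ?card_move_set //.
case/orP: uv => [/eqP<-|adj].
  by rewrite /move_set !movable_same.
by have [_] := tn_ineq_move c1 c2 adj valid; apply.
Qed.

(** Formal transposition, by which column operations inherit the results on row operations. *)
Definition swap_expr (n : nat) (e : det_expr n) : det_expr n :=
  [seq (if s is SymProd p then SymProd [seq (d.2, d.1) | d <- p] else s) | s <- e].

Lemma swap_formal (n : nat) (X1 Y1 X2 Y2 Z1 W1 Z2 W2 : {set 'I_n}) :
  swap_expr (formal_ineq X1 Y1 X2 Y2 Z1 W1 Z2 W2) =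
  formal_ineq Y1 X1 Y2 X2 W1 Z1 W2 Z2.
Proof. by []. Qed.

Lemma has_zero_swap (n : nat) (e : det_expr n) : has_zero (swap_expr e) = has_zero e.
Proof. by rewrite /has_zero has_map; apply: eq_has => -[]. Qed.

Lemma col_op_swap (n : nat) (u v : 'I_n) (e : det_expr n) :
  col_op u v (swap_expr e) = swap_expr (row_op u v e).
Proof.
rewrite /col_op /row_op /index_op /swap_expr -!map_comp big_map.
rewrite (eq_bigr (fun s => if s is SymProd p
   then count (fun d => movable u v d.1) p else 0%N)); last first.
  by move=> s _; case: s => //= p; rewrite count_map.
apply: eq_map => -[] //= p; rewrite count_map.
by case: ifP => //= _; rewrite -!map_comp.
Qed.

Lemma col_ops_swap (n : nat) s (e : det_expr n) :
  col_ops s (swap_expr e) = swap_expr (row_ops s e).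
Proof.
rewrite /col_ops /row_ops; elim: s e => //= uv s IH e.
by rewrite col_op_swap IH.
Qed.

Lemma formal_ineq_inj (n : nat) (X1 Y1 X2 Y2 Z1 W1 Z2 W2 : {set 'I_n})
    (X1' Y1' X2' Y2' Z1' W1' Z2' W2' : {set 'I_n}) :
  formal_ineq X1 Y1 X2 Y2 Z1 W1 Z2 W2 =
  formal_ineq X1' Y1' X2' Y2' Z1' W1' Z2' W2' ->
  [/\ (X1 = X1' /\ Y1 = Y1'), (X2 = X2' /\ Y2 = Y2'),
      (Z1 = Z1' /\ W1 = W1') & (Z2 = Z2' /\ W2 = W2')].
Proof. by case. Qed.

Lemma index_ops_tn_ineq (R : realType) (n : nat)
    (P1 P2 Q1 Q2 I1 I2 J1 J2 : {set 'I_n}) :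
  obtained_by_index_ops R P1 P2 Q1 Q2 I1 I2 J1 J2 ->
  tn_ineq R P1 P2 Q1 Q2 I1 I2 J1 J2.
Proof.
case=> P [Q [I [J [[[cP cQ] _] valid [rows [cols [_ _ nr nc]]]]]]].
rewrite -swap_formal col_ops_swap.
have c1 : #|Q| = #|P| by rewrite cP cQ.
have c2 : #|~: Q| = #|~: P|.
  by apply: (@addnI #|Q|); rewrite cardsC {1}c1 cardsC.
have validT : tn_ineq R Q (~: Q) P (~: P) J (~: J) I (~: I) by exact: tn_ineq_tr.
have [z|[X1 [X2 [Z1 [Z2 [-> d1 d2 validX]]]]]] := row_ops_sound nc c1 c2 validT.
  move=> e; have : has_zero (formal_ineq P1 Q1 P2 Q2 I1 J1 I2 J2).
    by rewrite -e has_zero_row_ops // has_zero_swap.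
  by [].
rewrite swap_formal.
have [z|[X1' [X2' [Z1' [Z2' [-> _ _ valid']]]]]] :=
    row_ops_sound nr (esym d1) (esym d2) (tn_ineq_tr validX).
  by move=> e; rewrite e in z.
move=> /formal_ineq_inj[[<- <-] [<- <-] [<- <-] [<- <-]].
exact: valid'.
Qed.

(** * Running the moves backwards *)

(** The points met by the two heights along rows and columns; the condition says that they form the
    graph of a function. A move of one element alters at most one of the listed points. *)
Definition path_point (n : nat) (P1 P2 Q1 Q2 I1 I2 J1 J2 : {set 'I_n})
    (x y : int) : Prop :=
  (exists2 s, (s <= n)%N & height P1 P2 s = x /\ height I1 I2 s = y) \/
  (exists2 t, (t <= n)%N & height Q1 Q2 t = x /\ height J1 J2 t = y).

Lemma pair_refines_points (n : nat) (P1 P2 Q1 Q2 I1 I2 J1 J2 : {set 'I_n}) :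
  pair_refines P1 P2 Q1 Q2 I1 I2 J1 J2 <->
  [/\ same_multiset P1 P2 I1 I2, same_multiset Q1 Q2 J1 J2 &
   forall x y y', path_point P1 P2 Q1 Q2 I1 I2 J1 J2 x y ->
     path_point P1 P2 Q1 Q2 I1 I2 J1 J2 x y' -> y = y'].
Proof.
split=> -[PI QJ ref]; split=> //.
  move=> x y y' [] [s sn [<- <-]] [] [t tn [e <-]]; have [rr cc rc] := ref _ _ sn tn.
  - exact/rr/esym.
  - exact/rc/esym.
  - by have [_ _ ->] := ref _ _ tn sn.
  - exact/cc/esym.
move=> s t sn tn; split=> e.
- by apply: (ref (height P1 P2 s)); left; [exists s | exists t].
- by apply: (ref (height Q1 Q2 s)); right; [exists s | exists t].
- by apply: (ref (height P1 P2 s)); [left; exists s | right; exists t].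
Qed.

Lemma path_point_adjacent (n : nat) (P1 P2 Q1 Q2 I1 I2 J1 J2 : {set 'I_n}) s x y :
  #|P1| = #|Q1| -> #|P2| = #|Q2| -> #|I1| = #|J1| -> #|I2| = #|J2| ->
  pair_refines P1 P2 Q1 Q2 I1 I2 J1 J2 -> (s <= n)%N ->
  path_point P1 P2 Q1 Q2 I1 I2 J1 J2 x y ->
  `|x - height P1 P2 s| = 1 -> `|y - height I1 I2 s| = 1.
Proof.
move=> c1 c2 d1 d2 /(refines_doubleP c1 c2 d1 d2) ref sn [] [t tn [<- <-]].
  have := refines_adjacent_heights (s := s) (t := t) ref.
  by rewrite !height_double_low.
have := refines_adjacent_heights (s := s) (t := n + n - t) ref.
rewrite !height_double_high // !height_double_low // !height_full.
by rewrite c1 c2 d1 d2 !subrr !add0r.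
Qed.

Lemma height_move_other (n : nat) (u v : 'I_n) (X Y : {set 'I_n}) (s : nat) :
  adjacent u v -> s != maxn u v -> movable u v X ->
  height (move_set u v X) Y s = height X Y s.
Proof.
move=> adj sg mv; rewrite height_moveL ?adjacent_neq //.
have -> : (u < s)%N = (v < s)%N by move: adj; rewrite /adjacent; lia.
by rewrite subrK.
Qed.

Lemma height_move_otherR (n : nat) (u v : 'I_n) (X Y : {set 'I_n}) (s : nat) :
  adjacent u v -> s != maxn u v -> movable u v Y ->
  height X (move_set u v Y) s = height X Y s.
Proof.
by move=> adj sg mv; rewrite height_sym height_move_other // -height_sym.
Qed.

Lemma move_setK (n : nat) (u v : 'I_n) (X : {set 'I_n}) : movable u v X ->
  movable v u (move_set u v X) /\ move_set v u (move_set u v X) = X.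
Proof.
move=> mv; have [uX vX] := andP mv.
have nuv : u != v by apply: contraNneq vX => <-.
have mv' : movable v u (move_set u v X).
  by rewrite /movable /move_set mv !inE !eqxx /= (negPf nuv).
split=> //; apply/setP=> z; rewrite in_move_set // 1?eq_sym // in_move_set //.
by rewrite tpermC tpermK.
Qed.

Lemma notmovable_move_set (n : nat) (u v : 'I_n) (X : {set 'I_n}) :
  movable u v X = false -> move_set u v X = X.
Proof. by rewrite /move_set => ->. Qed.

(** The columns are arbitrary in the clause on operations, so that rows and columns can be expanded
    one after the other. *)
Definition expandable (n : nat) (Q1 Q2 J1 J2 P1 P2 I1 I2 : {set 'I_n}) : Prop :=
  exists (P I : {set 'I_n}) (rows : seq ('I_n * 'I_n)),
  [/\ #|P| = #|P1| /\ #|I| = #|I1|, all (@near_pair n) rows,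
    forall Y1 Y2 W1 W2, row_ops rows (formal_ineq P Y1 (~: P) Y2 I W1 (~: I) W2) =
      formal_ineq P1 Y1 P2 Y2 I1 W1 I2 W2
    & pair_refines P (~: P) Q1 Q2 I (~: I) J1 J2].

Lemma expandable_step (n : nat) (u v : 'I_n)
    (Q1 Q2 J1 J2 P1 P2 I1 I2 P1' P2' I1' I2' : {set 'I_n}) :
  adjacent u v ->
  (movable u v P1' + movable u v P2' = movable u v I1' + movable u v I2')%N ->
  P1 = move_set u v P1' -> P2 = move_set u v P2' ->
  I1 = move_set u v I1' -> I2 = move_set u v I2' ->
  expandable Q1 Q2 J1 J2 P1' P2' I1' I2' ->
  expandable Q1 Q2 J1 J2 P1 P2 I1 I2.
Proof.
move=> adj e -> -> -> -> [P [I [rows [[cP cI] nr ops ref]]]].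
exists P, I, (rcons rows (u, v)); split=> //.
- by rewrite !card_move_set.
- by rewrite all_rcons near_pairP adj orbT.
- move=> Y1 Y2 W1 W2; rewrite /row_ops foldl_rcons /= -/(row_ops _ _) ops.
  by have := row_op_formal u v P1' Y1 P2' Y2 I1' W1 I2' W2 => /=; rewrite e eqxx.
Qed.

(** After the move [v] is empty, so the height at the altered cut equals the height across [v], and
    no new point arises. *)
Lemma pair_refines_swap (n : nat) (u v : 'I_n)
    (P1 P2 Q1 Q2 I1 I2 J1 J2 : {set 'I_n}) :
  adjacent u v -> mult P1 P2 u = 0%N -> mult P1 P2 v = 1%N ->
  pair_refines P1 P2 Q1 Q2 I1 I2 J1 J2 ->
  pair_refines (move_set v u P1) (move_set v u P2) Q1 Q2
    (move_set v u I1) (move_set v u I2) J1 J2.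
Proof.
move=> adj mu mv /pair_refines_points[PI QJ ref]; apply/pair_refines_points.
have nvu : v != u by rewrite eq_sym adjacent_neq.
have mI x : mult I1 I2 x = mult P1 P2 x by rewrite /mult PI.
have sing X1 X2 : mult X1 X2 u = 0%N -> mult X1 X2 v = 1%N ->
  (movable v u X1 /\ movable v u X2 = false) \/
  (movable v u X1 = false /\ movable v u X2).
  rewrite /mult /movable; case: (u \in X1); case: (u \in X2) => // _.
  by case: (v \in X1); case: (v \in X2) => // _; [left | right].
have moved X1 X2 : mult X1 X2 u = 0%N -> mult X1 X2 v = 1%N ->
    mult (move_set v u X1) (move_set v u X2) =1 moved_mult v u (mult X1 X2) /\
    forall s, s != maxn v u ->
      height (move_set v u X1) (move_set v u X2) s = height X1 X2 s.
  move=> xu xv; case: (sing X1 X2 xu xv) => -[m1 m2].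
    rewrite (notmovable_move_set m2); split=> [z|s sg].
      by rewrite mult_moveL.
    by rewrite height_move_other // adjacentC.
  rewrite (notmovable_move_set m1); split=> [z|s sg].
    by rewrite mult_moveR.
  by rewrite height_move_otherR // adjacentC.
have [multP offP] := moved P1 P2 mu mv.
have [multI offI] : _ := moved I1 I2 (etrans (mI u) mu) (etrans (mI v) mv).
have PI' : same_multiset (move_set v u P1) (move_set v u P2) (move_set v u I1) (move_set v u I2).
  by move=> z; have := multP z; have := multI z; rewrite /mult /moved_mult => -> ->; rewrite !PI.
split=> // x y y'.
suff sub z w : path_point (move_set v u P1) (move_set v u P2) Q1 Q2
    (move_set v u I1) (move_set v u I2) J1 J2 z w -> path_point P1 P2 Q1 Q2 I1 I2 J1 J2 z w.
  by move=> /sub h /sub; exact: ref.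
case=> [[s sn [<- <-]]|?]; last by right.
have [sg|sg] := eqVneq s (maxn v u); last by left; exists s; rewrite ?offP ?offI.
have cP0 : color (move_set v u P1) (move_set v u P2) v = 0.
  by apply/eqP; rewrite color_eq0 multP /moved_mult eqxx mv.
have cI0 : color (move_set v u I1) (move_set v u I2) v = 0.
  by apply/eqP; rewrite color_eq0 multI /moved_mult eqxx mI mv.
case/orP: (adj) => /eqP uv.
  have ne : v.+1 != maxn v u by lia.
  have gv : s = v by lia.
  left; exists v.+1; first exact: ltn_ord.
  by rewrite -(offP _ ne) -(offI _ ne) !heightS cP0 cI0 !addr0 gv.
have ne : (v : nat) != maxn v u by lia.
have gv : s = v.+1 by lia.
left; exists v; first exact: ltnW.
by rewrite -(offP _ ne) -(offI _ ne) gv !heightS cP0 cI0 !addr0.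
Qed.

(* The new height of (P1, P2) may already occur elsewhere; it then forces which of
   I1, I2 is moved. *)
Lemma pair_refines_split (n : nat) (u v : 'I_n)
    (P1 P2 Q1 Q2 I1 I2 J1 J2 : {set 'I_n}) :
  #|P1| = #|Q1| -> #|P2| = #|Q2| -> #|I1| = #|J1| -> #|I2| = #|J2| ->
  adjacent u v -> mult P1 P2 u = 0%N -> mult P1 P2 v = 2%N ->
  pair_refines P1 P2 Q1 Q2 I1 I2 J1 J2 ->
  pair_refines (move_set v u P1) P2 Q1 Q2 (move_set v u I1) I2 J1 J2 \/
  pair_refines (move_set v u P1) P2 Q1 Q2 I1 (move_set v u I2) J1 J2.
Proof.
move=> c1 c2 d1 d2 adj mu mv pref; have := pref => /pair_refines_points[PI QJ ref].
have nvu : v != u by rewrite eq_sym adjacent_neq.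
have mI x : mult I1 I2 x = mult P1 P2 x by rewrite /mult PI.
have both X1 X2 : mult X1 X2 u = 0%N -> mult X1 X2 v = 2%N ->
    movable v u X1 /\ movable v u X2.
  rewrite /mult /movable; case: (u \in X1); case: (u \in X2) => // _.
  by case: (v \in X1); case: (v \in X2).
have [mP1 mP2] := both P1 P2 mu mv.
have [mI1 mI2] : _ := both I1 I2 (etrans (mI u) mu) (etrans (mI v) mv).
have adj' : adjacent v u by rewrite adjacentC.
pose g := maxn v u; pose lo := minn v u.
have lon : (lo <= n)%N by rewrite /lo; have := ltn_ord v; lia.
(* [g] is the cut between [u] and [v]; its height before the move is that at [lo], since [u] and [v]
   have colour 0. Moving the first or the second set changes it by [eps] or [- eps]. *)
have [eps [eps1 gapL gapR]] : exists eps : int, [/\ `|eps| = 1,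
    forall X1 X2, mult X1 X2 u = 0%N -> mult X1 X2 v = 2%N ->
      height (move_set v u X1) X2 g = height X1 X2 lo + eps &
    forall X1 X2, mult X1 X2 u = 0%N -> mult X1 X2 v = 2%N ->
      height X1 (move_set v u X2) g = height X1 X2 lo - eps].
  have flat X1 X2 : mult X1 X2 u = 0%N -> mult X1 X2 v = 2%N ->
      height X1 X2 g = height X1 X2 lo.
    move=> xu xv; have cu : color X1 X2 u = 0 by apply/eqP; rewrite color_eq0 xu.
    have cv : color X1 X2 v = 0 by apply/eqP; rewrite color_eq0 xv.
    case/orP: (adj) => /eqP uv.
      have -> : lo = u by rewrite /lo -uv; lia.
      have -> : g = u.+1 by rewrite /g -uv; lia.
      by rewrite heightS cu addr0.
    have -> : lo = v by rewrite /lo -uv; lia.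
    have -> : g = v.+1 by rewrite /g -uv; lia.
    by rewrite heightS cv addr0.
  exists ((u < g)%N%:Z - (v < g)%N%:Z); split.
  - by move: adj; rewrite /adjacent /g => /orP[]/eqP uv;
      do 2!case: ltnP; rewrite -?uv //=; lia.
  - move=> X1 X2 xu xv; have [m1 m2] := both X1 X2 xu xv.
    by rewrite height_moveL // flat //; ring.
  - move=> X1 X2 xu xv; have [m1 m2] := both X1 X2 xu xv.
    by rewrite height_sym height_moveL // height_sym flat //; ring.
pose x0 := height P1 P2 lo + eps.
have main I1' I2' y0 : same_multiset (move_set v u P1) P2 I1' I2' ->
    (forall s, s != g -> height I1' I2' s = height I1 I2 s) ->
    height I1' I2' g = y0 ->
    (forall y, path_point P1 P2 Q1 Q2 I1 I2 J1 J2 x0 y -> y = y0) ->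
    pair_refines (move_set v u P1) P2 Q1 Q2 I1' I2' J1 J2.
  move=> PI' offI gapI uniq; apply/pair_refines_points; split=> // x y y'.
  have sub z w : path_point (move_set v u P1) P2 Q1 Q2 I1' I2' J1 J2 z w ->
      path_point P1 P2 Q1 Q2 I1 I2 J1 J2 z w \/ z = x0 /\ w = y0.
    case=> [[s sn [<- <-]]|?]; last by left; right.
    have [->|sg] := eqVneq s g; first by right; rewrite gapL.
    by left; left; exists s => //; rewrite offI // height_move_other.
  case/sub=> [h|[-> ->]]; case/sub=> [h'|[e ->]].
  - exact: ref h h'.
  - by apply: uniq; rewrite -e.
  - exact/esym/uniq.
  - by [].
have multP z := mult_moveL P2 z nvu mP1.
have mIu := etrans (mI u) mu; have mIv := etrans (mI v) mv.
have PIL : same_multiset (move_set v u P1) P2 (move_set v u I1) I2.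
  move=> z; have := multP z; have := mult_moveL I2 z nvu mI1.
  by rewrite mI /mult => -> ->.
have PIR : same_multiset (move_set v u P1) P2 I1 (move_set v u I2).
  move=> z; have := multP z; have := mult_moveR I1 z nvu mI2.
  by rewrite mI /mult => -> ->.
have offL s : s != g -> height (move_set v u I1) I2 s = height I1 I2 s.
  by move=> sg; rewrite height_move_other.
have offR s : s != g -> height I1 (move_set v u I2) s = height I1 I2 s.
  by move=> sg; rewrite height_move_otherR.
(* If the height [x0] occurs nowhere yet, its image is free. Otherwise the image [y] is prescribed,
   and it differs by 1 from the image of the height at [lo], so one of the two moves realizes it. *)
have [[y Zy]|none] := boolp.EM (exists y, path_point P1 P2 Q1 Q2 I1 I2 J1 J2 x0 y); last first.
  left; apply: main PIL offL (gapL _ _ mIu mIv) _ => y Zy.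
  by case: none; exists y.
have uniq y' : path_point P1 P2 Q1 Q2 I1 I2 J1 J2 x0 y' -> y' = y by move=> h; exact: ref h Zy.
have : `|y - height I1 I2 lo| = 1.
  by apply: (path_point_adjacent c1 c2 d1 d2 pref lon Zy); rewrite /x0 addrC addKr.
have [ey|ney] := eqVneq y (height I1 I2 lo + eps).
  by move=> _; left; apply: main PIL offL (gapL _ _ mIu mIv) _; rewrite -ey.
move=> y1; right; apply: main PIR offR (gapR _ _ mIu mIv) _ => y' /uniq ->.
by move: ney y1 eps1; lia.
Qed.

Definition empty_count (n : nat) (P1 P2 : {set 'I_n}) : nat :=
  #|[set x | mult P1 P2 x == 0%N]|.

Lemma sum_mult (n : nat) (P1 P2 : {set 'I_n}) :
  (\sum_x mult P1 P2 x = #|P1| + #|P2|)%N.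
Proof.
rewrite /mult big_split /=; congr (_ + _)%N; rewrite -sum1_card [RHS]big_mkcond;
by apply: eq_bigr => x _; case: (x \in _).
Qed.

Lemma mult_cases (n : nat) (P1 P2 : {set 'I_n}) x :
  [\/ mult P1 P2 x = 0%N, mult P1 P2 x = 1%N | mult P1 P2 x = 2%N].
Proof.
rewrite /mult; case: (x \in P1); case: (x \in P2);
by [constructor 1 | constructor 2 | constructor 3].
Qed.

Lemma no_empty_complement (n : nat) (P1 P2 : {set 'I_n}) :
  (#|P1| + #|P2|)%N = n -> (forall x, mult P1 P2 x != 0%N) -> P2 = ~: P1.
Proof.
move=> cP m0; have m1 x : mult P1 P2 x = 1%N.
  have : (\sum_x (mult P1 P2 x - 1) = 0)%N.
    have : (\sum_x (mult P1 P2 x - 1) + \sum_(x < n) 1 = \sum_x mult P1 P2 x)%N.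
      by rewrite -big_split; apply: eq_bigr => y _; rewrite /= subnK // lt0n.
    by rewrite sum_mult cP sum1_card card_ord -[RHS]add0n => /addIn.
  move/eqP; rewrite sum_nat_eq0 => /forallP/(_ x)/implyP/(_ isT).
  by have := m0 x; case: (mult_cases P1 P2 x) => ->.
apply/setP=> x; rewrite inE; have := m1 x; rewrite /mult.
by case: (x \in P1); case: (x \in P2).
Qed.

(** The multiplicities have mean 1. *)
Lemma empty_double (n : nat) (P1 P2 : {set 'I_n}) u :
  (#|P1| + #|P2|)%N = n -> mult P1 P2 u = 0%N -> exists w, mult P1 P2 w = 2%N.
Proof.
move=> cP mu.
have [/existsP[w /eqP mw]|/existsPn none] := boolP [exists w, mult P1 P2 w == 2%N].
  by exists w.
have : (\sum_x mult P1 P2 x < \sum_(x < n) 1)%N.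
  apply: (ltn_sum_at (i0 := u)) => [x|]; last by rewrite mu.
  by have := none x; case: (mult_cases P1 P2 x) => -> .
by rewrite sum_mult cP sum1_card card_ord ltnn.
Qed.

(** Outer induction on the number of empty positions, inner induction on the distance from an empty
    [u] to a doubled [w]. The neighbour [v] of [u] towards [w] replaces [u] if it is empty, is
    swapped with [u] if single, and is split if doubled. *)
Lemma expandableP (n : nat) (P1 P2 Q1 Q2 I1 I2 J1 J2 : {set 'I_n}) :
  #|P1| = #|Q1| -> #|P2| = #|Q2| -> #|I1| = #|J1| -> #|I2| = #|J2| ->
  (#|P1| + #|P2|)%N = n ->
  pair_refines P1 P2 Q1 Q2 I1 I2 J1 J2 -> expandable Q1 Q2 J1 J2 P1 P2 I1 I2.
Proof.
move=> c1 c2 d1 d2 cP; have [k] := ubnP (empty_count P1 P2).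
elim: k P1 P2 I1 I2 c1 c2 d1 d2 cP => // k IH P1 P2 I1 I2 c1 c2 d1 d2 cP ltk ref.
have [/existsP[u /eqP mu]|/existsPn none] := boolP [exists u, mult P1 P2 u == 0%N]; last first.
  have eP : P2 = ~: P1 by exact: no_empty_complement.
  have eI : I2 = ~: I1.
    apply/setP=> x; rewrite inE; have [PI _ _] := ref; have := PI x; rewrite eP inE.
    by case: (x \in P1); case: (x \in I1); case: (x \in I2).
  by exists P1, I1, [::]; split=> //; rewrite -?eP -?eI.
have [w mw] := empty_double cP mu.
have [d] := ubnP ((u - w) + (w - u)).
elim: d u P1 P2 I1 I2 c1 c2 d1 d2 cP ltk ref mu mw => // d IHd u P1 P2 I1 I2.
move=> c1 c2 d1 d2 cP ltk ref mu mw ltd.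
have nuw : u != w by apply: contra_eq_neq mu => ->; rewrite mw.
have [v [adj vw]] : exists v : 'I_n, adjacent u v /\
    ((v - w) + (w - v) < (u - w) + (w - u))%N.
  move: nuw; rewrite -val_eqE /= neq_ltn => /orP[lt|lt].
    have lt' : (u.+1 < n)%N by apply: leq_trans (ltn_ord w).
    by exists (Ordinal lt'); rewrite /adjacent /= eqxx; split => //; lia.
  have lt' : (u.-1 < n)%N by have := ltn_ord u; lia.
  by exists (Ordinal lt'); rewrite /adjacent /= prednK ?eqxx ?orbT; [split => // | ]; lia.
have adj' : adjacent v u by rewrite adjacentC.
have nvu := adjacent_neq adj'.
have [PI _ _] := ref.
have mI x : mult I1 I2 x = mult P1 P2 x by rewrite /mult PI.
case: (mult_cases P1 P2 v) => mv.
- by apply: (IHd v) => //; exact: leq_trans vw ltd.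
- have ref' := pair_refines_swap adj mu mv ref.
  have sing X1 X2 : mult X1 X2 u = 0%N -> mult X1 X2 v = 1%N ->
      [/\ move_set u v (move_set v u X1) = X1, move_set u v (move_set v u X2) = X2,
        (movable u v (move_set v u X1) + movable u v (move_set v u X2) = 1)%N &
        mult (move_set v u X1) (move_set v u X2) =1 moved_mult v u (mult X1 X2)].
    move=> xu xv; have : (movable v u X1 /\ movable v u X2 = false) \/
        (movable v u X1 = false /\ movable v u X2).
      move: xu xv; rewrite /mult /movable; case: (u \in X1); case: (u \in X2) => // _.
      by case: (v \in X1); case: (v \in X2) => // _; [left | right].
    have uN : movable u v X1 = false /\ movable u v X2 = false.
      by move: xu; rewrite /mult /movable; case: (u \in X1); case: (u \in X2).
    case=> -[m1 m2].
      have [m1' e1] := move_setK m1; rewrite (notmovable_move_set m2) e1 m1'.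
      by rewrite uN.2 (notmovable_move_set uN.2); split=> // z; rewrite mult_moveL.
    have [m2' e2] := move_setK m2; rewrite (notmovable_move_set m1) e2 m2'.
    by rewrite uN.1 (notmovable_move_set uN.1); split=> // z; rewrite mult_moveR.
  have [eP1 eP2 mvP multP] := sing P1 P2 mu mv.
  have [eI1 eI2 mvI _] : _ := sing I1 I2 (etrans (mI u) mu) (etrans (mI v) mv).
  apply: (expandable_step adj (etrans mvP (esym mvI)) (esym eP1) (esym eP2)
    (esym eI1) (esym eI2)).
  have nvw : v != w by apply: contra_eq_neq mv => ->; rewrite mw.
  apply: (IHd v); rewrite ?card_move_set //.
  (* The swap replaces [u] by [v] among the empty positions, so their number is unchanged. *)
  + rewrite /empty_count (_ : [set x | _] = v |: ([set x | mult P1 P2 x == 0%N] :\ u)).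
      rewrite cardsU1 !inE mv /= andbF add1n.
      by move: ltk; rewrite /empty_count (cardsD1 u) inE mu eqxx.
    apply/setP=> z; rewrite !inE multP /moved_mult.
    have [->|zv] := eqVneq z v; first by rewrite mv.
    by have [->|zu] := eqVneq z u.
  + by rewrite multP /moved_mult eqxx mv.
  + by rewrite multP /moved_mult eq_sym (negPf nvw) eq_sym (negPf nuw).
  + exact: leq_trans vw ltd.
- have both X1 X2 : mult X1 X2 u = 0%N -> mult X1 X2 v = 2%N ->
      [/\ movable v u X1, movable v u X2, movable u v X1 = false & movable u v X2 = false].
    rewrite /mult /movable; case: (u \in X1); case: (u \in X2) => // _.
    by case: (v \in X1); case: (v \in X2).
  have [mP1 mP2 nP1 nP2] := both P1 P2 mu mv.
  have [mI1 mI2 nI1 nI2] : _ := both I1 I2 (etrans (mI u) mu) (etrans (mI v) mv).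
  have [mP1' eP1] := move_setK mP1.
  have [mI1' eI1] := move_setK mI1; have [mI2' eI2] := move_setK mI2.
  have lt' : (empty_count (move_set v u P1) P2 < k)%N.
    move: ltk; rewrite /empty_count (cardsD1 u) inE mu eqxx add1n ltnS.
    apply: leq_trans; rewrite ltnS; apply/subset_leq_card/subsetP => z.
    rewrite !inE mult_moveL //.
    have [->|zv] := eqVneq z v; first by rewrite mv.
    by have [->|zu] := eqVneq z u.
  case: (pair_refines_split c1 c2 d1 d2 adj mu mv ref) => ref'.
    apply: (@expandable_step _ u v _ _ _ _ _ _ _ _ (move_set v u P1) P2 (move_set v u I1) I2) => //.
    + by rewrite mP1' mI1' nP2 nI2.
    + by rewrite notmovable_move_set.
    + by rewrite notmovable_move_set.
    + by apply: IH => //; rewrite ?card_move_set.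
  apply: (@expandable_step _ u v _ _ _ _ _ _ _ _ (move_set v u P1) P2 I1 (move_set v u I2)) => //.
  + by rewrite mP1' mI2' nP2 nI1.
  + by rewrite notmovable_move_set.
  + by rewrite notmovable_move_set.
  + by apply: IH => //; rewrite ?card_move_set.
Qed.

Lemma pair_refines_tr (n : nat) (P1 P2 Q1 Q2 I1 I2 J1 J2 : {set 'I_n}) :
  pair_refines P1 P2 Q1 Q2 I1 I2 J1 J2 -> pair_refines Q1 Q2 P1 P2 J1 J2 I1 I2.
Proof.
case=> PI QJ ref; split=> // s t sn tn; have [rr cc _] := ref s t sn tn.
by have [_ _ rc] := ref t s tn sn; split=> // e; rewrite rc.
Qed.

Lemma row_ops_cons_same (n : nat) (u : 'I_n) s
    (X1 Y1 X2 Y2 Z1 W1 Z2 W2 : {set 'I_n}) :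
  row_ops ((u, u) :: s) (formal_ineq X1 Y1 X2 Y2 Z1 W1 Z2 W2) =
  row_ops s (formal_ineq X1 Y1 X2 Y2 Z1 W1 Z2 W2).
Proof.
rewrite /row_ops /=; have := row_op_formal u u X1 Y1 X2 Y2 Z1 W1 Z2 W2.
by rewrite /= /move_set !movable_same eqxx => ->.
Qed.

(** Columns are expanded after rows, against rows that are already complementary; this matches the
    composite, in which the column operations are applied first. *)
Lemma pair_refines_obtained (R : realType) (n : nat)
    (P1 P2 Q1 Q2 I1 I2 J1 J2 : {set 'I_n}) :
  (0 < n)%N ->
  #|P1| = #|Q1| -> #|P2| = #|Q2| -> #|I1| = #|J1| -> #|I2| = #|J2| ->
  (#|P1| + #|P2|)%N = n ->
  pair_refines P1 P2 Q1 Q2 I1 I2 J1 J2 ->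
  obtained_by_index_ops R P1 P2 Q1 Q2 I1 I2 J1 J2.
Proof.
move=> n0 c1 c2 d1 d2 cP ref; pose u0 := Ordinal n0.
have cI : (#|I1| + #|I2|)%N = n.
  apply: etrans cP; rewrite -!sum_mult; apply: eq_bigr => x _; rewrite /mult.
  by have [PI _ _] := ref; rewrite PI.
have compl (X Y : {set 'I_n}) k : #|X| = #|Y| -> (#|Y| + k)%N = n -> #|~: X| = k.
  move=> cXY cY; apply: (@addnI #|X|).
  by rewrite cardsC card_ord cXY cY.
have [P [I [rows [[eP eI] nr opsr ref1]]]] := expandableP c1 c2 d1 d2 cP ref.
have cP' := compl P P1 _ eP cP; have cI' := compl I I1 _ eI cI.
have [Q [J [cols [[eQ eJ] nc opsc ref2]]]] : expandable P (~: P) I (~: I) Q1 Q2 J1 J2.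
  apply: expandableP (pair_refines_tr ref1).
  - by rewrite eP.
  - by rewrite cP'.
  - by rewrite eI.
  - by rewrite cI'.
  - by rewrite -c1 -c2.
have cQ' : #|~: Q| = #|Q2| by apply: (compl Q Q1) => //; rewrite -c1 -c2.
have cJ' : #|~: J| = #|J2| by apply: (compl J J1) => //; rewrite -d1 -d2.
exists P, Q, I, J; split.
- by rewrite eP eQ eI eJ -c1 -d1.
- apply/tn_ineqP/pair_refines_tr => //.
  + by rewrite eP eQ.
  + by rewrite cP' cQ'.
  + by rewrite eI eJ.
  + by rewrite cI' cJ'.
(* The identity operation is prepended because both lists must be nonempty. *)
- exists ((u0, u0) :: rows), ((u0, u0) :: cols).
  split=> //; try by rewrite /= near_pairP eqxx ?nr ?nc.
  by rewrite -swap_formal col_ops_swap row_ops_cons_same opsc swap_formal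
    row_ops_cons_same opsr.
Qed.

Theorem theoremK (R : realType) (n : nat)
    (P1 P2 Q1 Q2 I1 I2 J1 J2 : {set 'I_n}) (n_gt0 : (1 <= n)%N)
    (P1n0 : P1 != set0) (P2n0 : P2 != set0)
    (Q1n0 : Q1 != set0) (Q2n0 : Q2 != set0)
    (I1n0 : I1 != set0) (I2n0 : I2 != set0)
    (J1n0 : J1 != set0) (J2n0 : J2 != set0)
    (cardPQ1 : #|P1| = #|Q1|) (cardPQ2 : #|P2| = #|Q2|)
    (cardIJ1 : #|I1| = #|J1|) (cardIJ2 : #|I2| = #|J2|)
    (cardP : (#|P1| + #|P2|)%N = n) (cardI : (#|I1| + #|I2|)%N = n) :
  let R1 := double_set P1 Q2 in
  let R2 := double_set P2 Q1 in
  let K1 := double_set I1 J2 in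
  let K2 := double_set I2 J1 in
  [/\ obtained_by_index_ops R P1 P2 Q1 Q2 I1 I2 J1 J2 <->
        tn_ineq R P1 P2 Q1 Q2 I1 I2 J1 J2,
      obtained_by_index_ops R P1 P2 Q1 Q2 I1 I2 J1 J2 <-> principal_tn_ineq R R1 R2 K1 K2
    & obtained_by_index_ops R P1 P2 Q1 Q2 I1 I2 J1 J2 <-> contiguous_set_condition R1 R2 K1 K2].
Proof.
(* Every statement is compared with [pair_refines]. *)
have obtainedP : obtained_by_index_ops R P1 P2 Q1 Q2 I1 I2 J1 J2 <->
    pair_refines P1 P2 Q1 Q2 I1 I2 J1 J2.
  split=> [/index_ops_tn_ineq/tn_ineqP|]; first exact.
  exact: pair_refines_obtained.
move=> R1 R2 K1 K2; split.
- by rewrite tn_ineqP.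
- by rewrite principal_tn_ineqP refines_doubleP.
- by rewrite contiguous_set_conditionP refines_doubleP.
Qed.
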